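(* Let $0<l<L$. The set of critical points of $\mathcal{W}$ in $\mathcal{A}_{l,L}$ is $$\Big\{\gamma\in\mathcal{A}_{l,L} \ :\ \tilde\gamma \text{ is } \hat\gamma_n^{+}\text{ or }\hat\gamma_n^{-}\text{ or }\check\gamma_n^{+}\text{ or }\check\gamma_n^{-}\text{ for some } n\in\mathbb{N}\cup\{0\}\Big\},$$ where $\tilde\gamma$ is the arc length reparameterization of $\gamma$ and: (i) $\hat\gamma_n^{\pm}(s)=(\hat X_n(s),\pm\hat Y_n(s))$ for $s\in[0,L]$, with $$\hat X_n(s)=2\hat p^2\int_0^s \mathrm{cn}\Big(\tfrac{2(n+1)\mathrm{K}(\hat p)}{L}t+\mathrm{K}(\hat p),\hat p\Big)^2dt+(1-2\hat p^2)s,$$ $$\hat Y_n(s)=-\frac{\hat p L}{(n+1)\mathrm{K}(\hat p)}\,\mathrm{cn}\Big(\tfrac{2(n+1)\mathrm{K}(\hat p)}{L}s+\mathrm{K}(\hat p),\hat p\Big),$$ where $\hat p\in(0,1)$ is uniquely determined as the solution of $2\,\mathrm{E}(p)/\mathrm{K}(p)-1=l/L$; (ii) $\check\gamma_n^{\pm}(s)=(\check X_n(s),\pm\check Y_n(s))$ for $s\in[0,L]$, with $$\check X_n(s)=-2\check p^2\int_0^s \mathrm{cn}\Big(\tfrac{2(n+1)\mathrm{K}(\check p)}{L}t-\mathrm{K}(\check p),\check p\Big)^2dt-(1-2\check p^2)s,$$ $$\check Y_n(s)=\frac{\check p L}{(n+1)\mathrm{K}(\check p)}\,\mathrm{cn}\Big(\tfrac{2(n+1)\mathrm{K}(\check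 p)}{L}s-\mathrm{K}(\check p),\check p\Big),$$ where $\check p\in(0,1)$ is uniquely determined as the solution of $-2\,\mathrm{E}(p)/\mathrm{K}(p)+1=l/L$.
   Context: For given $0<l<L$, $\mathcal{A}_{l,L}$ is the set of $\gamma\in C^\infty([0,1];\mathbb{R}^2)$ with $\gamma(0)=(0,0)$, $\gamma(1)=(l,0)$, $\gamma'(t)\neq0$ for all $t\in[0,1]$, and $\mathcal{L}(\gamma)=L$, where $\mathcal{L}$ denotes length. The elastic energy is $\mathcal{W}(\gamma)=\int_\gamma\kappa^2\,ds$, where $s$ is arc length and $\kappa$ the (signed) curvature. The arc length reparameterization of $\gamma\in\mathcal{A}_{l,L}$ is denoted $\tilde\gamma:[0,L]\to\mathbb{R}^2$. A curve $\gamma\in\mathcal{A}_{l,L}$ is a critical point of $\mathcal{W}$ in $\mathcal{A}_{l,L}$ if (in the sense of Lagrange multipliers) there is $\lambda\in\mathbb{R}$ such that $\frac{d}{d\varepsilon}\big(\mathcal{W}(\gamma_\varepsilon)+\lambda\mathcal{L}(\gamma_\varepsilon)\big)\big|_{\varepsilon=0}=0$ for every smooth family $(\gamma_\varepsilon)_{|\varepsilon|<\varepsilon_0}$ of curves with $\gamma_0=\gamma$ (up to parameterization) and with endpoints fixed at $(0,0)$ and $(l,0)$. Complete elliptic integrals with modulus $p\in[0,1)$: $\mathrm{K}(p)=\int_0^1\frac{dz}{\sqrt{1-z^2}\sqrt{1-p^2z^2}}$ and $\mathrm{E}(p)=\int_0^1\frac{\sqrt{1-p^2z^2}}{\sqrt{1-z^2}}\,dz$.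 The Jacobi elliptic function is $\mathrm{cn}(x,p)=\cos\phi$, where $\phi=\mathrm{am}(x,p)$ is the inverse function of $x(\phi)=\int_0^\phi\frac{d\theta}{\sqrt{1-p^2\sin^2\theta}}$. *)

(* Defs.v *)
From Stdlib Require Export Reals.
From Coquelicot Require Export Coquelicot.

Open Scope R_scope.

(** * Calculus on a closed interval [[a, b]]

    This is Coquelicot's [is_derive] with [locally t] replaced by its trace on
    [[a, b]]: the derivative is one-sided at [a] and [b], and the values of [f]
    outside [[a, b]] play no role. *)

Definition is_derive_in (a b : R) (f : R -> R) (t v : R) : Prop :=
  filterdiff f (within (fun u => a <= u <= b) (locally t)) (fun h => scal h v).

Definition ex_derive_in (a b : R) (f : R -> R) (t : R) : Prop :=
  exists v : R, is_derive_in a b f t v.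

Definition Derive_in (a b : R) (f : R -> R) (t : R) : R :=
  iota (is_derive_in a b f t).

Definition smooth_in (a b : R) (f : R -> R) : Prop :=
  forall (n : nat) (t : R), a <= t <= b ->
    ex_derive_in a b (Nat.iter n (Derive_in a b) f) t.

(** * Plane curves

    A curve on [[a, b]] is a function [R -> R * R] of which only the values on
    [[a, b]] matter. *)

Definition xcoord (g : R -> R * R) (t : R) : R := fst (g t).
Definition ycoord (g : R -> R * R) (t : R) : R := snd (g t).

Definition smooth_curve (a b : R) (g : R -> R * R) : Prop :=
  smooth_in a b (xcoord g) /\ smooth_in a b (ycoord g).

Definition velocity (a b : R) (g : R -> R * R) (t : R) : R * R :=
  (Derive_in a b (xcoord g) t, Derive_in a b (ycoord g) t).

Definition acceleration (a b : R) (g : R -> R * R) : R -> R * R :=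
  velocity a b (velocity a b g).

Definition regular_curve (a b : R) (g : R -> R * R) : Prop :=
  forall t : R, a <= t <= b -> velocity a b g t <> (0, 0).

Definition speed (a b : R) (g : R -> R * R) (t : R) : R :=
  sqrt (fst (velocity a b g t) ^ 2 + snd (velocity a b g t) ^ 2).

Definition curve_length (a b : R) (g : R -> R * R) : R :=
  RInt (speed a b g) a b.

Definition curvature (a b : R) (g : R -> R * R) (t : R) : R :=
  (fst (velocity a b g t) * snd (acceleration a b g t)
   - snd (velocity a b g t) * fst (acceleration a b g t))
  / speed a b g t ^ 3.

(** The arc length element is [ds = speed dt]. *)
Definition elastic_energy (a b : R) (g : R -> R * R) : R :=
  RInt (fun t => curvature a b g t ^ 2 * speed a b g t) a b.

Definition admissible (l L : R) (g : R -> R * R) : Prop :=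
  smooth_curve 0 1 g /\ g 0 = (0, 0) /\ g 1 = (l, 0) /\
  regular_curve 0 1 g /\ curve_length 0 1 g = L.

(** For a regular curve on [[0, 1]] and [s] between 0 and its length, the
    parameter [t] below is unique. *)
Definition arclength_reparam (g : R -> R * R) (s : R) : R * R :=
  g (iota (fun t : R => 0 <= t <= 1 /\ RInt (speed 0 1 g) 0 t = s)).

(** * Smooth families of curves and critical points *)

Definition family_domain (e0 a b : R) (z : R * R) : Prop :=
  Rabs (fst z) < e0 /\ a <= snd z <= b.

Definition D_eps (F : R -> R -> R) (e t : R) : R :=
  Derive (fun e' => F e' t) e.

Definition D_par (a b : R) (F : R -> R -> R) (e t : R) : R :=
  Derive_in a b (F e) t.

(** [F] is of class C^k, jointly in both variables, on [(-e0, e0) * [a, b]]. *)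
Fixpoint class_C (k : nat) (e0 a b : R) (F : R -> R -> R) : Prop :=
  continuous_on (family_domain e0 a b) (fun z => F (fst z) (snd z)) /\
  match k with
  | O => True
  | S k' =>
      (forall e t : R, Rabs e < e0 -> a <= t <= b ->
         ex_derive (fun e' => F e' t) e /\ ex_derive_in a b (F e) t) /\
      class_C k' e0 a b (D_eps F) /\ class_C k' e0 a b (D_par a b F)
  end.

Definition smooth_family (e0 a b : R) (G : R -> R -> R * R) : Prop :=
  forall k : nat,
    class_C k e0 a b (fun e => xcoord (G e)) /\
    class_C k e0 a b (fun e => ycoord (G e)).

(** [h], defined on [[a, b]], is [g], defined on [[0, 1]], up to an
    orientation-preserving smooth change of parameter. *)
Definition reparametrization (a b : R) (g h : R -> R * R) : Prop :=
  exists phi : R -> R,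
    smooth_in a b phi /\ phi a = 0 /\ phi b = 1 /\
    (forall t : R, a <= t <= b -> 0 < Derive_in a b phi t) /\
    (forall t : R, a <= t <= b -> h t = g (phi t)).

Definition admissible_family (l : R) (g : R -> R * R) (e0 a b : R)
    (G : R -> R -> R * R) : Prop :=
  smooth_family e0 a b G /\
  (forall e : R, Rabs e < e0 ->
     regular_curve a b (G e) /\ G e a = (0, 0) /\ G e b = (l, 0)) /\
  reparametrization a b g (G 0).

(** The parameter interval [[a, b]] of a family is arbitrary, so that
    variations of the arc length parameterization are included. *)
Definition critical_point (l L : R) (g : R -> R * R) : Prop :=
  admissible l L g /\
  exists lambda : R,
    forall (e0 a b : R) (G : R -> R -> R * R),
      0 < e0 -> a < b -> admissible_family l g e0 a b G ->
      is_derive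
        (fun e => elastic_energy a b (G e) + lambda * curve_length a b (G e))
        0 0.

(** * Elliptic integrals and the Jacobi function cn, with modulus [p] *)

(** Both integrals are improper at 1. *)
Definition ellK (p : R) : R :=
  RInt_gen (fun z => 1 / (sqrt (1 - z ^ 2) * sqrt (1 - p ^ 2 * z ^ 2)))
    (at_point 0) (at_left 1).

Definition ellE (p : R) : R :=
  RInt_gen (fun z => sqrt (1 - p ^ 2 * z ^ 2) / sqrt (1 - z ^ 2))
    (at_point 0) (at_left 1).

Definition am (x p : R) : R :=
  iota (fun phi : R =>
    RInt (fun theta => 1 / sqrt (1 - p ^ 2 * sin theta ^ 2)) 0 phi = x).

Definition cn (x p : R) : R := cos (am x p).

(** * The explicit critical curves *)

Definition hat_modulus (l L p : R) : Prop :=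
  0 < p < 1 /\ 2 * (ellE p / ellK p) - 1 = l / L.

Definition check_modulus (l L p : R) : Prop :=
  0 < p < 1 /\ - 2 * (ellE p / ellK p) + 1 = l / L.

Definition X_hat (L p : R) (n : nat) (s : R) : R :=
  2 * p ^ 2
    * RInt (fun t => cn (2 * (INR n + 1) * ellK p / L * t + ellK p) p ^ 2) 0 s
  + (1 - 2 * p ^ 2) * s.

Definition Y_hat (L p : R) (n : nat) (s : R) : R :=
  - (p * L / ((INR n + 1) * ellK p))
    * cn (2 * (INR n + 1) * ellK p / L * s + ellK p) p.

Definition X_check (L p : R) (n : nat) (s : R) : R :=
  - 2 * p ^ 2
    * RInt (fun t => cn (2 * (INR n + 1) * ellK p / L * t - ellK p) p ^ 2) 0 s
  - (1 - 2 * p ^ 2) * s.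

Definition Y_check (L p : R) (n : nat) (s : R) : R :=
  p * L / ((INR n + 1) * ellK p)
    * cn (2 * (INR n + 1) * ellK p / L * s - ellK p) p.

Definition hat_plus (L p : R) (n : nat) (s : R) : R * R :=
  (X_hat L p n s, Y_hat L p n s).
Definition hat_minus (L p : R) (n : nat) (s : R) : R * R :=
  (X_hat L p n s, - Y_hat L p n s).
Definition check_plus (L p : R) (n : nat) (s : R) : R * R :=
  (X_check L p n s, Y_check L p n s).
Definition check_minus (L p : R) (n : nat) (s : R) : R * R :=
  (X_check L p n s, - Y_check L p n s).

Definition equal_on (a b : R) (g h : R -> R * R) : Prop :=
  forall s : R, a <= s <= b -> g s = h s.

(* Main.v *)
Require Import Defs.
From Stdlib Require Import ZArith Lra Lia FunctionalExtensionality.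

(** The argument rests on a first integral of the Euler-Lagrange equation that
    comes from the translation invariance of length and energy.

    Write v for the speed of a curve, T for its unit tangent, N for T turned by
    a right angle, k for the curvature and a subscript s for the arc length
    derivative d/(v dt).  For a variation field eta, the derivative of
    [elastic_energy + lam * curve_length] is the integral of
    [2 k N.(eta' / v)' - (3 k^2 - lam) T.eta'] (lemma [first_variation]).  Only
    derivatives of eta occur, since a translation changes nothing; so one
    integration by parts suffices to see that g is critical with multiplier lam
    exactly when the vector [2 k_s N + (k^2 - lam) T] is a constant C and k
    vanishes at both ends.  Its tangential component is [k^2 - lam = C.T]; its
    normal component, [2 k_s = C.N], integrates to [2 k = C_2 x - C_1 y].  As y
    and k vanish at both ends while x goes from 0 to l > 0, the second
    component of C is 0.  Criticality thus amounts to the pair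
    [k = - C y / 2], [k^2 - lam = C T_x] ([elastica_equations]), by
    [critical_elastica] in one direction and [elastica_critical] in the other.
    These relations do not depend on the parametrization.  Everything is
    differentiated with respect to the given parameter t, and arc length enters
    only as the function [arclength g] of t: its inverse is never
    differentiated.

    The two relations say that T_x is a quadratic polynomial in y, whence, with
    respect to arc length, y solves an equation [y'' = alpha y + beta y^3]
    with [y = 0] at the start ([height_equation]).  The degenerate cases C = 0
    and zero initial slope give segments, excluded by l < L.  In the
    remaining case an elliptic cosine solves the same initial value problem:
    the modulus p is read off the initial direction, the frequency omega off
    the modulus of C, and two signs off C and the initial slope.
    Uniqueness identifies the curve up to these two reflections with
    [(wave_X, wave_Y)] ([elastica_is_wave]).  The end condition y = 0
    quantizes the frequency, omega L = 2 (n + 1) K(p), and the end condition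
    x = l then reads 2 E(p) / K(p) - 1 = l / L or - l / L according to the sign
    of C.  Conversely these waves satisfy the two relations ([wave_elastica]).
    Since [cn (u - K) = - cn (u + K)], the check curves are the mirror images
    of hat curves with the other modulus.

    Each of the two modulus equations has exactly one solution because E / K
    decreases continuously on (0, 1), from 1 down to 0 ([modulus_exists],
    [modulus_unique]). *)

(** * Calculus on a closed interval *)

Definition clamp (a b t : R) : R := Rmax a (Rmin b t).

(** Continuity of the restriction of [f] to [[a, b]], expressed by the extension
    of that restriction that is constant on either side, so that the theory of
    continuous functions on the whole line applies to it. *)
Definition cont_in (a b : R) (f : R -> R) : Prop :=
  forall t : R, continuous (fun u => f (clamp a b u)) t.

Lemma clamp_bounds a b t : a <= b -> a <= clamp a b t <= b.
Proof.
  intros. unfold clamp, Rmax, Rmin.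
  destruct (Rle_dec b t), (Rle_dec a b), (Rle_dec a t); lra.
Qed.

Lemma clamp_id a b t : a <= t <= b -> clamp a b t = t.
Proof.
  intros. unfold clamp. rewrite Rmin_right by lra. apply Rmax_right; lra.
Qed.

Lemma clamp_lipschitz a b s t : Rabs (clamp a b s - clamp a b t) <= Rabs (s - t).
Proof.
  unfold clamp, Rmax, Rmin.
  destruct (Rle_dec b t), (Rle_dec b s);
  repeat match goal with |- context [Rle_dec ?x ?y] => destruct (Rle_dec x y) end;
  unfold Rabs; repeat destruct Rcase_abs; lra.
Qed.

Lemma continuous_clamp a b t : continuous (clamp a b) t.
Proof.
  intros P [d Hd]. exists d. intros u Hu. apply Hd.
  change (Rabs (clamp a b u - clamp a b t) < d).
  eapply Rle_lt_trans; [apply clamp_lipschitz | exact Hu].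
Qed.

Section Interval.
Context {a b : R} (ab : a < b).

Lemma within_interval_proper t : a <= t <= b ->
  ProperFilter' (within (fun u => a <= u <= b) (locally t)).
Proof.
  intros Ht. constructor.
  - intros [d Hd]. exact (Hd t (ball_center t d) Ht).
  - apply within_filter, locally_filter.
Qed.

(** A one-sided derivative is the ordinary derivative of some extension of [f]:
    continue [f] by its tangent line at [t].  Through this equivalence every
    rule of differentiation carries over from the line to the interval. *)
Lemma is_derive_in_iff t v f : a <= t <= b ->
  is_derive_in a b f t v <->
  exists F, (forall u, a <= u <= b -> F u = f u) /\ is_derive F t v.
Proof.
  intros Ht. split.
  - intros [Hlin H].
    exists (fun u => if Rle_dec a u then if Rle_dec u b then f u
              else f t + (u - t) * v else f t + (u - t) * v).
    split.
    { intros u Hu. destruct (Rle_dec a u), (Rle_dec u b); lra. }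
    split; [exact Hlin|].
    intros x Hx eps.
    assert (Hxt : x = t) by (symmetry; exact (is_filter_lim_locally_unique t x Hx)).
    subst x.
    assert (Hx' : is_filter_lim (within (fun u => a <= u <= b) (locally t)) t).
    { intros P HP. apply filter_le_within. exact HP. }
    specialize (H t Hx' eps). unfold within in H.
    revert H. apply filter_imp. intros u Hu.
    destruct (Rle_dec a t); [|lra]. destruct (Rle_dec t b); [|lra].
    destruct (Rle_dec a u) as [h1|h1]; [destruct (Rle_dec u b) as [h2|h2]|].
    + exact (Hu (conj h1 h2)).
    + replace (minus _ _) with (0 : R).
      2:{ unfold minus, plus, opp, scal; simpl; unfold mult; simpl; ring. }
      change (Rabs 0 <= eps * Rabs (u - t)). rewrite Rabs_R0.
      apply Rmult_le_pos; [left; apply cond_pos | apply Rabs_pos].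
    + replace (minus _ _) with (0 : R).
      2:{ unfold minus, plus, opp, scal; simpl; unfold mult; simpl; ring. }
      change (Rabs 0 <= eps * Rabs (u - t)). rewrite Rabs_R0.
      apply Rmult_le_pos; [left; apply cond_pos | apply Rabs_pos].
  - intros [F [HF [Hlin H]]]. split; [exact Hlin|].
    intros x Hx eps.
    assert (Hx' : is_filter_lim (within (fun u => a <= u <= b) (locally t)) t).
    { intros P HP. apply filter_le_within. exact HP. }
    assert (x = t).
    { exact (@is_filter_lim_unique _ R_NormedModule _ (within_interval_proper t Ht) x t Hx Hx'). }
    subst x.
    specialize (H t (fun P HP => HP) eps). unfold within.
    revert H. apply filter_imp. intros u Hu Hab.
    rewrite <- (HF u Hab), <- (HF t Ht). exact Hu.
Qed.

Lemma is_derive_in_of_is_derive f t v : a <= t <= b ->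
  is_derive f t v -> is_derive_in a b f t v.
Proof. intros. apply is_derive_in_iff; auto. exists f; auto. Qed.

Lemma is_derive_eps F t v : is_derive F t v ->
  forall eps, 0 < eps -> exists d, 0 < d /\
  forall u, Rabs (u - t) < d -> Rabs (F u - F t - (u - t) * v) <= eps * Rabs (u - t).
Proof.
  intros [_ H] eps Heps.
  destruct (H t (fun P HP => HP) (mkposreal eps Heps)) as [d Hd].
  exists d. split; [apply cond_pos|]. intros u Hu. exact (Hd u Hu).
Qed.

Lemma is_derive_in_unique t f v w : a <= t <= b ->
  is_derive_in a b f t v -> is_derive_in a b f t w -> v = w.
Proof.
  intros Ht Hv Hw.
  apply is_derive_in_iff in Hv; auto. apply is_derive_in_iff in Hw; auto.
  destruct Hv as [F [HF HFv]], Hw as [G [HG HGw]].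
  destruct (Req_dec v w) as [|Hne]; auto. exfalso.
  set (eps := Rabs (v - w) / 4).
  assert (Hp : 0 < Rabs (v - w)) by (apply Rabs_pos_lt; lra).
  assert (He : 0 < eps) by (unfold eps; lra).
  destruct (is_derive_eps _ _ _ HFv eps He) as [d1 [Hd1 H1]].
  destruct (is_derive_eps _ _ _ HGw eps He) as [d2 [Hd2 H2]].
  assert (exists u, a <= u <= b /\ u <> t /\ Rabs (u - t) < d1 /\ Rabs (u - t) < d2)
    as [u [Hu [Hut [Hu1 Hu2]]]].
  { set (m := Rmin (Rmin (d1 / 2) (d2 / 2)) ((b - a) / 2)).
    assert (0 < m) by (unfold m; repeat apply Rmin_glb_lt; lra).
    assert (m <= d1 / 2) by (unfold m; eapply Rle_trans; [apply Rmin_l|apply Rmin_l]).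
    assert (m <= d2 / 2) by (unfold m; eapply Rle_trans; [apply Rmin_l|apply Rmin_r]).
    assert (m <= (b - a) / 2) by (unfold m; apply Rmin_r).
    destruct (Rle_dec t ((a + b) / 2)).
    - exists (t + m). replace (t + m - t) with m by ring. rewrite Rabs_pos_eq; lra.
    - exists (t - m). replace (t - m - t) with (- m) by ring.
      rewrite Rabs_Ropp, Rabs_pos_eq; lra. }
  specialize (H1 u Hu1). specialize (H2 u Hu2).
  rewrite !HF in H1 by auto. rewrite !HG in H2 by auto.
  assert (0 < Rabs (u - t)) by (apply Rabs_pos_lt; lra).
  assert (Rabs ((u - t) * (v - w)) <= 2 * eps * Rabs (u - t)).
  { replace ((u - t) * (v - w)) with
      ((f u - f t - (u - t) * w) - (f u - f t - (u - t) * v)) by ring.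
    eapply Rle_trans; [apply Rabs_triang|]. rewrite Rabs_Ropp. lra. }
  rewrite Rabs_mult in H0. unfold eps in H0. nra.
Qed.

Lemma Derive_in_eq t f v : a <= t <= b ->
  is_derive_in a b f t v -> Derive_in a b f t = v.
Proof.
  intros Ht H. unfold Derive_in.
  apply (is_derive_in_unique t f); auto.
  apply (iota_correct (V := R_CompleteNormedModule) (is_derive_in a b f t)).
  exists v; split; auto. intros w Hw. eapply is_derive_in_unique; eauto.
Qed.

Lemma Derive_in_correct t f : a <= t <= b ->
  ex_derive_in a b f t -> is_derive_in a b f t (Derive_in a b f t).
Proof. intros Ht [v Hv]. rewrite (Derive_in_eq t f v); auto. Qed.

Lemma is_derive_in_ext t f g v : a <= t <= b ->
  (forall u, a <= u <= b -> f u = g u) ->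
  is_derive_in a b f t v -> is_derive_in a b g t v.
Proof.
  intros Ht Hfg H. apply is_derive_in_iff in H; auto. apply is_derive_in_iff; auto.
  destruct H as [F [HF HFv]]. exists F; split; auto. intros u Hu. rewrite HF; auto.
Qed.

Lemma Derive_in_ext t f g : a <= t <= b -> ex_derive_in a b f t ->
  (forall u, a <= u <= b -> f u = g u) -> Derive_in a b g t = Derive_in a b f t.
Proof.
  intros Ht Hex Hfg. apply Derive_in_eq; auto.
  apply (is_derive_in_ext t f); auto. apply Derive_in_correct; auto.
Qed.

Lemma is_derive_in_const c t : a <= t <= b -> is_derive_in a b (fun _ => c) t 0.
Proof. intros. apply is_derive_in_of_is_derive; auto. apply (is_derive_const (V := R_NormedModule)). Qed.

Lemma is_derive_in_id t : a <= t <= b -> is_derive_in a b (fun u => u) t 1.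
Proof. intros. apply is_derive_in_of_is_derive; auto. apply (is_derive_id (K := R_AbsRing)). Qed.

Lemma is_derive_in_plus f g t v w : a <= t <= b ->
  is_derive_in a b f t v -> is_derive_in a b g t w ->
  is_derive_in a b (fun u => f u + g u) t (v + w).
Proof.
  intros Ht Hf Hg. apply is_derive_in_iff in Hf; auto. apply is_derive_in_iff in Hg; auto.
  destruct Hf as [F [HF HFv]], Hg as [G [HG HGw]].
  apply is_derive_in_iff; auto. exists (fun u => F u + G u). split.
  - intros u Hu. rewrite HF, HG; auto.
  - apply (is_derive_plus (V := R_NormedModule)); auto.
Qed.

Lemma is_derive_in_mult f g t v w : a <= t <= b ->
  is_derive_in a b f t v -> is_derive_in a b g t w ->
  is_derive_in a b (fun u => f u * g u) t (v * g t + f t * w).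
Proof.
  intros Ht Hf Hg. apply is_derive_in_iff in Hf; auto. apply is_derive_in_iff in Hg; auto.
  destruct Hf as [F [HF HFv]], Hg as [G [HG HGw]].
  apply is_derive_in_iff; auto. exists (fun u => F u * G u). split.
  - intros u Hu. rewrite HF, HG; auto.
  - rewrite <- HF, <- HG by auto.
    apply (is_derive_mult (K := R_AbsRing) F G); auto. intros n m; apply Rmult_comm.
Qed.

Lemma is_derive_in_outer f t v H dH : a <= t <= b ->
  is_derive_in a b f t v -> is_derive H (f t) dH ->
  is_derive_in a b (fun u => H (f u)) t (v * dH).
Proof.
  intros Ht Hf HH. apply is_derive_in_iff in Hf; auto.
  destruct Hf as [F [HF HFv]].
  apply is_derive_in_iff; auto. exists (fun u => H (F u)). split.
  - intros u Hu. rewrite HF; auto.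
  - rewrite <- HF in HH by auto.
    exact (is_derive_comp (V := R_NormedModule) H F t dH v HH HFv).
Qed.

(** The extension by tangent lines at both ends.  Unlike the one behind
    [is_derive_in_iff] it serves all points at once, which makes the mean value
    theorem and the fundamental theorem of calculus available. *)
Definition C1_extension (f df : R -> R) (u : R) : R :=
  f (clamp a b u) + (u - clamp a b u) * df (clamp a b u).

Lemma is_derive_C1_extension f df :
  (forall t, a <= t <= b -> is_derive_in a b f t (df t)) ->
  forall t, is_derive (C1_extension f df) t (df (clamp a b t)).
Proof.
  intros H t.
  pose proof (clamp_bounds a b t (Rlt_le _ _ ab)) as Hc.
  destruct (Rlt_dec t a) as [h|h].
  { apply (is_derive_ext_loc (fun u => f a + (u - a) * df a)).
    - exists (mkposreal (a - t) (proj2 (Rlt_0_minus _ _) h)). intros u Hu.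
      apply Rabs_def2 in Hu. simpl in Hu. unfold minus, plus, opp in Hu; simpl in Hu.
      unfold C1_extension. assert (E : clamp a b u = a).
      { unfold clamp. rewrite Rmin_right by lra. apply Rmax_left; lra. }
      rewrite E. reflexivity.
    - replace (clamp a b t) with a. 2:{ unfold clamp. rewrite Rmin_right, Rmax_left; lra. }
      auto_derive; auto; ring. }
  destruct (Rlt_dec b t) as [h'|h'].
  { apply (is_derive_ext_loc (fun u => f b + (u - b) * df b)).
    - exists (mkposreal (t - b) (proj2 (Rlt_0_minus _ _) h')). intros u Hu.
      apply Rabs_def2 in Hu. simpl in Hu. unfold minus, plus, opp in Hu; simpl in Hu.
      unfold C1_extension. assert (E : clamp a b u = b).
      { unfold clamp. rewrite Rmin_left by lra. apply Rmax_right; lra. }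
      rewrite E. reflexivity.
    - replace (clamp a b t) with b. 2:{ unfold clamp. rewrite Rmin_left, Rmax_right; lra. }
      auto_derive; auto; ring. }
  assert (Ht : a <= t <= b) by lra.
  rewrite (clamp_id a b t Ht).
  (* at an end point, the linear piece and [f] have the same one-sided derivative *)
  specialize (H t Ht). apply is_derive_in_iff in H; auto. destruct H as [F [HF HFv]].
  split; [apply is_linear_scal_l|].
  intros x Hx eps.
  assert (Hxt : x = t) by (symmetry; exact (is_filter_lim_locally_unique t x Hx)).
  subst x.
  destruct (is_derive_eps F t (df t) HFv eps (cond_pos eps)) as [d [Hd H1]].
  assert (Hloc : locally t (fun u => Rabs (u - t) < d /\ (a < t -> a < u) /\ (t < b -> u < b))).
  { apply filter_and; [exists (mkposreal d Hd); intros u Hu; exact Hu|].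
    apply filter_and.
    - destruct (Rlt_dec a t) as [h1|h1].
      + generalize (open_gt a t h1). apply filter_imp. auto.
      + apply filter_forall. intros; lra.
    - destruct (Rlt_dec t b) as [h1|h1].
      + generalize (open_lt b t h1). apply filter_imp. auto.
      + apply filter_forall. intros; lra. }
  revert Hloc. apply filter_imp. intros u [Hu [Hu1 Hu2]].
  change (Rabs (C1_extension f df u - C1_extension f df t - (u - t) * df t) <= eps * Rabs (u - t)).
  unfold C1_extension at 2. rewrite (clamp_id a b t Ht).
  replace (t - t) with 0 by ring. rewrite Rmult_0_l, Rplus_0_r.
  unfold C1_extension.
  destruct (Rlt_dec u a) as [h1|h1]; [|destruct (Rlt_dec b u) as [h2|h2]].
  - assert (Et : t = a) by (destruct (Rlt_dec a t); [specialize (Hu1 r); lra | lra]).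
    assert (E : clamp a b u = a).
    { unfold clamp. rewrite Rmin_right by lra. apply Rmax_left; lra. }
    rewrite E, Et. replace (_ - _ - _) with 0 by ring. rewrite Rabs_R0.
    apply Rmult_le_pos; [left; apply cond_pos | apply Rabs_pos].
  - assert (Et : t = b) by (destruct (Rlt_dec t b); [specialize (Hu2 r); lra | lra]).
    assert (E : clamp a b u = b).
    { unfold clamp. rewrite Rmin_left by lra. apply Rmax_right; lra. }
    rewrite E, Et. replace (_ - _ - _) with 0 by ring. rewrite Rabs_R0.
    apply Rmult_le_pos; [left; apply cond_pos | apply Rabs_pos].
  - rewrite clamp_id by lra. replace (u - u) with 0 by ring. rewrite Rmult_0_l, Rplus_0_r.
    rewrite <- !HF by lra. apply H1; auto.
Qed.

Lemma C1_extension_eq f df t : a <= t <= b -> C1_extension f df t = f t.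
Proof. intros. unfold C1_extension. rewrite clamp_id by auto. ring. Qed.

Lemma cont_in_ext f g : (forall t, a <= t <= b -> f t = g t) -> cont_in a b f -> cont_in a b g.
Proof.
  intros H Hf t. eapply continuous_ext; [|apply Hf].
  intros u. simpl. apply H, clamp_bounds. lra.
Qed.

Lemma cont_in_of_continuous f : (forall t, a <= t <= b -> continuous f t) -> cont_in a b f.
Proof.
  intros H t. apply (continuous_comp (clamp a b) f); [apply continuous_clamp|].
  apply H, clamp_bounds; lra.
Qed.

Lemma cont_in_of_ex_derive_in f : (forall t, a <= t <= b -> ex_derive_in a b f t) -> cont_in a b f.
Proof.
  intros H. apply (cont_in_ext (C1_extension f (Derive_in a b f))).
  - intros; apply C1_extension_eq; auto.
  - apply cont_in_of_continuous. intros t Ht.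
    apply (ex_derive_continuous (V := R_NormedModule)). exists (Derive_in a b f (clamp a b t)).
    apply is_derive_C1_extension. intros; apply Derive_in_correct; auto.
Qed.

Lemma cont_in_const c : cont_in a b (fun _ => c).
Proof. intros t. apply continuous_const. Qed.

Lemma cont_in_plus f g : cont_in a b f -> cont_in a b g -> cont_in a b (fun t => f t + g t).
Proof. intros Hf Hg t. apply (continuous_plus (V := R_NormedModule)); auto. Qed.

Lemma cont_in_mult f g : cont_in a b f -> cont_in a b g -> cont_in a b (fun t => f t * g t).
Proof. intros Hf Hg t. apply (continuous_mult (K := R_AbsRing)); auto. Qed.

Lemma cont_in_is_RInt f c d : cont_in a b f -> a <= c <= b -> a <= d <= b ->
  is_RInt f c d (RInt f c d).
Proof.
  intros Hf Hc Hd. apply (RInt_correct (V := R_CompleteNormedModule)).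
  apply (ex_RInt_ext (V := R_NormedModule) (fun u => f (clamp a b u))).
  - intros x Hx. rewrite clamp_id; auto.
    unfold Rmin, Rmax in Hx. destruct (Rle_dec c d); lra.
  - apply (ex_RInt_continuous (V := R_CompleteNormedModule)). intros; apply Hf.
Qed.

Lemma is_RInt_derive_in f df c d :
  (forall t, a <= t <= b -> is_derive_in a b f t (df t)) -> cont_in a b df ->
  a <= c <= b -> a <= d <= b -> is_RInt df c d (f d - f c).
Proof.
  intros Hf Hdf Hc Hd.
  apply (is_RInt_ext (V := R_NormedModule) (fun u => df (clamp a b u))).
  - intros x Hx. rewrite clamp_id; auto.
    unfold Rmin, Rmax in Hx. destruct (Rle_dec c d); lra.
  - rewrite <- (C1_extension_eq f df d Hd), <- (C1_extension_eq f df c Hc).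
    apply (is_RInt_derive (V := R_CompleteNormedModule) (C1_extension f df)).
    + intros; apply is_derive_C1_extension; auto.
    + intros; apply Hdf.
Qed.

Lemma is_derive_in_RInt f c t : cont_in a b f -> a <= c <= b -> a <= t <= b ->
  is_derive_in a b (fun u => RInt f c u) t (f t).
Proof.
  intros Hf Hc Ht. apply is_derive_in_iff; auto.
  exists (fun u => RInt (fun x => f (clamp a b x)) c u). split.
  - intros u Hu. apply RInt_ext. intros x Hx. rewrite clamp_id; auto.
    unfold Rmin, Rmax in Hx. destruct (Rle_dec c u); lra.
  - rewrite <- (clamp_id a b t Ht) at 2.
    apply (is_derive_RInt (V := R_NormedModule) (fun x => f (clamp a b x)) _ c).
    + apply filter_forall. intros u. apply (RInt_correct (V := R_CompleteNormedModule)).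
      apply (ex_RInt_continuous (V := R_CompleteNormedModule)). intros; apply Hf.
    + apply Hf.
Qed.

Lemma mvt_in f df c d : (forall t, a <= t <= b -> is_derive_in a b f t (df t)) ->
  a <= c -> c <= d -> d <= b -> exists e, c <= e <= d /\ f d - f c = df e * (d - c).
Proof.
  intros Hf H1 H2 H3.
  destruct (MVT_gen (C1_extension f df) c d (fun t => df (clamp a b t))) as [e [He H]].
  - intros; apply is_derive_C1_extension; auto.
  - intros x _. apply continuity_pt_filterlim.
    apply (ex_derive_continuous (V := R_NormedModule)).
    eexists. apply is_derive_C1_extension; auto.
  - rewrite Rmin_left, Rmax_right in He by lra.
    exists e. split; auto. rewrite !C1_extension_eq, clamp_id in H by lra. exact H.
Qed.

Lemma constant_in f : (forall t, a <= t <= b -> is_derive_in a b f t 0) ->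
  forall t, a <= t <= b -> f t = f a.
Proof.
  intros Hf t Ht. destruct (mvt_in f (fun _ => 0) a t Hf) as [e [He H]]; lra.
Qed.

Lemma increasing_in f df : (forall t, a <= t <= b -> is_derive_in a b f t (df t)) ->
  (forall t, a <= t <= b -> 0 < df t) ->
  forall c d, a <= c -> c < d -> d <= b -> f c < f d.
Proof.
  intros Hf Hp c d H1 H2 H3. destruct (mvt_in f df c d Hf) as [e [He H]]; try lra.
  assert (0 < df e) by (apply Hp; lra). nra.
Qed.

(** The indefinite integral increases from 0 to 0, so it is constant and its
    derivative [f] vanishes. *)
Lemma nonneg_integral_zero f : cont_in a b f -> (forall t, a <= t <= b -> 0 <= f t) ->
  RInt f a b = 0 -> forall t, a <= t <= b -> f t = 0.
Proof.
  intros Hf Hp H0 t Ht.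
  assert (Hd : forall u, a <= u <= b -> is_derive_in a b (fun u => RInt f a u) u (f u)).
  { intros; apply is_derive_in_RInt; auto; lra. }
  assert (Hz : forall u, a <= u <= b -> RInt f a u = 0).
  { intros u Hu.
    destruct (mvt_in _ f a u Hd) as [e [He H]]; try lra.
    destruct (mvt_in _ f u b Hd) as [e' [He' H']]; try lra.
    cbv beta in H, H'. rewrite RInt_point in H. unfold zero in H; simpl in H.
    assert (0 <= f e) by (apply Hp; lra). assert (0 <= f e') by (apply Hp; lra).
    rewrite H0 in H'.
    assert (0 <= f e * (u - a)) by (apply Rmult_le_pos; lra).
    assert (0 <= f e' * (b - u)) by (apply Rmult_le_pos; lra). lra. }
  apply (is_derive_in_unique t (fun u => RInt f a u)); auto.
  apply (is_derive_in_ext t (fun _ => 0)); auto. intros; symmetry; auto.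
  apply is_derive_in_const; auto.
Qed.

Lemma cont_in_zero_closed f : cont_in a b f -> (forall t, a < t < b -> f t = 0) ->
  forall t, a <= t <= b -> f t = 0.
Proof.
  intros Hf H t Ht.
  assert (Hd : forall u, a <= u <= b -> is_derive_in a b (fun u => RInt f a u) u (f u)).
  { intros; apply is_derive_in_RInt; auto; lra. }
  apply (is_derive_in_unique t (fun u => RInt f a u)); auto.
  apply (is_derive_in_ext t (fun _ => 0)); auto. 2: apply is_derive_in_const; auto.
  intros u Hu. symmetry. rewrite (RInt_ext f (fun _ => 0)).
  - rewrite RInt_const. unfold scal; simpl; unfold mult; simpl; ring.
  - intros x Hx. rewrite Rmin_left, Rmax_right in Hx by lra. apply H; lra.
Qed.

End Interval.

Lemma is_derive_in_comp a b c d f phi t v w : a <= t <= b ->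
  (forall u, a <= u <= b -> c <= phi u <= d) ->
  is_derive_in c d f (phi t) v -> is_derive_in a b phi t w ->
  is_derive_in a b (fun u => f (phi u)) t (v * w).
Proof.
  intros Ht Hphi Hf Hp. apply is_derive_in_iff in Hf; auto. apply is_derive_in_iff in Hp; auto.
  destruct Hf as [F [HF HFv]], Hp as [P [HP HPw]].
  apply is_derive_in_iff; auto. exists (fun u => F (P u)). split.
  - intros u Hu. rewrite HP, HF; auto.
  - rewrite <- HP in HFv by auto. rewrite Rmult_comm.
    exact (is_derive_comp (V := R_NormedModule) F P t v w HFv HPw).
Qed.

Lemma cont_in_bounded a b f : a < b -> cont_in a b f ->
  exists M, 0 <= M /\ forall t, a <= t <= b -> Rabs (f t) <= M.
Proof.
  intros ab Hf.
  destruct (continuity_ab_maj (fun t => Rabs (f (clamp a b t))) a b) as [m [Hm Hm']]; [lra| |].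
  - intros c _. apply continuity_pt_filterlim.
    apply (continuous_comp (fun t => f (clamp a b t)) Rabs); [apply Hf|apply continuous_Rabs].
  - exists (Rabs (f (clamp a b m))). split; [apply Rabs_pos|].
    intros t Ht. specialize (Hm t Ht). simpl in Hm. rewrite clamp_id in Hm; auto.
Qed.

(** * Smooth functions on a closed interval *)

Lemma Rabs_lt_near x e e0 : Rabs (x - e) < e0 - Rabs e -> Rabs x < e0.
Proof. unfold Rabs. repeat destruct Rcase_abs; lra. Qed.

Section Smooth.
Context {a b : R} (ab : a < b).

(** The iterated derivatives in [smooth_in], rearranged so that one
    differentiation is peeled off first: closure under products and the like
    then follows by induction on [n] from the rule for the first derivative. *)
Fixpoint differentiable_in (n : nat) (f : R -> R) : Prop :=
  match n with
  | O => True
  | S m => (forall t, a <= t <= b -> ex_derive_in a b f t) /\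
           differentiable_in m (Derive_in a b f)
  end.

Lemma smooth_in_iff f : smooth_in a b f <-> forall n, differentiable_in n f.
Proof.
  split.
  - intros H n. revert f H. induction n as [|n IH]; intros f H; simpl; auto. split.
    + exact (H O).
    + apply IH. intros m t Ht. specialize (H (S m) t Ht).
      rewrite Nat.iter_succ_r in H. exact H.
  - intros H n. revert f H. induction n as [|n IH]; intros f H t Ht.
    + exact (proj1 (H 1%nat) t Ht).
    + rewrite Nat.iter_succ_r. apply IH; auto. intros m. exact (proj2 (H (S m))).
Qed.

Lemma differentiable_in_ext n : forall f g, (forall t, a <= t <= b -> f t = g t) ->
  differentiable_in n f -> differentiable_in n g.
Proof.
  induction n as [|n IH]; intros f g H; simpl; auto. intros [H1 H2]. split.
  - intros t Ht. destruct (H1 t Ht) as [v Hv]. exists v.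
    apply (is_derive_in_ext t f); auto.
  - apply (IH (Derive_in a b f)); auto.
    intros t Ht. symmetry. apply (Derive_in_ext ab); auto.
Qed.

Lemma differentiable_in_antiderivative n F f :
  (forall t, a <= t <= b -> is_derive_in a b F t (f t)) ->
  differentiable_in n f -> differentiable_in (S n) F.
Proof.
  intros H Hf. split.
  - intros t Ht. exists (f t). auto.
  - apply (differentiable_in_ext n f); auto. intros t Ht. symmetry.
    apply (Derive_in_eq ab); auto.
Qed.

Lemma differentiable_in_S n : forall f, differentiable_in (S n) f -> differentiable_in n f.
Proof.
  induction n as [|n IH]; intros f H; simpl; auto. destruct H as [H1 H2]. split; auto.
Qed.

Lemma differentiable_in_derive n f : differentiable_in (S n) f ->
  forall t, a <= t <= b -> is_derive_in a b f t (Derive_in a b f t).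
Proof. intros [H _] t Ht. apply (Derive_in_correct ab); auto. Qed.

Lemma differentiable_in_const n : forall c, differentiable_in n (fun _ => c).
Proof.
  induction n as [|n IH]; intros c; simpl; auto.
  apply (differentiable_in_antiderivative n (fun _ => c) (fun _ => 0)); auto.
  intros; apply (is_derive_in_const); auto.
Qed.

Lemma differentiable_in_id n : differentiable_in n (fun t => t).
Proof.
  destruct n; [exact I|].
  apply (differentiable_in_antiderivative n (fun t => t) (fun _ => 1)).
  - intros; apply (is_derive_in_id); auto.
  - apply differentiable_in_const.
Qed.

Lemma differentiable_in_plus n : forall f g, differentiable_in n f -> differentiable_in n g ->
  differentiable_in n (fun t => f t + g t).
Proof.
  induction n as [|n IH]; intros f g Hf Hg; [exact I|].
  apply (differentiable_in_antiderivative n _ (fun t => Derive_in a b f t + Derive_in a b g t)).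
  - intros t Ht. apply (is_derive_in_plus); auto; eapply differentiable_in_derive; eauto.
  - apply IH; [apply Hf | apply Hg].
Qed.

Lemma differentiable_in_mult n : forall f g, differentiable_in n f -> differentiable_in n g ->
  differentiable_in n (fun t => f t * g t).
Proof.
  induction n as [|n IH]; intros f g Hf Hg; [exact I|].
  apply (differentiable_in_antiderivative n _
    (fun t => Derive_in a b f t * g t + f t * Derive_in a b g t)).
  - intros t Ht. apply (is_derive_in_mult); auto; eapply differentiable_in_derive; eauto.
  - apply differentiable_in_plus; apply IH; try apply Hf; try apply Hg;
    apply differentiable_in_S; auto.
Qed.

Lemma is_derive_in_rsqrt w t dw : a <= t <= b -> 0 < w t -> is_derive_in a b w t dw ->
  is_derive_in a b (fun u => / sqrt (w u)) t (- / 2 * dw * (/ sqrt (w t)) ^ 3).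
Proof.
  intros Ht Hw H.
  replace (- / 2 * dw * (/ sqrt (w t)) ^ 3) with (dw * (- / 2 * (/ sqrt (w t)) ^ 3)) by ring.
  apply (is_derive_in_outer w t dw (fun y => / sqrt y)); auto.
  pose proof (sqrt_lt_R0 _ Hw).
  auto_derive; [split; auto; lra|].
  assert (E : sqrt (w t) * sqrt (w t) = w t) by (apply sqrt_sqrt; lra).
  field. lra.
Qed.

(** The derivative of [w ^ (-1/2)] is [- w' / 2] times the cube of [w ^ (-1/2)],
    so this single function can be bootstrapped; speed, tangent and curvature
    are polynomials in it and in the derivatives of the coordinates. *)
Lemma differentiable_in_rsqrt n : forall w, (forall t, a <= t <= b -> 0 < w t) ->
  differentiable_in n w -> differentiable_in n (fun t => / sqrt (w t)).
Proof.
  induction n as [|n IH]; intros w Hw H; [exact I|].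
  apply (differentiable_in_antiderivative n _
    (fun t => (- / 2 * Derive_in a b w t) * (/ sqrt (w t) * (/ sqrt (w t) * / sqrt (w t))))).
  - intros t Ht. replace (_ * _) with (- / 2 * Derive_in a b w t * (/ sqrt (w t)) ^ 3) by ring.
    apply is_derive_in_rsqrt; auto. eapply differentiable_in_derive; eauto.
  - assert (Hr : differentiable_in n (fun t => / sqrt (w t)))
      by (apply IH; auto; apply differentiable_in_S; auto).
    repeat apply differentiable_in_mult; auto; try apply differentiable_in_const.
    apply H.
Qed.

Lemma smooth_in_ext f g : (forall t, a <= t <= b -> f t = g t) -> smooth_in a b f -> smooth_in a b g.
Proof. rewrite !smooth_in_iff. intros H Hf n. eapply differentiable_in_ext; eauto. Qed.

Lemma smooth_in_const c : smooth_in a b (fun _ => c).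
Proof. rewrite smooth_in_iff. intros; apply differentiable_in_const. Qed.

Lemma smooth_in_id : smooth_in a b (fun t => t).
Proof. rewrite smooth_in_iff. intros; apply differentiable_in_id. Qed.

Lemma smooth_in_plus f g : smooth_in a b f -> smooth_in a b g -> smooth_in a b (fun t => f t + g t).
Proof. rewrite !smooth_in_iff. intros; apply differentiable_in_plus; auto. Qed.

Lemma smooth_in_mult f g : smooth_in a b f -> smooth_in a b g -> smooth_in a b (fun t => f t * g t).
Proof. rewrite !smooth_in_iff. intros; apply differentiable_in_mult; auto. Qed.

Lemma smooth_in_rsqrt w : (forall t, a <= t <= b -> 0 < w t) ->
  smooth_in a b w -> smooth_in a b (fun t => / sqrt (w t)).
Proof. rewrite !smooth_in_iff. intros; apply differentiable_in_rsqrt; auto. Qed.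

Lemma smooth_in_Derive f : smooth_in a b f -> smooth_in a b (Derive_in a b f).
Proof. rewrite !smooth_in_iff. intros H n. apply (H (S n)). Qed.

Lemma smooth_in_antiderivative F f : (forall t, a <= t <= b -> is_derive_in a b F t (f t)) ->
  smooth_in a b f -> smooth_in a b F.
Proof.
  rewrite !smooth_in_iff. intros H Hf n.
  apply differentiable_in_S, (differentiable_in_antiderivative n F f); auto.
Qed.

Lemma smooth_in_is_derive f t : smooth_in a b f -> a <= t <= b ->
  is_derive_in a b f t (Derive_in a b f t).
Proof. intros H Ht. apply (Derive_in_correct ab); auto. exact (H O t Ht). Qed.

Lemma smooth_in_cont f : smooth_in a b f -> cont_in a b f.
Proof. intros H. apply (cont_in_of_ex_derive_in ab). exact (H O). Qed.

(** * Functions of a deformation parameter and a point of the interval *)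

(** The two-variable analogue of [cont_in]. *)
Definition cont2 (e0 : R) (F : R -> R -> R) : Prop :=
  forall e t, Rabs e < e0 ->
    continuous (fun z : R * R => F (fst z) (clamp a b (snd z))) (e, t).

Lemma continuous_on_cont2 e0 F :
  continuous_on (family_domain e0 a b) (fun z => F (fst z) (snd z)) -> cont2 e0 F.
Proof.
  intros H e t He.
  assert (Hc := clamp_bounds a b t (Rlt_le _ _ ab)).
  specialize (H (e, clamp a b t) (conj He Hc)). simpl in H.
  unfold continuous. simpl.
  apply (filterlim_comp _ _ _ (fun z : R * R => (fst z, clamp a b (snd z)))
           (fun z => F (fst z) (snd z)) _
           (within (family_domain e0 a b) (locally (e, clamp a b t)))); auto.
  intros P HP. unfold within in HP. unfold filtermap.
  assert (Hlim : filterlim (fun z : R * R => (fst z, clamp a b (snd z))) (locally (e, t))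
            (locally (e, clamp a b t))).
  { intros Q [d HQ]. exists d. intros z [Hz1 Hz2]. apply HQ. split; auto.
    change (Rabs (clamp a b (snd z) - clamp a b t) < d).
    eapply Rle_lt_trans; [apply clamp_lipschitz | exact Hz2]. }
  specialize (Hlim _ HP). unfold filtermap in Hlim.
  assert (Hd : locally (e, t) (fun z : R * R => Rabs (fst z) < e0)).
  { assert (Hp : 0 < e0 - Rabs e) by lra.
    exists (mkposreal _ Hp). intros z [Hz1 _].
    change (Rabs (fst z - e) < e0 - Rabs e) in Hz1.
    exact (Rabs_lt_near _ _ _ Hz1). }
  generalize (filter_and _ _ Hlim Hd). apply filter_imp.
  intros z [H1 H2]. apply H1. split; [exact H2|]. apply clamp_bounds. lra.
Qed.

Lemma cont2_continuous_on e0 F : cont2 e0 F ->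
  continuous_on (family_domain e0 a b) (fun z => F (fst z) (snd z)).
Proof.
  intros H [e t] [He Ht]. simpl in He, Ht.
  intros P HP. specialize (H e t He). unfold continuous in H. simpl in H.
  rewrite clamp_id in H by auto. specialize (H P HP). unfold filtermap, within in *.
  revert H. apply filter_imp. intros z Hz Hd. rewrite clamp_id in Hz; [exact Hz | apply Hd].
Qed.

Lemma cont2_plus e0 F G : cont2 e0 F -> cont2 e0 G -> cont2 e0 (fun e t => F e t + G e t).
Proof. intros HF HG e t He. apply (continuous_plus (V := R_NormedModule)); auto. Qed.

Lemma cont2_mult e0 F G : cont2 e0 F -> cont2 e0 G -> cont2 e0 (fun e t => F e t * G e t).
Proof. intros HF HG e t He. apply (continuous_mult (K := R_AbsRing)); auto. Qed.

Lemma cont2_const e0 c : cont2 e0 (fun _ _ => c).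
Proof. intros e t He. apply continuous_const. Qed.

Lemma cont2_pow e0 F n : cont2 e0 F -> cont2 e0 (fun e t => F e t ^ n).
Proof.
  intros HF. induction n as [|n IH]; simpl.
  - apply cont2_const.
  - apply (cont2_mult e0 F (fun e t => F e t ^ n)); auto.
Qed.

Lemma cont2_fst e0 : cont2 e0 (fun e _ => e).
Proof. intros e t He. apply continuous_fst. Qed.

Lemma cont2_snd e0 f : cont_in a b f -> cont2 e0 (fun _ t => f t).
Proof.
  intros H e t He.
  apply (continuous_comp (fun z : R * R => snd z) (fun u => f (clamp a b u))).
  - apply continuous_snd.
  - apply H.
Qed.

Lemma cont2_rsqrt e0 F : (forall e t, Rabs e < e0 -> a <= t <= b -> 0 < F e t) ->
  cont2 e0 F -> cont2 e0 (fun e t => / sqrt (F e t)).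
Proof.
  intros Hp HF e t He.
  apply (continuous_comp (fun z : R * R => F (fst z) (clamp a b (snd z))) (fun y => / sqrt y)).
  - apply HF; auto.
  - simpl. apply (ex_derive_continuous (V := R_NormedModule)).
    assert (0 < F e (clamp a b t)) by (apply Hp; auto; apply clamp_bounds; lra).
    pose proof (sqrt_lt_R0 _ H). auto_derive. split; auto; lra.
Qed.

Lemma cont2_slice e0 F e : Rabs e < e0 -> cont2 e0 F -> cont_in a b (F e).
Proof.
  intros He H t.
  apply (continuous_comp_2 (fun _ : R => e) (fun u : R => u) (fun x y => F x (clamp a b y))).
  - apply continuous_const.
  - apply continuous_id.
  - exact (H e t He).
Qed.

(** Differentiation under the integral sign, where the integrand is controlled
    only for parameters in the interval [[a, b]]. *)
Lemma is_derive_RInt_param_in e0 F dF c d : 0 < e0 ->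
  (forall e t, Rabs e < e0 -> a <= t <= b -> is_derive (fun e' => F e' t) e (dF e t)) ->
  cont2 e0 dF -> (forall e, Rabs e < e0 -> cont_in a b (F e)) ->
  a <= c <= b -> a <= d <= b ->
  is_derive (fun e => RInt (F e) c d) 0 (RInt (dF 0) c d).
Proof.
  intros He0 HF HdF HFc Hc Hd.
  assert (Hcl := clamp_bounds a b).
  assert (Hab : a <= b) by lra.
  assert (H0 : Rabs 0 < e0) by (rewrite Rabs_R0; auto).
  assert (Hin : forall x, Rmin c d < x < Rmax c d -> clamp a b x = x).
  { intros x Hx. apply clamp_id. unfold Rmin, Rmax in Hx. destruct (Rle_dec c d); lra. }
  assert (Hloc : forall P : R -> Prop, (forall e, Rabs e < e0 -> P e) -> locally 0 P).
  { intros P HP. exists (mkposreal e0 He0). intros e He. apply HP.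
    change (Rabs (e - 0) < e0) in He. rewrite Rminus_0_r in He. exact He. }
  apply (is_derive_ext_loc (fun e => RInt (fun t => F e (clamp a b t)) c d)).
  { apply filter_forall. intros e. apply RInt_ext. intros x Hx. rewrite Hin; auto. }
  replace (RInt (dF 0) c d) with
    (RInt (fun t => Derive (fun u => F u (clamp a b t)) 0) c d).
  2:{ apply RInt_ext. intros x Hx. rewrite Hin by auto. apply is_derive_unique.
      apply HF; auto. rewrite <- (Hin x Hx). auto. }
  apply (is_derive_RInt_param (fun e t => F e (clamp a b t))).
  - apply Hloc. intros e He t _. eexists. apply HF; auto.
  - intros t _.
    apply (continuity_2d_pt_ext_loc (fun e t => dF e (clamp a b t))).
    + exists (mkposreal e0 He0). intros u v Hu _. simpl in Hu. rewrite Rminus_0_r in Hu.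
      symmetry. apply is_derive_unique. apply HF; auto.
    + apply continuity_2d_pt_filterlim. exact (HdF 0 t H0).
  - apply Hloc. intros e He.
    apply (ex_RInt_continuous (V := R_CompleteNormedModule)). intros; apply HFc; auto.
Qed.

(** The two orders of differentiation agree at [e = 0]: differentiate in [e] the
    identity that expresses [F e t - F e a] as the integral of [D_par a b F e]. *)
Lemma is_derive_in_D_eps e0 F : 0 < e0 -> class_C 2 e0 a b F ->
  forall t, a <= t <= b -> is_derive_in a b (D_eps F 0) t (D_eps (D_par a b F) 0 t).
Proof.
  intros He0 [_ [Hd [[_ [_ _]] [_ [Hd1 [[Hc1 _] _]]]]]] t Ht.
  assert (H0 : Rabs 0 < e0) by (rewrite Rabs_R0; auto).
  assert (Hc2 : cont2 e0 (D_eps (D_par a b F))) by (apply continuous_on_cont2; auto).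
  assert (HFi : forall e u, Rabs e < e0 -> a <= u <= b ->
           is_derive_in a b (F e) u (D_par a b F e u)).
  { intros e u He Hu. apply (Derive_in_correct ab); auto. apply Hd; auto. }
  assert (HFe : forall e u, Rabs e < e0 -> a <= u <= b ->
           is_derive (fun e' => F e' u) e (D_eps F e u)).
  { intros e u He Hu. apply Derive_correct. apply Hd; auto. }
  assert (Hcp : forall e, Rabs e < e0 -> cont_in a b (D_par a b F e)).
  { intros e He. apply (cont_in_of_ex_derive_in ab). intros u Hu. apply Hd1; auto. }
  assert (Key : forall u, a <= u <= b ->
    RInt (D_eps (D_par a b F) 0) a u + D_eps F 0 a = D_eps F 0 u).
  { intros u Hu.
    assert (D1 : is_derive (fun e => RInt (D_par a b F e) a u) 0
                   (RInt (D_eps (D_par a b F) 0) a u)).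
    { apply (is_derive_RInt_param_in e0); auto; try lra.
      intros e x He Hx. apply Derive_correct. apply Hd1; auto. }
    assert (D2 : is_derive (fun e => RInt (D_par a b F e) a u) 0 (D_eps F 0 u - D_eps F 0 a)).
    { apply (is_derive_ext_loc (fun e => F e u - F e a)).
      - exists (mkposreal e0 He0). intros e He.
        change (Rabs (e - 0) < e0) in He. rewrite Rminus_0_r in He.
        symmetry. apply is_RInt_unique.
        apply (is_RInt_derive_in ab (F e)); auto; try lra.
      - apply (is_derive_minus (V := R_NormedModule)); apply HFe; auto; lra. }
    apply is_derive_unique in D1. apply is_derive_unique in D2. lra. }
  apply (is_derive_in_ext t
     (fun u => RInt (D_eps (D_par a b F) 0) a u + D_eps F 0 a)); auto.
  rewrite <- (Rplus_0_r (D_eps (D_par a b F) 0 t)).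
  apply (is_derive_in_plus); auto.
  - apply (is_derive_in_RInt); auto; try lra. apply (cont2_slice e0); auto.
  - apply (is_derive_in_const); auto.
Qed.

(** Provides the test variations of the calculus of variations. *)
Lemma class_C_affine e0 k : forall f g F, smooth_in a b f -> smooth_in a b g ->
  (forall e t, Rabs e < e0 -> a <= t <= b -> F e t = f t + e * g t) ->
  class_C k e0 a b F.
Proof.
  induction k as [|k IH]; intros f g F Hf Hg HF;
  assert (Hc : continuous_on (family_domain e0 a b) (fun z => F (fst z) (snd z))).
  1, 3 : apply cont2_continuous_on; intros e t He;
    apply (continuous_ext_loc _ (fun z : R * R => f (clamp a b (snd z)) + fst z * g (clamp a b (snd z))));
    [ assert (Hp : 0 < e0 - Rabs e) by lra;
      exists (mkposreal _ Hp); intros z [Hz1 _];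
      change (Rabs (fst z - e) < e0 - Rabs e) in Hz1;
      symmetry; apply HF; [|apply clamp_bounds; lra];
      exact (Rabs_lt_near _ _ _ Hz1)
    | exact (cont2_plus e0 _ _ (cont2_snd e0 f (smooth_in_cont f Hf))
        (cont2_mult e0 _ _ (cont2_fst e0) (cont2_snd e0 g (smooth_in_cont g Hg))) e t He) ].
  - split; auto.
  - assert (He : forall e t, Rabs e < e0 -> a <= t <= b -> is_derive (fun e' => F e' t) e (g t)).
    { intros e t He Ht. apply (is_derive_ext_loc (fun e' => f t + e' * g t)).
      - assert (Hp : 0 < e0 - Rabs e) by lra.
        exists (mkposreal _ Hp). intros z Hz. symmetry. apply HF; auto.
        change (Rabs (z - e) < e0 - Rabs e) in Hz.
        exact (Rabs_lt_near _ _ _ Hz).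
      - auto_derive; auto; ring. }
    assert (Hp : forall e t, Rabs e < e0 -> a <= t <= b ->
       is_derive_in a b (F e) t (Derive_in a b f t + e * Derive_in a b g t)).
    { intros e t H Ht. apply (is_derive_in_ext t (fun t => f t + e * g t)); auto.
      - intros; symmetry; auto.
      - apply (is_derive_in_plus); auto; [apply smooth_in_is_derive; auto|].
        replace (e * Derive_in a b g t) with (0 * g t + e * Derive_in a b g t) by ring.
        apply (is_derive_in_mult (fun _ => e)); auto.
        + apply (is_derive_in_const); auto.
        + apply smooth_in_is_derive; auto. }
    split; [auto|split; [|split]].
    + intros e t H Ht. split; eexists; eauto.
    + apply (IH g (fun _ => 0)); auto; [apply smooth_in_const|].
      intros e t H Ht. rewrite Rmult_0_r, Rplus_0_r. apply is_derive_unique. auto.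
    + apply (IH (Derive_in a b f) (Derive_in a b g)); auto; try (apply smooth_in_Derive; auto).
      intros e t H Ht. unfold D_par. apply (Derive_in_eq ab); auto.
Qed.

End Smooth.

Lemma class_C_smooth_in a b (ab : a < b) e0 e F : Rabs e < e0 ->
  (forall k, class_C k e0 a b F) -> smooth_in a b (F e).
Proof.
  intros He HF n. revert F HF. induction n as [|n IH]; intros F HF t Ht.
  - apply (HF 1%nat); auto.
  - rewrite Nat.iter_succ_r. apply (IH (D_par a b F)); auto. intros k. apply (HF (S k)).
Qed.

Arguments cont2 a b e0 F : clear implicits.

(** Equations between integrals are stated in the carrier of a normed module,
    where [ring] and [field] do not recognize the real numbers. *)
Ltac real_eq := match goal with |- @eq _ ?x ?y => change (@eq R x y) end.

Ltac prove_smooth ab :=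
  lazymatch goal with
  | |- smooth_in _ _ (fun t => @?f t * @?g t) =>
      apply (smooth_in_mult ab f g); cbv beta; prove_smooth ab
  | |- smooth_in _ _ (fun t => @?f t + @?g t) =>
      apply (smooth_in_plus ab f g); cbv beta; prove_smooth ab
  | |- smooth_in _ _ (fun _ => ?c) => exact (smooth_in_const ab c)
  | |- smooth_in _ _ (fun t => t) => exact (smooth_in_id ab)
  | H : smooth_in _ _ ?f |- smooth_in _ _ (fun t => ?f t) => exact H
  | H : smooth_in _ _ ?f |- smooth_in _ _ ?f => exact H
  end.

Ltac prove_cont2 opp :=
  lazymatch goal with
  | |- cont2 _ _ _ (fun e t => @?f e t * @?g e t) =>
      apply (cont2_mult _ f g); cbv beta; prove_cont2 opp
  | |- cont2 _ _ _ (fun e t => @?f e t + @?g e t) =>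
      apply (cont2_plus _ f g); cbv beta; prove_cont2 opp
  | |- cont2 _ _ _ (fun e t => - @?f e t) =>
      apply (opp f); cbv beta; prove_cont2 opp
  | |- cont2 _ _ _ (fun e _ => e) => exact (cont2_fst _)
  | |- cont2 _ _ _ (fun _ _ => ?c) => exact (cont2_const _ c)
  | H : cont2 _ _ _ ?f |- cont2 _ _ _ (fun e t => ?f e t) => exact H
  | H : cont2 _ _ _ ?f |- cont2 _ _ _ ?f => exact H
  end.

(** * The moving frame of a regular curve *)

Section Frame.
Context {a b : R} (ab : a < b).

Definition tangent_x (h : R -> R * R) (t : R) : R := fst (velocity a b h t) / speed a b h t.
Definition tangent_y (h : R -> R * R) (t : R) : R := snd (velocity a b h t) / speed a b h t.

Lemma speed_pos h t : regular_curve a b h -> a <= t <= b -> 0 < speed a b h t.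
Proof.
  intros Hr Ht. apply sqrt_lt_R0. specialize (Hr t Ht).
  destruct (velocity a b h t) as [p q]. simpl.
  destruct (Req_dec p 0) as [->|Hp]; [|nra].
  destruct (Req_dec q 0) as [->|Hq]; [congruence|nra].
Qed.

Lemma speed_sqr h t : speed a b h t * speed a b h t =
  fst (velocity a b h t) ^ 2 + snd (velocity a b h t) ^ 2.
Proof. apply sqrt_sqrt. nra. Qed.

Lemma tangent_unit h t : regular_curve a b h -> a <= t <= b ->
  tangent_x h t ^ 2 + tangent_y h t ^ 2 = 1.
Proof.
  intros Hr Ht. pose proof (speed_pos h t Hr Ht). pose proof (speed_sqr h t).
  unfold tangent_x, tangent_y.
  set (v := speed a b h t) in *.
  replace (_ + _) with ((fst (velocity a b h t) ^ 2 + snd (velocity a b h t) ^ 2) / (v * v))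
    by (field; lra).
  rewrite H0. field. rewrite <- H0. nra.
Qed.

Section Curve.
Context (h : R -> R * R).
Context (Hs : smooth_curve a b h) (Hr : regular_curve a b h).

Let x1 := Derive_in a b (xcoord h).
Let y1 := Derive_in a b (ycoord h).
Let x2 := Derive_in a b x1.
Let y2 := Derive_in a b y1.

Lemma smooth_in_inv_speed : smooth_in a b (fun t => / speed a b h t).
Proof.
  apply (smooth_in_rsqrt ab (fun t => x1 t ^ 2 + y1 t ^ 2)).
  - intros t Ht. pose proof (speed_pos h t Hr Ht). pose proof (speed_sqr h t).
    simpl in H0. fold x1 y1 in H0. simpl. nra.
  - apply (smooth_in_ext ab (fun t => x1 t * x1 t + y1 t * y1 t)); [intros; ring|].
    destruct Hs as [Hx Hy]. apply smooth_in_Derive in Hx, Hy. fold x1 in Hx. fold y1 in Hy.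
    prove_smooth ab.
Qed.

Lemma smooth_in_speed : smooth_in a b (speed a b h).
Proof.
  pose proof smooth_in_inv_speed as Hr'. destruct Hs as [Hx Hy].
  apply smooth_in_Derive in Hx, Hy. fold x1 in Hx. fold y1 in Hy.
  pose proof (smooth_in_Derive _ Hx) as Hx2. pose proof (smooth_in_Derive _ Hy) as Hy2.
  fold x2 in Hx2. fold y2 in Hy2.
  apply (smooth_in_ext ab (fun t => (x1 t * x1 t + y1 t * y1 t) * / speed a b h t)).
  - intros t Ht. pose proof (speed_pos h t Hr Ht). pose proof (speed_sqr h t) as E.
    simpl in E. fold x1 y1 in E.
    replace (x1 t * x1 t + y1 t * y1 t) with (speed a b h t * speed a b h t) by (rewrite E; ring).
    field. lra.
  - prove_smooth ab.
Qed.

Lemma smooth_in_tangent_x : smooth_in a b (tangent_x h).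
Proof.
  apply (smooth_in_mult ab); [|apply smooth_in_inv_speed]. apply smooth_in_Derive, Hs.
Qed.

Lemma smooth_in_tangent_y : smooth_in a b (tangent_y h).
Proof.
  apply (smooth_in_mult ab); [|apply smooth_in_inv_speed]. apply smooth_in_Derive, Hs.
Qed.

Lemma smooth_in_curvature : smooth_in a b (curvature a b h).
Proof.
  pose proof smooth_in_inv_speed as Hr'. destruct Hs as [Hx Hy].
  apply smooth_in_Derive in Hx, Hy. fold x1 in Hx. fold y1 in Hy.
  pose proof (smooth_in_Derive _ Hx) as Hx2. pose proof (smooth_in_Derive _ Hy) as Hy2.
  fold x2 in Hx2. fold y2 in Hy2.
  apply (smooth_in_ext ab (fun t => (x1 t * y2 t + -1 * (y1 t * x2 t)) *
    (/ speed a b h t * (/ speed a b h t * / speed a b h t)))).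
  - intros t Ht. pose proof (speed_pos h t Hr Ht). unfold curvature. simpl.
    fold x1 y1. change (Derive_in a b (xcoord (velocity a b h)) t) with (x2 t).
    change (Derive_in a b (ycoord (velocity a b h)) t) with (y2 t). field. lra.
  - prove_smooth ab.
Qed.

Lemma is_derive_in_xcoord t : a <= t <= b ->
  is_derive_in a b (xcoord h) t (speed a b h t * tangent_x h t).
Proof.
  intros Ht. replace (_ * _) with (x1 t).
  - apply (smooth_in_is_derive ab); auto. apply Hs.
  - pose proof (speed_pos h t Hr Ht). unfold tangent_x. simpl. fold x1. field. lra.
Qed.

Lemma is_derive_in_ycoord t : a <= t <= b ->
  is_derive_in a b (ycoord h) t (speed a b h t * tangent_y h t).
Proof.
  intros Ht. replace (_ * _) with (y1 t).
  - apply (smooth_in_is_derive ab); auto. apply Hs.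
  - pose proof (speed_pos h t Hr Ht). unfold tangent_y. simpl. fold y1. field. lra.
Qed.

Lemma is_derive_in_inv_speed t : a <= t <= b ->
  is_derive_in a b (fun u => / speed a b h u) t
   (- (x1 t * x2 t + y1 t * y2 t) * (/ speed a b h t) ^ 3).
Proof.
  intros Ht. pose proof (speed_pos h t Hr Ht). pose proof (speed_sqr h t) as E.
  destruct Hs as [Hx Hy]. apply smooth_in_Derive in Hx, Hy. fold x1 in Hx. fold y1 in Hy.
  replace (- _ * _) with (- / 2 * (x2 t * x1 t + x1 t * x2 t + (y2 t * y1 t + y1 t * y2 t))
     * (/ speed a b h t) ^ 3) by (field; lra).
  apply (is_derive_in_rsqrt (fun u => x1 u ^ 2 + y1 u ^ 2)); auto.
  - unfold x1, y1. simpl in E. simpl. nra.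
  - apply (is_derive_in_ext t (fun u => x1 u * x1 u + y1 u * y1 u)); auto; [intros; ring|].
    apply is_derive_in_plus; auto; apply is_derive_in_mult; auto;
      apply (smooth_in_is_derive ab); auto.
Qed.

Lemma is_derive_in_tangent_x t : a <= t <= b ->
  is_derive_in a b (tangent_x h) t (- (speed a b h t * curvature a b h t * tangent_y h t)).
Proof.
  intros Ht. pose proof (speed_pos h t Hr Ht). pose proof (speed_sqr h t) as E.
  replace (- _) with (x2 t * / speed a b h t +
     x1 t * (- (x1 t * x2 t + y1 t * y2 t) * (/ speed a b h t) ^ 3)).
  - apply (is_derive_in_mult x1 (fun u => / speed a b h u)); auto.
    + apply (smooth_in_is_derive ab); auto. apply smooth_in_Derive, Hs.
    + apply is_derive_in_inv_speed; auto.
  - simpl in E. unfold curvature, tangent_y. simpl.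
    change (Derive_in a b (xcoord (velocity a b h)) t) with (x2 t).
    change (Derive_in a b (ycoord (velocity a b h)) t) with (y2 t).
    fold x1 y1. fold x1 y1 in E. set (v := speed a b h t) in *.
    replace (x2 t * / v) with (x2 t * (v * v) / v ^ 3) by (field; lra). rewrite E. field. lra.
Qed.

Lemma is_derive_in_tangent_y t : a <= t <= b ->
  is_derive_in a b (tangent_y h) t (speed a b h t * curvature a b h t * tangent_x h t).
Proof.
  intros Ht. pose proof (speed_pos h t Hr Ht). pose proof (speed_sqr h t) as E.
  replace (_ * _ * _) with (y2 t * / speed a b h t +
     y1 t * (- (x1 t * x2 t + y1 t * y2 t) * (/ speed a b h t) ^ 3)).
  - apply (is_derive_in_mult y1 (fun u => / speed a b h u)); auto.
    + apply (smooth_in_is_derive ab); auto. apply smooth_in_Derive, Hs.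
    + apply is_derive_in_inv_speed; auto.
  - simpl in E. unfold curvature, tangent_x. simpl.
    change (Derive_in a b (xcoord (velocity a b h)) t) with (x2 t).
    change (Derive_in a b (ycoord (velocity a b h)) t) with (y2 t).
    fold x1 y1. fold x1 y1 in E. set (v := speed a b h t) in *.
    replace (y2 t * / v) with (y2 t * (v * v) / v ^ 3) by (field; lra). rewrite E. field. lra.
Qed.

End Curve.

(** * The first variation of energy and length *)

(** With [(p, q)] the derivative of the variation field, this is
    [2 k N.((p, q) / v)' - (3 k ^ 2 - lam) T.(p, q)]. *)
Definition first_variation_density (lam : R) (h : R -> R * R) (p q : R -> R) (t : R) : R :=
  2 * curvature a b h t *
    (tangent_x h t * Derive_in a b (fun u => q u / speed a b h u) t
     - tangent_y h t * Derive_in a b (fun u => p u / speed a b h u) t)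
  - (3 * curvature a b h t ^ 2 - lam) * (tangent_x h t * p t + tangent_y h t * q t).

(** The integrand of the energy is [c ^ 2 * r ^ 5], with [c] the cross product of
    velocity and acceleration and [r] the inverse of the speed; that of the
    length is the squared speed times [r]. *)
Section Integrand.
Context (e0 lam : R) (x1 y1 x2 y2 dx1 dy1 dx2 dy2 : R -> R -> R).
Let c e t := x1 e t * y2 e t - y1 e t * x2 e t.
Let r e t := / sqrt (x1 e t ^ 2 + y1 e t ^ 2).
Let m e t := x1 e t * dx1 e t + y1 e t * dy1 e t.

Lemma is_derive_energy_integral :
  0 < e0 ->
  (forall e t, Rabs e < e0 -> a <= t <= b -> 0 < x1 e t ^ 2 + y1 e t ^ 2) ->
  (forall e t, Rabs e < e0 -> a <= t <= b -> is_derive (fun e => x1 e t) e (dx1 e t)) ->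
  (forall e t, Rabs e < e0 -> a <= t <= b -> is_derive (fun e => y1 e t) e (dy1 e t)) ->
  (forall e t, Rabs e < e0 -> a <= t <= b -> is_derive (fun e => x2 e t) e (dx2 e t)) ->
  (forall e t, Rabs e < e0 -> a <= t <= b -> is_derive (fun e => y2 e t) e (dy2 e t)) ->
  cont2 a b e0 x1 -> cont2 a b e0 y1 ->
  cont2 a b e0 x2 -> cont2 a b e0 y2 ->
  cont2 a b e0 dx1 -> cont2 a b e0 dy1 ->
  cont2 a b e0 dx2 -> cont2 a b e0 dy2 ->
  is_derive (fun e =>
      RInt (fun t => (c e t / sqrt (x1 e t ^ 2 + y1 e t ^ 2) ^ 3) ^ 2 * sqrt (x1 e t ^ 2 + y1 e t ^ 2)) a b
      + lam * RInt (fun t => sqrt (x1 e t ^ 2 + y1 e t ^ 2)) a b) 0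
    (RInt (fun t => 2 * c 0 t * (dx1 0 t * y2 0 t + x1 0 t * dy2 0 t - dy1 0 t * x2 0 t - y1 0 t * dx2 0 t)
             * r 0 t ^ 5 - 5 * c 0 t ^ 2 * r 0 t ^ 7 * m 0 t + lam * r 0 t * m 0 t) a b).
Proof.
  intros He0 Hw D1 D2 D3 D4 C1 C2 C3 C4 C5 C6 C7 C8.
  assert (Cw : cont2 a b e0 (fun e t => x1 e t ^ 2 + y1 e t ^ 2)).
  { apply cont2_plus; apply cont2_pow; auto. }
  assert (Cr : cont2 a b e0 r) by (apply (cont2_rsqrt ab); auto).
  assert (Cneg : forall F, cont2 a b e0 F -> cont2 a b e0 (fun e t => - F e t)).
  { intros F HF e t He. apply (continuous_opp (V := R_NormedModule)). exact (HF e t He). }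
  assert (Cc : cont2 a b e0 c).
  { apply cont2_plus; [|apply Cneg]; apply cont2_mult; auto. }
  assert (Cm : cont2 a b e0 m).
  { apply cont2_plus; apply cont2_mult; auto. }
  set (F := fun e t => c e t ^ 2 * r e t ^ 5 + lam * ((x1 e t ^ 2 + y1 e t ^ 2) * r e t)).
  set (dF := fun e t => 2 * c e t *
             (dx1 e t * y2 e t + x1 e t * dy2 e t - dy1 e t * x2 e t - y1 e t * dx2 e t)
             * r e t ^ 5 - 5 * c e t ^ 2 * r e t ^ 7 * m e t + lam * r e t * m e t).
  assert (HFc : forall e, Rabs e < e0 -> cont_in a b (fun t => c e t ^ 2 * r e t ^ 5) /\
             cont_in a b (fun t => (x1 e t ^ 2 + y1 e t ^ 2) * r e t)).
  { intros e He. split.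
    - apply (cont2_slice e0 (fun e t => c e t ^ 2 * r e t ^ 5)); auto.
      apply (cont2_mult e0 (fun e t => c e t ^ 2)); apply cont2_pow; auto.
    - apply (cont2_slice e0 (fun e t => (x1 e t ^ 2 + y1 e t ^ 2) * r e t)); auto.
      apply (cont2_mult e0 (fun e t => x1 e t ^ 2 + y1 e t ^ 2)); auto. }
  apply (is_derive_ext_loc (fun e => RInt (F e) a b)).
  { exists (mkposreal e0 He0). intros e He.
    change (Rabs (e - 0) < e0) in He. rewrite Rminus_0_r in He.
    destruct (HFc e He) as [H1 H2].
    apply is_RInt_unique.
    apply (is_RInt_plus (V := R_NormedModule)).
    - rewrite (RInt_ext _ (fun t => c e t ^ 2 * r e t ^ 5)).
      + apply (cont_in_is_RInt (a:=a) (b:=b)); auto; lra.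
      + intros t Ht. rewrite Rmin_left, Rmax_right in Ht by lra.
        assert (Hp : 0 < x1 e t ^ 2 + y1 e t ^ 2) by (apply Hw; auto; lra).
        pose proof (sqrt_lt_R0 _ Hp). unfold r. real_eq. field. lra.
    - apply (is_RInt_scal (V := R_NormedModule)).
      rewrite (RInt_ext _ (fun t => (x1 e t ^ 2 + y1 e t ^ 2) * r e t)).
      + apply (cont_in_is_RInt (a:=a) (b:=b)); auto; lra.
      + intros t Ht. rewrite Rmin_left, Rmax_right in Ht by lra.
        assert (Hp : 0 < x1 e t ^ 2 + y1 e t ^ 2) by (apply Hw; auto; lra).
        pose proof (sqrt_lt_R0 _ Hp). unfold r.
        rewrite <- (sqrt_sqrt (x1 e t ^ 2 + y1 e t ^ 2)) at 2 by lra. real_eq. field. lra. }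
  change (is_derive (fun e => RInt (F e) a b) 0 (RInt (dF 0) a b)).
  apply (is_derive_RInt_param_in ab e0 F dF); auto; try lra.
  - intros e t He Ht.
    assert (Hp : 0 < x1 e t ^ 2 + y1 e t ^ 2) by (apply Hw; auto).
    pose proof (sqrt_lt_R0 _ Hp) as Hq.
    assert (Hss : sqrt (x1 e t ^ 2 + y1 e t ^ 2) * sqrt (x1 e t ^ 2 + y1 e t ^ 2)
       = x1 e t ^ 2 + y1 e t ^ 2) by (apply sqrt_sqrt; lra).
    specialize (D1 e t He Ht). specialize (D2 e t He Ht).
    specialize (D3 e t He Ht). specialize (D4 e t He Ht).
    assert (E1 : Derive (fun u : R => x1 u t) e = dx1 e t) by (apply is_derive_unique; exact D1).
    assert (E2 : Derive (fun u : R => y1 u t) e = dy1 e t) by (apply is_derive_unique; exact D2).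
    assert (E3 : Derive (fun u : R => x2 u t) e = dx2 e t) by (apply is_derive_unique; exact D3).
    assert (E4 : Derive (fun u : R => y2 u t) e = dy2 e t) by (apply is_derive_unique; exact D4).
    assert (Dr : is_derive (fun e => r e t) e (- m e t * r e t ^ 3)).
    { unfold r at 1. auto_derive.
      - repeat split; try (eexists; eassumption); simpl in *; lra.
      - rewrite E1, E2.
        replace (x1 e t * (x1 e t * 1) + y1 e t * (y1 e t * 1)) with (x1 e t ^ 2 + y1 e t ^ 2) by ring.
        unfold r, m. field. lra. }
    (* the relation that reconciles the two ways of writing the length term *)
    assert (Hrw : r e t ^ 2 * (x1 e t ^ 2 + y1 e t ^ 2) = 1).
    { unfold r. rewrite <- Hss at 2. field. lra. }
    unfold F, c. auto_derive.
    + repeat split; eexists; eassumption.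
    + assert (Er : Derive (fun u : R => r u t) e = - m e t * r e t ^ 3)
        by (apply is_derive_unique; exact Dr).
      rewrite E1, E2, E3, E4, Er. unfold dF, c.
      replace (lam * r e t * m e t) with
       (lam * r e t * m e t * (2 - r e t ^ 2 * (x1 e t ^ 2 + y1 e t ^ 2))) by (rewrite Hrw; ring).
      unfold m. ring.
  - unfold dF.
    assert (C5' : cont2 a b e0 (fun e t => r e t ^ 5)) by (apply cont2_pow; auto).
    assert (C7' : cont2 a b e0 (fun e t => r e t ^ 7)) by (apply cont2_pow; auto).
    assert (C2' : cont2 a b e0 (fun e t => c e t ^ 2)) by (apply cont2_pow; auto).
    unfold Rminus. prove_cont2 Cneg.
  - intros e He. destruct (HFc e He) as [H1 H2]. apply cont_in_plus; auto.
    apply (cont_in_mult (fun _ => lam)); auto. apply cont_in_const.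
Qed.

End Integrand.

(** The density computed in coordinates is rewritten in the moving frame, the
    form in which it can be integrated by parts.  Commuting the derivatives in
    [e] and [t] identifies the variation of the acceleration with the derivative
    of the variation of the velocity. *)
Lemma first_variation e0 lam G : 0 < e0 -> smooth_family e0 a b G ->
  (forall e, Rabs e < e0 -> regular_curve a b (G e)) -> smooth_curve a b (G 0) ->
  is_derive (fun e => elastic_energy a b (G e) + lam * curve_length a b (G e)) 0
    (RInt (first_variation_density lam (G 0)
             (D_eps (D_par a b (fun e => xcoord (G e))) 0)
             (D_eps (D_par a b (fun e => ycoord (G e))) 0)) a b).
Proof.
  intros He0 HG Hreg Hs0.
  assert (H0 : Rabs 0 < e0) by (rewrite Rabs_R0; auto).
  set (X := fun e => xcoord (G e)) in *. set (Y := fun e => ycoord (G e)) in *.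
  assert (HX : forall k, class_C k e0 a b X) by (intros k; apply (HG k)).
  assert (HY : forall k, class_C k e0 a b Y) by (intros k; apply (HG k)).
  assert (Hcont : forall k F, class_C k e0 a b F -> cont2 a b e0 F).
  { intros k F HF. apply (continuous_on_cont2 ab). destruct k; apply HF. }
  assert (Hde : forall F, (forall k, class_C k e0 a b F) -> forall k, class_C k e0 a b (D_eps F)).
  { intros F HF k. apply (HF (S k)). }
  assert (Hdp : forall F, (forall k, class_C k e0 a b F) -> forall k, class_C k e0 a b (D_par a b F)).
  { intros F HF k. apply (HF (S k)). }
  assert (Hder : forall F, (forall k, class_C k e0 a b F) -> forall e t, Rabs e < e0 -> a <= t <= b ->
     is_derive (fun e => F e t) e (D_eps F e t)).
  { intros F HF e t He Ht. apply Derive_correct. apply (HF 1%nat); auto. }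
  set (x1 := D_par a b X). set (y1 := D_par a b Y).
  set (x2 := D_par a b x1). set (y2 := D_par a b y1).
  assert (Hw : forall e t, Rabs e < e0 -> a <= t <= b -> 0 < x1 e t ^ 2 + y1 e t ^ 2).
  { intros e t He Ht. pose proof (speed_pos (G e) t (Hreg e He) Ht).
    pose proof (speed_sqr (G e) t) as E. simpl in E.
    change (Derive_in a b (xcoord (G e)) t) with (x1 e t) in E.
    change (Derive_in a b (ycoord (G e)) t) with (y1 e t) in E. simpl. nra. }
  pose proof (is_derive_energy_integral e0 lam x1 y1 x2 y2 (D_eps x1) (D_eps y1) (D_eps x2) (D_eps y2)
     He0 Hw) as K.
  unfold x1, y1, x2, y2 in *.
  specialize (K (Hder _ (Hdp _ HX)) (Hder _ (Hdp _ HY)) (Hder _ (Hdp _ (Hdp _ HX)))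
     (Hder _ (Hdp _ (Hdp _ HY)))).
  specialize (K (Hcont O _ (Hdp _ HX O)) (Hcont O _ (Hdp _ HY O)) (Hcont O _ (Hdp _ (Hdp _ HX) O))
     (Hcont O _ (Hdp _ (Hdp _ HY) O))).
  specialize (K (Hcont O _ (Hde _ (Hdp _ HX) O)) (Hcont O _ (Hde _ (Hdp _ HY) O))
     (Hcont O _ (Hde _ (Hdp _ (Hdp _ HX)) O)) (Hcont O _ (Hde _ (Hdp _ (Hdp _ HY)) O))).
  match type of K with is_derive _ _ ?v =>
    match goal with |- is_derive _ _ ?w => replace w with v; [exact K|] end end.
  apply RInt_ext. intros t Ht. rewrite Rmin_left, Rmax_right in Ht by lra.
  assert (Ht' : a <= t <= b) by lra.
  pose proof (speed_pos (G 0) t (Hreg 0 H0) Ht') as Hv.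
  pose proof (speed_sqr (G 0) t) as E.
  assert (Dp : is_derive_in a b (D_eps (D_par a b X) 0) t (D_eps (D_par a b (D_par a b X)) 0 t)).
  { apply (is_derive_in_D_eps ab e0); auto. }
  assert (Dq : is_derive_in a b (D_eps (D_par a b Y) 0) t (D_eps (D_par a b (D_par a b Y)) 0 t)).
  { apply (is_derive_in_D_eps ab e0); auto. }
  pose proof (is_derive_in_inv_speed (G 0) Hs0 (Hreg 0 H0) t Ht') as Dv.
  unfold first_variation_density.
  unfold Rdiv at 1 2.
  rewrite (Derive_in_eq ab t _ _ Ht' (is_derive_in_mult _ _ t _ _ Ht' Dp Dv)).
  rewrite (Derive_in_eq ab t _ _ Ht' (is_derive_in_mult _ _ t _ _ Ht' Dq Dv)).
  unfold curvature, tangent_x, tangent_y.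
  change (Derive_in a b (xcoord (G 0))) with (D_par a b X 0).
  change (Derive_in a b (ycoord (G 0))) with (D_par a b Y 0).
  change (Derive_in a b (D_par a b X 0)) with (D_par a b (D_par a b X) 0).
  change (Derive_in a b (D_par a b Y 0)) with (D_par a b (D_par a b Y) 0).
  change (velocity a b (G 0) t) with (D_par a b X 0 t, D_par a b Y 0 t) in *.
  change (acceleration a b (G 0) t) with (D_par a b (D_par a b X) 0 t, D_par a b (D_par a b Y) 0 t).
  cbn [fst snd] in *.
  change (sqrt (D_par a b X 0 t ^ 2 + D_par a b Y 0 t ^ 2)) with (speed a b (G 0) t).
  clear K Hw Dp Dq Dv. subst x2 y2. subst x1 y1.
  generalize dependent (speed a b (G 0) t).
  generalize (D_eps (D_par a b X) 0 t) (D_eps (D_par a b Y) 0 t)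
    (D_eps (D_par a b (D_par a b X)) 0 t) (D_eps (D_par a b (D_par a b Y)) 0 t)
    (D_par a b (D_par a b X) 0 t) (D_par a b (D_par a b Y) 0 t)
    (D_par a b X 0 t) (D_par a b Y 0 t).
  intros p q p2 q2 u2 w2 u1 w1 v Hv E. real_eq.
  set (r := / v). assert (Er : r ^ 2 * (u1 ^ 2 + w1 ^ 2) = 1) by (unfold r; rewrite <- E; field; lra).
  unfold Rdiv. rewrite <- !pow_inv. fold r.
  (* both sides agree only after this term is homogenized by r ^ 2 * (u1 ^ 2 + w1 ^ 2) = 1 *)
  assert (Ecv : (u1 * w2 - w1 * u2) * r ^ 5 = (u1 * w2 - w1 * u2) * r ^ 7 * (u1 ^ 2 + w1 ^ 2)).
  { transitivity ((u1 * w2 - w1 * u2) * r ^ 5 * (r ^ 2 * (u1 ^ 2 + w1 ^ 2))); [rewrite Er|]; ring. }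
  transitivity (2 * ((u1 * w2 - w1 * u2) * r ^ 5) * (p * w2 + u1 * q2 - q * u2 - w1 * p2) -
    5 * (u1 * w2 - w1 * u2) ^ 2 * r ^ 7 * (u1 * p + w1 * q) + lam * r * (u1 * p + w1 * q)); [ring|].
  transitivity (2 * ((u1 * w2 - w1 * u2) * r ^ 5) * (u1 * q2 - w1 * p2) +
    2 * ((u1 * w2 - w1 * u2) * r ^ 5) * (p * w2 - q * u2) -
    5 * (u1 * w2 - w1 * u2) ^ 2 * r ^ 7 * (u1 * p + w1 * q) + lam * r * (u1 * p + w1 * q)); [ring|].
  rewrite Ecv at 2. ring.
Qed.

End Frame.

Arguments tangent_x a b h t : clear implicits.
Arguments tangent_y a b h t : clear implicits.
Arguments first_variation_density a b lam h p q t : clear implicits.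

(** * The elastica equations and their invariance under reparametrization *)

(** The integrated form of [2 k_s N + (k ^ 2 - lam) T = (C, 0)] for a curve that
    starts on the x-axis with zero curvature. *)
Definition elastica_equations (a b : R) (h : R -> R * R) (C lam : R) : Prop :=
  forall t, a <= t <= b ->
    curvature a b h t = - (C / 2) * ycoord h t /\
    curvature a b h t ^ 2 - lam = C * tangent_x a b h t.

(** By the Frenet equations, the curvature is determined by the derivative of
    the unit tangent; this replaces the second derivatives of the coordinates
    whenever the unit tangent is known explicitly. *)
Lemma curvature_unique a b (ab : a < b) h k t : smooth_curve a b h -> regular_curve a b h ->
  a <= t <= b ->
  is_derive_in a b (tangent_x a b h) t (- (speed a b h t * k * tangent_y a b h t)) ->
  is_derive_in a b (tangent_y a b h) t (speed a b h t * k * tangent_x a b h t) ->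
  curvature a b h t = k.
Proof.
  intros Hs Hr Ht Hx Hy.
  pose proof (is_derive_in_tangent_x ab h Hs Hr t Ht) as Hx'.
  pose proof (is_derive_in_tangent_y ab h Hs Hr t Ht) as Hy'.
  pose proof (is_derive_in_unique ab t _ _ _ Ht Hx Hx') as Ex.
  pose proof (is_derive_in_unique ab t _ _ _ Ht Hy Hy') as Ey.
  pose proof (tangent_unit h t Hr Ht) as E1.
  pose proof (speed_pos h t Hr Ht) as Hv.
  set (v := speed a b h t) in *. set (p := tangent_x a b h t) in *. set (q := tangent_y a b h t) in *.
  set (c := curvature a b h t) in *.
  apply (Rmult_eq_reg_l v); [|lra].
  replace (v * c) with ((v * c * p) * p + (v * c * q) * q) by
    (transitivity (v * c * (p ^ 2 + q ^ 2)); [ring | rewrite E1; ring]).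
  replace (v * c * q) with (v * k * q) by lra. rewrite <- Ey.
  transitivity (v * k * (p ^ 2 + q ^ 2)); [ring | rewrite E1; ring].
Qed.

Section Reparametrization.
Context {a b : R} (ab : a < b) (g h : R -> R * R) (phi : R -> R).
Context (Hgs : smooth_curve 0 1 g).
Context (Hgr : regular_curve 0 1 g).
Context (Hhs : smooth_curve a b h).
Context (Hhr : regular_curve a b h).
Context (Hphi : smooth_in a b phi).
Context (Hphia : phi a = 0).
Context (Hphib : phi b = 1).
Context (Hphi' : forall t : R, a <= t <= b -> 0 < Derive_in a b phi t).
Context (Hgh : forall t : R, a <= t <= b -> h t = g (phi t)).

Lemma reparametrization_range t : a <= t <= b -> 0 <= phi t <= 1.
Proof.
  intros Ht.
  assert (Hd : forall u, a <= u <= b -> is_derive_in a b phi u (Derive_in a b phi u)).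
  { intros; apply (smooth_in_is_derive ab); auto. }
  assert (Hi := increasing_in ab phi _ Hd Hphi').
  split.
  - destruct (Req_dec t a) as [->|]; [lra|]. rewrite <- Hphia. left. apply Hi; lra.
  - destruct (Req_dec t b) as [->|]; [lra|]. rewrite <- Hphib. left. apply Hi; lra.
Qed.

Let is_derive_phi t (Ht : a <= t <= b) : is_derive_in a b phi t (Derive_in a b phi t) :=
  smooth_in_is_derive ab phi t Hphi Ht.

Lemma reparametrization_derive_x t : a <= t <= b -> Derive_in a b (xcoord h) t =
  speed 0 1 g (phi t) * tangent_x 0 1 g (phi t) * Derive_in a b phi t.
Proof.
  intros Ht. apply (Derive_in_eq ab); auto.
  apply (is_derive_in_ext t (fun u => xcoord g (phi u))); auto.
  { intros u Hu. unfold xcoord. rewrite Hgh; auto. }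
  apply (is_derive_in_comp a b 0 1); auto; [apply reparametrization_range|].
  apply is_derive_in_xcoord; auto; [lra | apply reparametrization_range; auto].
Qed.

Lemma reparametrization_derive_y t : a <= t <= b -> Derive_in a b (ycoord h) t =
  speed 0 1 g (phi t) * tangent_y 0 1 g (phi t) * Derive_in a b phi t.
Proof.
  intros Ht. apply (Derive_in_eq ab); auto.
  apply (is_derive_in_ext t (fun u => ycoord g (phi u))); auto.
  { intros u Hu. unfold ycoord. rewrite Hgh; auto. }
  apply (is_derive_in_comp a b 0 1); auto; [apply reparametrization_range|].
  apply is_derive_in_ycoord; auto; [lra | apply reparametrization_range; auto].
Qed.

Lemma reparametrization_speed t : a <= t <= b ->
  speed a b h t = speed 0 1 g (phi t) * Derive_in a b phi t.
Proof.
  intros Ht. pose proof (reparametrization_range t Ht) as Hp.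
  pose proof (tangent_unit g (phi t) Hgr Hp) as E.
  pose proof (speed_pos g (phi t) Hgr Hp). pose proof (Hphi' t Ht).
  unfold speed at 1. simpl fst. simpl snd.
  rewrite reparametrization_derive_x, reparametrization_derive_y by auto.
  replace (_ + _) with ((speed 0 1 g (phi t) * Derive_in a b phi t) ^ 2 *
    (tangent_x 0 1 g (phi t) ^ 2 + tangent_y 0 1 g (phi t) ^ 2)) by ring.
  rewrite E, Rmult_1_r. apply sqrt_pow2. apply Rmult_le_pos; lra.
Qed.

Lemma reparametrization_tangent_x t : a <= t <= b -> tangent_x a b h t = tangent_x 0 1 g (phi t).
Proof.
  intros Ht. unfold tangent_x at 1. simpl fst.
  rewrite reparametrization_derive_x, reparametrization_speed by auto.
  pose proof (speed_pos g (phi t) Hgr (reparametrization_range t Ht)). pose proof (Hphi' t Ht).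
  field. lra.
Qed.

Lemma reparametrization_tangent_y t : a <= t <= b -> tangent_y a b h t = tangent_y 0 1 g (phi t).
Proof.
  intros Ht. unfold tangent_y at 1. simpl snd.
  rewrite reparametrization_derive_y, reparametrization_speed by auto.
  pose proof (speed_pos g (phi t) Hgr (reparametrization_range t Ht)). pose proof (Hphi' t Ht).
  field. lra.
Qed.

Lemma reparametrization_curvature t : a <= t <= b -> curvature a b h t = curvature 0 1 g (phi t).
Proof.
  intros Ht. pose proof (reparametrization_range t Ht) as Hp.
  apply curvature_unique; auto.
  - apply (is_derive_in_ext t (fun u => tangent_x 0 1 g (phi u))); auto.
    { intros; symmetry; apply reparametrization_tangent_x; auto. }
    rewrite reparametrization_tangent_y, reparametrization_speed by auto.
    replace (- _) with (- (speed 0 1 g (phi t) * curvature 0 1 g (phi t) * tangent_y 0 1 g (phi t))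
       * Derive_in a b phi t) by ring.
    apply (is_derive_in_comp a b 0 1); auto; [apply reparametrization_range|].
    apply is_derive_in_tangent_x; auto; lra.
  - apply (is_derive_in_ext t (fun u => tangent_y 0 1 g (phi u))); auto.
    { intros; symmetry; apply reparametrization_tangent_y; auto. }
    rewrite reparametrization_tangent_x, reparametrization_speed by auto.
    replace (_ * tangent_x _ _ _ _) with
      ((speed 0 1 g (phi t) * curvature 0 1 g (phi t) * tangent_x 0 1 g (phi t))
       * Derive_in a b phi t) by ring.
    apply (is_derive_in_comp a b 0 1); auto; [apply reparametrization_range|].
    apply is_derive_in_tangent_y; auto; lra.
Qed.

Lemma reparametrization_elastica C lam :
  elastica_equations 0 1 g C lam -> elastica_equations a b h C lam.
Proof.
  intros H t Ht. destruct (H (phi t) (reparametrization_range t Ht)) as [H1 H2].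
  rewrite reparametrization_curvature, reparametrization_tangent_x by auto.
  unfold ycoord. rewrite Hgh by auto. auto.
Qed.

End Reparametrization.

(** * Solutions of the elastica equations are critical *)

(** With [p] and [q] the derivatives of the components of the variation field,
    the elastica equations turn the density of the first variation into the
    derivative of [2 k N.(p, q) / v - C eta], where [eta] is the horizontal
    component of the field.  At the ends [k] vanishes because [y] does, and
    [eta] vanishes because the end points are fixed. *)
Lemma elastica_critical l g C lam : smooth_curve 0 1 g -> regular_curve 0 1 g ->
  elastica_equations 0 1 g C lam ->
  forall e0 a b G, 0 < e0 -> a < b -> admissible_family l g e0 a b G ->
    is_derive (fun e => elastic_energy a b (G e) + lam * curve_length a b (G e)) 0 0.
Proof.
  intros Hgs Hgr Hel e0 a b G He0 ab [HG [Hadm [phi [Hphi [Hphia [Hphib [Hphi' Hgh]]]]]]].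
  assert (H0 : Rabs 0 < e0) by (rewrite Rabs_R0; auto).
  assert (Hreg : forall e, Rabs e < e0 -> regular_curve a b (G e)) by (intros; apply Hadm; auto).
  set (X := fun e => xcoord (G e)). set (Y := fun e => ycoord (G e)).
  assert (HX : forall k, class_C k e0 a b X) by (intros k; apply (HG k)).
  assert (HY : forall k, class_C k e0 a b Y) by (intros k; apply (HG k)).
  assert (Hs0 : smooth_curve a b (G 0)).
  { split; [apply (class_C_smooth_in a b ab e0 0 X) | apply (class_C_smooth_in a b ab e0 0 Y)]; auto. }
  assert (Hr0 := Hreg 0 H0).
  assert (E := reparametrization_elastica ab g (G 0) phi Hgs Hgr Hs0 Hr0 Hphi Hphia Hphib Hphi'
    Hgh C lam Hel).
  pose proof (first_variation ab e0 lam G He0 HG Hreg Hs0) as K.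
  fold X Y in K.
  set (p := D_eps (D_par a b X) 0) in K. set (q := D_eps (D_par a b Y) 0) in K.
  set (eta := D_eps X 0).
  assert (Hp : smooth_in a b p).
  { apply (class_C_smooth_in a b ab e0 0 (D_eps (D_par a b X))); auto. intros k. apply (HX (S (S k))). }
  assert (Hq : smooth_in a b q).
  { apply (class_C_smooth_in a b ab e0 0 (D_eps (D_par a b Y))); auto. intros k. apply (HY (S (S k))). }
  assert (Heta : forall t, a <= t <= b -> is_derive_in a b eta t (p t)).
  { apply (is_derive_in_D_eps ab e0 X); auto. }
  assert (Hloc : forall P : R -> Prop, (forall e, Rabs e < e0 -> P e) -> locally 0 P).
  { intros P HP. exists (mkposreal e0 He0). intros e He. apply HP.
    change (Rabs (e - 0) < e0) in He. rewrite Rminus_0_r in He. exact He. }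
  assert (Hea : eta a = 0).
  { apply is_derive_unique. apply (is_derive_ext_loc (fun _ => 0)).
    - apply Hloc. intros e He. unfold X, xcoord. destruct (Hadm e He) as [_ [-> _]]. reflexivity.
    - apply (is_derive_const (V := R_NormedModule)). }
  assert (Heb : eta b = 0).
  { apply is_derive_unique. apply (is_derive_ext_loc (fun _ => l)).
    - apply Hloc. intros e He. unfold X, xcoord. destruct (Hadm e He) as [_ [_ ->]]. reflexivity.
    - apply (is_derive_const (V := R_NormedModule)). }
  assert (Hka : curvature a b (G 0) a = 0).
  { destruct (E a) as [E1 _]; [lra|]. rewrite E1. unfold ycoord.
    destruct (Hadm 0 H0) as [_ [-> _]]. simpl. ring. }
  assert (Hkb : curvature a b (G 0) b = 0).
  { destruct (E b) as [E1 _]; [lra|]. rewrite E1. unfold ycoord.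
    destruct (Hadm 0 H0) as [_ [_ ->]]. simpl. ring. }
  clearbody p q eta. clear HX HY X Y Hloc.
  set (h := G 0) in *. clearbody h.
  match type of K with is_derive _ _ ?v => replace v with 0 in K; [exact K|] end.
  symmetry. apply is_RInt_unique.
  set (v := speed a b h) in *. set (k := curvature a b h) in *.
  set (tx := tangent_x a b h) in *. set (ty := tangent_y a b h) in *.
  pose proof (smooth_in_inv_speed ab h Hs0 Hr0) as Hsv.
  pose proof (smooth_in_tangent_x ab h Hs0 Hr0) as Htx. fold tx in Htx.
  pose proof (smooth_in_tangent_y ab h Hs0 Hr0) as Hty. fold ty in Hty.
  pose proof (smooth_in_curvature ab h Hs0 Hr0) as Hk. fold k in Hk.
  set (pv := fun t => p t / v t). set (qv := fun t => q t / v t).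
  assert (Hpv : smooth_in a b pv) by (apply (smooth_in_mult ab p); auto).
  assert (Hqv : smooth_in a b qv) by (apply (smooth_in_mult ab q); auto).
  set (B := fun t => 2 * (k t * (tx t * qv t + -1 * (ty t * pv t))) + - C * eta t).
  replace 0 with (B b - B a) by (unfold B; rewrite Hka, Hkb, Hea, Heb; ring).
  apply (is_RInt_derive_in ab B); try lra.
  - intros t Ht.
    pose proof (speed_pos h t Hr0 Ht) as Hv. fold v in Hv.
    pose proof (tangent_unit h t Hr0 Ht) as Hu. fold tx ty in Hu.
    destruct (E t Ht) as [E1 E2]. fold k tx in E2.
    pose proof (is_derive_in_tangent_x ab h Hs0 Hr0 t Ht) as Dtx. fold tx ty v k in Dtx.
    pose proof (is_derive_in_tangent_y ab h Hs0 Hr0 t Ht) as Dty. fold tx ty v k in Dty.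
    assert (Dk : is_derive_in a b k t (- (C / 2) * (v t * ty t))).
    { apply (is_derive_in_ext t (fun u => - (C / 2) * ycoord h u)); auto.
      { intros u Hu'. symmetry. apply E; auto. }
      replace (- (C / 2) * (v t * ty t)) with (0 * ycoord h t + - (C / 2) * (v t * ty t)) by ring.
      apply (is_derive_in_mult (fun _ => - (C / 2))); auto.
      - apply is_derive_in_const; auto.
      - apply (is_derive_in_ycoord ab); auto. }
    pose proof (smooth_in_is_derive ab pv t Hpv Ht) as Dp.
    pose proof (smooth_in_is_derive ab qv t Hqv Ht) as Dq.
    match goal with |- is_derive_in _ _ _ _ ?d => replace d with
      (0 * (k t * (tx t * qv t + -1 * (ty t * pv t)))
       + 2 * (- (C / 2) * (v t * ty t) * (tx t * qv t + -1 * (ty t * pv t)) +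
         k t * ((v t * k t * - ty t * qv t + tx t * Derive_in a b qv t) +
           (0 * (ty t * pv t) + -1 * (v t * k t * tx t * pv t + ty t * Derive_in a b pv t))))
       + (0 * eta t + - C * p t)) end.
    + apply (is_derive_in_plus (fun t => 2 * (k t * (tx t * qv t + -1 * (ty t * pv t))))
        (fun t => - C * eta t)); auto.
      * apply (is_derive_in_mult (fun _ => 2) (fun t => k t * (tx t * qv t + -1 * (ty t * pv t)))); auto;
        [apply is_derive_in_const; auto|].
        apply (is_derive_in_mult k (fun t => tx t * qv t + -1 * (ty t * pv t))); auto.
        apply (is_derive_in_plus (fun t => tx t * qv t) (fun t => -1 * (ty t * pv t))); auto.
        -- apply (is_derive_in_mult tx); auto.
           replace (_ * - ty t) with (- (v t * k t * ty t)) by ring. auto.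
        -- apply (is_derive_in_mult (fun _ => -1) (fun t => ty t * pv t)); auto;
           [apply is_derive_in_const; auto|].
           apply (is_derive_in_mult ty); auto.
      * apply (is_derive_in_mult (fun _ => - C)); auto. apply is_derive_in_const; auto.
    + unfold first_variation_density. fold tx ty k v.
      change (fun u => q u / v u) with qv. change (fun u => p u / v u) with pv.
      replace (q t) with (v t * qv t) by (unfold qv; field; lra).
      replace (p t) with (v t * pv t) by (unfold pv; field; lra).
      replace (3 * k t ^ 2 - lam) with (2 * k t ^ 2 + C * tx t) by lra.
      apply Rminus_diag_uniq.
      transitivity (C * v t * pv t * (tx t ^ 2 + ty t ^ 2 - 1)); [field | rewrite Hu; ring].
  - apply (smooth_in_cont ab).
    pose proof (smooth_in_Derive _ Hpv) as Hpv'. pose proof (smooth_in_Derive _ Hqv) as Hqv'.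
    apply (smooth_in_ext ab (fun t => 2 * k t * (tx t * Derive_in a b qv t +
       -1 * (ty t * Derive_in a b pv t)) + -1 * ((3 * (k t * k t) + - lam) * (tx t * p t + ty t * q t)))).
    + intros t Ht. unfold first_variation_density. fold tx ty k v.
      change (fun u => q u / v u) with qv. change (fun u => p u / v u) with pv. ring.
    + prove_smooth ab.
Qed.

(** * Critical points solve the elastica equations *)

Section Necessary.
Context (l lam : R) (g : R -> R * R).
Context (Hl : 0 < l).
Context (Hs : smooth_curve 0 1 g).
Context (Hr : regular_curve 0 1 g).
Context (Hg0 : g 0 = (0, 0)).
Context (Hg1 : g 1 = (l, 0)).
Context (Hcrit : forall e0 a b G, 0 < e0 -> a < b -> admissible_family l g e0 a b G ->
   is_derive (fun e => elastic_energy a b (G e) + lam * curve_length a b (G e)) 0 0).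

Let u01 := Rlt_0_1.
Let v := speed 0 1 g.
Let k := curvature 0 1 g.
Let tx := tangent_x 0 1 g.
Let ty := tangent_y 0 1 g.

Let Hv t : 0 <= t <= 1 -> 0 < v t.
Proof. apply speed_pos; auto. Qed.

(** Any pair of smooth functions of mean zero is the derivative of an admissible
    variation field, namely of its integral. *)
Lemma first_variation_zero p q : smooth_in 0 1 p -> smooth_in 0 1 q ->
  RInt p 0 1 = 0 -> RInt q 0 1 = 0 ->
  RInt (first_variation_density 0 1 lam g p q) 0 1 = 0.
Proof.
  intros Hp Hq Ip Iq.
  set (P := fun t => RInt p 0 t). set (Q := fun t => RInt q 0 t).
  assert (DP : forall t, 0 <= t <= 1 -> is_derive_in 0 1 P t (p t)).
  { intros t Ht. apply is_derive_in_RInt; auto; try lra. apply (smooth_in_cont u01); auto. }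
  assert (DQ : forall t, 0 <= t <= 1 -> is_derive_in 0 1 Q t (q t)).
  { intros t Ht. apply is_derive_in_RInt; auto; try lra. apply (smooth_in_cont u01); auto. }
  set (G := fun e t => (xcoord g t + e * P t, ycoord g t + e * Q t)).
  assert (Hsp := smooth_in_inv_speed u01 g Hs Hr). fold v in Hsp.
  (* The perturbed velocity cannot vanish while [e ^ 2 * (p ^ 2 + q ^ 2) < v ^ 2]. *)
  destruct (cont_in_bounded 0 1 (fun t => (p t * p t + q t * q t) * (/ v t * / v t)) u01) as [M [HM0 HM]].
  { apply (smooth_in_cont u01). prove_smooth u01. }
  set (e0 := / (1 + M)).
  assert (He0 : 0 < e0) by (apply Rinv_0_lt_compat; lra).
  assert (H0 : Rabs 0 < e0) by (rewrite Rabs_R0; auto).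
  assert (He1 : forall e, Rabs e < e0 -> e ^ 2 * M < 1).
  { intros e He.
    assert (e0 * (1 + M) = 1) by (unfold e0; field; lra).
    pose proof (Rabs_pos e). rewrite <- pow2_abs.
    assert (Rabs e * (1 + M) < 1) by nra. nra. }
  destruct Hs as [Hx Hy].
  assert (HPs : smooth_in 0 1 P) by (apply (smooth_in_antiderivative u01 P p); auto).
  assert (HQs : smooth_in 0 1 Q) by (apply (smooth_in_antiderivative u01 Q q); auto).
  assert (DX : forall e t, 0 <= t <= 1 ->
    is_derive_in 0 1 (xcoord (G e)) t (v t * tx t + e * p t)).
  { intros e t Ht. apply (is_derive_in_plus (xcoord g) (fun t => e * P t)); auto.
    - apply (is_derive_in_xcoord u01); auto.
    - replace (e * p t) with (0 * P t + e * p t) by ring.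
      apply (is_derive_in_mult (fun _ => e)); auto. apply is_derive_in_const; auto. }
  assert (DY : forall e t, 0 <= t <= 1 ->
    is_derive_in 0 1 (ycoord (G e)) t (v t * ty t + e * q t)).
  { intros e t Ht. apply (is_derive_in_plus (ycoord g) (fun t => e * Q t)); auto.
    - apply (is_derive_in_ycoord u01); auto.
    - replace (e * q t) with (0 * Q t + e * q t) by ring.
      apply (is_derive_in_mult (fun _ => e)); auto. apply is_derive_in_const; auto. }
  assert (HGf : smooth_family e0 0 1 G).
  { intros n. split.
    - apply (class_C_affine u01 e0 n (xcoord g) P); auto.
    - apply (class_C_affine u01 e0 n (ycoord g) Q); auto. }
  assert (HGr : forall e, Rabs e < e0 -> regular_curve 0 1 (G e)).
  { intros e He t Ht Habs. unfold velocity in Habs.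
    rewrite (Derive_in_eq u01 t _ _ Ht (DX e t Ht)), (Derive_in_eq u01 t _ _ Ht (DY e t Ht)) in Habs.
    injection Habs as A1 A2. specialize (HM t Ht). specialize (He1 e He).
    specialize (Hv t Ht). pose proof (tangent_unit g t Hr Ht) as Hu. fold tx ty in Hu.
    apply Rabs_le_between in HM. destruct HM as [_ HM].
    assert (E : e ^ 2 * ((p t * p t + q t * q t) * (/ v t * / v t)) = 1).
    { replace (e ^ 2 * _) with (((e * p t) ^ 2 + (e * q t) ^ 2) * (/ v t * / v t)) by ring.
      replace (e * p t) with (- (v t * tx t)) by lra. replace (e * q t) with (- (v t * ty t)) by lra.
      transitivity (tx t ^ 2 + ty t ^ 2); [field; lra | auto]. }
    assert (0 <= e ^ 2) by apply pow2_ge_0. nra. }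
  assert (HG0 : G 0 = g).
  { apply functional_extensionality. intros t. unfold G, xcoord, ycoord.
    rewrite !Rmult_0_l, !Rplus_0_r. symmetry. apply surjective_pairing. }
  assert (Hadm : admissible_family l g e0 0 1 G).
  { split; [auto|split].
    - intros e He. split; [auto|]. unfold G, P, Q, xcoord, ycoord.
      rewrite !RInt_point, Ip, Iq, Hg0, Hg1. unfold zero; simpl. split; f_equal; ring.
    - exists (fun t => t). repeat split; auto.
      + apply (smooth_in_id u01).
      + intros t Ht. rewrite (Derive_in_eq u01 t _ _ Ht (is_derive_in_id t Ht)). lra.
      + intros t Ht. rewrite HG0. reflexivity. }
  pose proof (Hcrit e0 0 1 G He0 u01 Hadm) as D0.
  assert (HsG : smooth_curve 0 1 (G 0)) by (rewrite HG0; split; auto).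
  pose proof (first_variation u01 e0 lam G He0 HGf HGr HsG) as D1.
  pose proof (is_derive_unique _ _ _ D0) as U0. pose proof (is_derive_unique _ _ _ D1) as U1.
  rewrite U0, HG0 in U1. symmetry in U1. refine (eq_trans _ U1). clear U0 U1 D0 D1.
  assert (Ep : forall t, 0 <= t <= 1 -> D_eps (D_par 0 1 (fun e => xcoord (G e))) 0 t = p t).
  { intros t Ht. unfold D_eps, D_par. apply is_derive_unique.
    apply (is_derive_ext (fun e => v t * tx t + e * p t)).
    - intros e. symmetry. apply (Derive_in_eq u01); auto.
    - auto_derive; auto; ring. }
  assert (Eq : forall t, 0 <= t <= 1 -> D_eps (D_par 0 1 (fun e => ycoord (G e))) 0 t = q t).
  { intros t Ht. unfold D_eps, D_par. apply is_derive_unique.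
    apply (is_derive_ext (fun e => v t * ty t + e * q t)).
    - intros e. symmetry. apply (Derive_in_eq u01); auto.
    - auto_derive; auto; ring. }
  apply RInt_ext. intros t Ht. rewrite Rmin_left, Rmax_right in Ht by lra.
  assert (Ht' : 0 <= t <= 1) by lra.
  assert (Hpv : smooth_in 0 1 (fun t => p t * / v t)) by prove_smooth u01.
  assert (Hqv : smooth_in 0 1 (fun t => q t * / v t)) by prove_smooth u01.
  unfold first_variation_density. rewrite Ep, Eq by auto.
  rewrite (Derive_in_ext u01 t (fun u => p u / speed 0 1 g u)
     (fun u => D_eps (D_par 0 1 (fun e => xcoord (G e))) 0 u / speed 0 1 g u)); auto.
  2: exact (Hpv O t Ht'). 2: intros u Hu; rewrite Ep; auto.
  rewrite (Derive_in_ext u01 t (fun u => q u / speed 0 1 g u)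
     (fun u => D_eps (D_par 0 1 (fun e => ycoord (G e))) 0 u / speed 0 1 g u)); auto.
  exact (Hqv O t Ht'). intros u Hu; rewrite Eq; auto.
Qed.

(** [V1] and [V2] are the components of the vector [2 k' N / v + (k ^ 2 - lam) T]
    that will turn out to be constant, [B1] and [B2] those of the boundary term
    [2 k N / v]. *)
Let k' := Derive_in 0 1 k.
Let V1 t := -2 * (k' t * (ty t * / v t)) + (k t * k t + - lam) * tx t.
Let V2 t := 2 * (k' t * (tx t * / v t)) + (k t * k t + - lam) * ty t.
Let B1 t := -2 * (k t * (ty t * / v t)).
Let B2 t := 2 * (k t * (tx t * / v t)).

Lemma conserved_vector_smooth : smooth_in 0 1 V1 /\ smooth_in 0 1 V2.
Proof.
  pose proof (smooth_in_inv_speed u01 g Hs Hr) as H1. fold v in H1.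
  pose proof (smooth_in_tangent_x u01 g Hs Hr) as H2. fold tx in H2.
  pose proof (smooth_in_tangent_y u01 g Hs Hr) as H3. fold ty in H3.
  pose proof (smooth_in_curvature u01 g Hs Hr) as H4. fold k in H4.
  pose proof (smooth_in_Derive _ H4) as H5. fold k' in H5.
  split; unfold V1, V2; prove_smooth u01.
Qed.

Lemma first_variation_by_parts p q : smooth_in 0 1 p -> smooth_in 0 1 q ->
  is_RInt (fun t => first_variation_density 0 1 lam g p q t + (V1 t * p t + V2 t * q t)) 0 1
    ((B1 1 * p 1 + B2 1 * q 1) - (B1 0 * p 0 + B2 0 * q 0)).
Proof.
  intros Hp Hq.
  pose proof (smooth_in_inv_speed u01 g Hs Hr) as H1. fold v in H1.
  pose proof (smooth_in_tangent_x u01 g Hs Hr) as H2. fold tx in H2.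
  pose proof (smooth_in_tangent_y u01 g Hs Hr) as H3. fold ty in H3.
  pose proof (smooth_in_curvature u01 g Hs Hr) as H4. fold k in H4.
  destruct conserved_vector_smooth as [HV1 HV2].
  set (pv := fun t => p t * / v t). set (qv := fun t => q t * / v t).
  assert (Hpv : smooth_in 0 1 pv) by (unfold pv; prove_smooth u01).
  assert (Hqv : smooth_in 0 1 qv) by (unfold qv; prove_smooth u01).
  set (B := fun t => 2 * (k t * (tx t * qv t + -1 * (ty t * pv t)))).
  replace (_ - _) with (B 1 - B 0) by (unfold B, B1, B2, pv, qv; ring).
  apply (is_RInt_derive_in u01 B); try lra.
  - intros t Ht.
    pose proof (Hv t Ht) as Hvt.
    pose proof (is_derive_in_tangent_x u01 g Hs Hr t Ht) as Dtx. fold tx ty v k in Dtx.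
    pose proof (is_derive_in_tangent_y u01 g Hs Hr t Ht) as Dty. fold tx ty v k in Dty.
    pose proof (smooth_in_is_derive u01 k t H4 Ht) as Dk. fold k' in Dk.
    pose proof (smooth_in_is_derive u01 pv t Hpv Ht) as Dp.
    pose proof (smooth_in_is_derive u01 qv t Hqv Ht) as Dq.
    match goal with |- is_derive_in _ _ _ _ ?d => replace d with
      (0 * (k t * (tx t * qv t + -1 * (ty t * pv t)))
       + 2 * (k' t * (tx t * qv t + -1 * (ty t * pv t)) +
         k t * ((- (v t * k t * ty t) * qv t + tx t * Derive_in 0 1 qv t) +
           (0 * (ty t * pv t) + -1 * (v t * k t * tx t * pv t + ty t * Derive_in 0 1 pv t))))) end.
    + apply (is_derive_in_mult (fun _ => 2) (fun t => k t * (tx t * qv t + -1 * (ty t * pv t)))); auto;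
        [apply is_derive_in_const; auto|].
      apply (is_derive_in_mult k (fun t => tx t * qv t + -1 * (ty t * pv t))); auto.
      apply (is_derive_in_plus (fun t => tx t * qv t) (fun t => -1 * (ty t * pv t))); auto.
      * apply (is_derive_in_mult tx); auto.
      * apply (is_derive_in_mult (fun _ => -1) (fun t => ty t * pv t)); auto;
           [apply is_derive_in_const; auto|].
        apply (is_derive_in_mult ty); auto.
    + unfold first_variation_density. fold tx ty k v.
      change (fun u => q u / v u) with qv. change (fun u => p u / v u) with pv.
      replace (q t) with (v t * qv t) by (unfold qv; field; lra).
      replace (p t) with (v t * pv t) by (unfold pv; field; lra).
      unfold V1, V2. field. lra.
  - apply (smooth_in_cont u01).
    pose proof (smooth_in_Derive _ Hpv) as Hpv'. pose proof (smooth_in_Derive _ Hqv) as Hqv'.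
    apply (smooth_in_ext u01 (fun t => 2 * k t * (tx t * Derive_in 0 1 qv t +
       -1 * (ty t * Derive_in 0 1 pv t)) + -1 * ((3 * (k t * k t) + - lam) * (tx t * p t + ty t * q t))
       + (V1 t * p t + V2 t * q t))).
    + intros t Ht. unfold first_variation_density. fold tx ty k v.
      change (fun u => q u / v u) with qv. change (fun u => p u / v u) with pv. ring.
    + prove_smooth u01.
Qed.

Lemma mean_zero_boundary_identity p q : smooth_in 0 1 p -> smooth_in 0 1 q ->
  RInt p 0 1 = 0 -> RInt q 0 1 = 0 ->
  RInt (fun t => V1 t * p t + V2 t * q t) 0 1 =
    (B1 1 * p 1 + B2 1 * q 1) - (B1 0 * p 0 + B2 0 * q 0).
Proof.
  intros Hp Hq Ip Iq.
  pose proof (first_variation_by_parts p q Hp Hq) as H.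
  pose proof (first_variation_zero p q Hp Hq Ip Iq) as H0.
  destruct conserved_vector_smooth as [HV1 HV2].
  assert (Hc : smooth_in 0 1 (fun t => V1 t * p t + V2 t * q t)) by prove_smooth u01.
  apply (smooth_in_cont u01) in Hc.
  assert (H2 : is_RInt (fun t => V1 t * p t + V2 t * q t) 0 1 (RInt (fun t => V1 t * p t + V2 t * q t) 0 1)).
  { apply (cont_in_is_RInt (a:=0) (b:=1)); auto; lra. }
  pose proof (is_RInt_minus (V := R_NormedModule) _ _ _ _ _ _ H H2) as H3.
  apply (is_RInt_ext (V := R_NormedModule) _ (first_variation_density 0 1 lam g p q)) in H3.
  2:{ intros t _. unfold minus, plus, opp; simpl. real_eq. ring. }
  apply (is_RInt_unique (V := R_CompleteNormedModule)) in H3.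
  rewrite H0 in H3. unfold minus, plus, opp in H3; simpl in H3. lra.
Qed.

(** The constraint on the means is removed in the manner of du Bois-Reymond:
    applying the identity to [p] and [q] minus their means costs only a constant
    vector [(c1, c2)]. *)
Lemma boundary_identity : exists c1 c2, forall p q, smooth_in 0 1 p -> smooth_in 0 1 q ->
  RInt (fun t => (V1 t + - c1) * p t + (V2 t + - c2) * q t) 0 1 =
    (B1 1 * p 1 + B2 1 * q 1) - (B1 0 * p 0 + B2 0 * q 0).
Proof.
  destruct conserved_vector_smooth as [HV1 HV2].
  assert (CV1 := smooth_in_cont u01 _ HV1). assert (CV2 := smooth_in_cont u01 _ HV2).
  exists (RInt V1 0 1 - (B1 1 - B1 0)), (RInt V2 0 1 - (B2 1 - B2 0)).
  intros p q Hp Hq.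
  set (m := RInt p 0 1). set (n := RInt q 0 1).
  assert (Ic : forall f, smooth_in 0 1 f -> is_RInt f 0 1 (RInt f 0 1)).
  { intros f Hf. apply (cont_in_is_RInt (a:=0) (b:=1)); try lra. apply (smooth_in_cont u01); auto. }
  assert (Hz : forall f, smooth_in 0 1 f -> RInt (fun t => f t + - RInt f 0 1) 0 1 = 0).
  { intros f Hf.
    pose proof (is_RInt_plus (V := R_NormedModule) _ _ _ _ _ _ (Ic f Hf)
             (is_RInt_const (V := R_NormedModule) 0 1 (- RInt f 0 1))) as A.
    apply (is_RInt_unique (V := R_CompleteNormedModule)) in A.
    refine (eq_trans A _). unfold plus, scal; simpl; unfold mult; simpl. real_eq. ring. }
  pose proof (mean_zero_boundary_identity (fun t => p t + - m) (fun t => q t + - n)) as H.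
  assert (Hp' : smooth_in 0 1 (fun t => p t + - m)) by prove_smooth u01.
  assert (Hq' : smooth_in 0 1 (fun t => q t + - n)) by prove_smooth u01.
  specialize (H Hp' Hq' (Hz p Hp) (Hz q Hq)).
  set (c1 := RInt V1 0 1 - _). set (c2 := RInt V2 0 1 - _).
  assert (Hpq : smooth_in 0 1 (fun t => V1 t * p t + V2 t * q t)) by prove_smooth u01.
  (* both integrands are expanded in the integrals of V1, V2, p, q and V1 p + V2 q *)
  set (J := RInt (fun t => V1 t * p t + V2 t * q t) 0 1).
  assert (HJ : is_RInt (fun t => V1 t * p t + V2 t * q t) 0 1 J) by (apply Ic; auto).
  assert (E1 : RInt (fun t => V1 t * (p t + - m) + V2 t * (q t + - n)) 0 1
           = J - m * RInt V1 0 1 - n * RInt V2 0 1).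
  { apply is_RInt_unique.
    pose proof (is_RInt_minus (V := R_NormedModule) _ _ _ _ _ _
      (is_RInt_minus (V := R_NormedModule) _ _ _ _ _ _ HJ
         (is_RInt_scal (V := R_NormedModule) _ _ _ m _ (Ic V1 HV1)))
      (is_RInt_scal (V := R_NormedModule) _ _ _ n _ (Ic V2 HV2))) as A.
    revert A. apply (is_RInt_ext (V := R_NormedModule)).
    intros t _. unfold minus, plus, opp, scal; simpl; unfold mult; simpl. real_eq. ring. }
  assert (E2 : RInt (fun t => (V1 t + - c1) * p t + (V2 t + - c2) * q t) 0 1
           = J - c1 * m - c2 * n).
  { apply is_RInt_unique.
    pose proof (is_RInt_minus (V := R_NormedModule) _ _ _ _ _ _
      (is_RInt_minus (V := R_NormedModule) _ _ _ _ _ _ HJ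
         (is_RInt_scal (V := R_NormedModule) _ _ _ c1 _ (Ic p Hp)))
      (is_RInt_scal (V := R_NormedModule) _ _ _ c2 _ (Ic q Hq))) as A.
    revert A. apply (is_RInt_ext (V := R_NormedModule)).
    intros t _. unfold minus, plus, opp, scal; simpl; unfold mult; simpl. real_eq. ring. }
  cbv beta in H. rewrite E1 in H. rewrite E2. unfold c1, c2.
  replace J with (m * RInt V1 0 1 + n * RInt V2 0 1 + (J - m * RInt V1 0 1 - n * RInt V2 0 1)) by ring.
  rewrite H. real_eq. ring.
Qed.

(** The test functions [t (1 - t) (V - c)] kill the boundary terms and give
    [V = c]; what is left of the identity, tested against [t] and [1 - t], gives
    [k = 0] at both ends.  Then [2 k - c2 x + c1 y] has derivative zero, and its
    values at the two ends give [c2 = 0]. *)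
Lemma critical_elastica : exists C, elastica_equations 0 1 g C lam.
Proof.
  destruct boundary_identity as [c1 [c2 Hid]].
  destruct conserved_vector_smooth as [HV1 HV2].
  set (W1 := fun t => V1 t + - c1). set (W2 := fun t => V2 t + - c2).
  assert (HW1 : smooth_in 0 1 W1) by (unfold W1; prove_smooth u01).
  assert (HW2 : smooth_in 0 1 W2) by (unfold W2; prove_smooth u01).
  pose proof (smooth_in_id u01) as Hid01.
  pose proof (smooth_in_const u01 0) as Hzero.
  assert (Hw : smooth_in 0 1 (fun t => t * (1 + -1 * t))) by prove_smooth u01.
  assert (HW : forall t, 0 <= t <= 1 -> W1 t = 0 /\ W2 t = 0).
  { set (S := fun t => t * (1 + -1 * t) * (W1 t * W1 t + W2 t * W2 t)).
    assert (HS : smooth_in 0 1 S) by (unfold S; prove_smooth u01).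
    assert (S0 : forall t, 0 <= t <= 1 -> S t = 0).
    { apply (nonneg_integral_zero u01); [apply (smooth_in_cont u01); auto | |].
      - intros t Ht. unfold S. apply Rmult_le_pos; [apply Rmult_le_pos; lra | nra].
      - rewrite (RInt_ext S (fun t => (V1 t + - c1) * (t * (1 + -1 * t) * W1 t) +
           (V2 t + - c2) * (t * (1 + -1 * t) * W2 t))).
        + rewrite (Hid (fun t => t * (1 + -1 * t) * W1 t) (fun t => t * (1 + -1 * t) * W2 t)).
          * real_eq. ring.
          * prove_smooth u01.
          * prove_smooth u01.
        + intros t _. unfold S, W1, W2. real_eq. ring. }
    assert (HI : forall t, 0 < t < 1 -> W1 t = 0 /\ W2 t = 0).
    { intros t Ht. assert (E := S0 t ltac:(lra)). unfold S in E.
      assert (0 < t * (1 + -1 * t)) by (apply Rmult_lt_0_compat; lra).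
      assert (W1 t * W1 t + W2 t * W2 t = 0) by nra. split; nra. }
    intros t Ht. split.
    - apply (cont_in_zero_closed u01 W1); auto; [apply (smooth_in_cont u01); auto | intros; apply HI; auto].
    - apply (cont_in_zero_closed u01 W2); auto; [apply (smooth_in_cont u01); auto | intros; apply HI; auto]. }
  assert (Hb : forall p q, smooth_in 0 1 p -> smooth_in 0 1 q ->
    (B1 1 * p 1 + B2 1 * q 1) - (B1 0 * p 0 + B2 0 * q 0) = 0).
  { intros p q Hp Hq. rewrite <- Hid by auto.
    rewrite (RInt_ext _ (fun _ => 0)).
    - rewrite RInt_const. unfold scal; simpl; unfold mult; simpl; ring.
    - intros t Ht. rewrite Rmin_left, Rmax_right in Ht by lra.
      destruct (HW t ltac:(lra)) as [A1 A2]. unfold W1, W2 in A1, A2. real_eq. rewrite A1, A2. ring. }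
  assert (Hk0 : k 0 = 0).
  { assert (Hm : smooth_in 0 1 (fun t => 1 + -1 * t)) by prove_smooth u01.
    pose proof (Hb (fun t => 1 + -1 * t) (fun _ => 0) Hm Hzero) as A1.
    pose proof (Hb (fun _ => 0) (fun t => 1 + -1 * t) Hzero Hm) as A2. cbv beta in A1, A2.
    pose proof (tangent_unit g 0 Hr ltac:(lra)) as Hu. fold tx ty in Hu.
    pose proof (Hv 0 ltac:(lra)) as Hv0.
    assert (B1' : k 0 * ty 0 * / v 0 = 0) by (unfold B1 in A1; lra).
    assert (B2' : k 0 * tx 0 * / v 0 = 0) by (unfold B2 in A2; lra).
    assert (0 < / v 0) by (apply Rinv_0_lt_compat; auto).
    assert (Z1 : k 0 * ty 0 = 0) by nra. assert (Z2 : k 0 * tx 0 = 0) by nra.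
    transitivity (k 0 * (tx 0 ^ 2 + ty 0 ^ 2)); [rewrite Hu; ring|].
    transitivity (k 0 * tx 0 * tx 0 + k 0 * ty 0 * ty 0); [ring|rewrite Z1, Z2; ring]. }
  exists c1.
  assert (HT : forall t, 0 <= t <= 1 ->
    2 * k' t = v t * (c2 * tx t - c1 * ty t) /\ k t ^ 2 - lam = c1 * tx t + c2 * ty t).
  { intros t Ht. destruct (HW t Ht) as [A1 A2]. unfold W1, W2, V1, V2 in A1, A2.
    pose proof (tangent_unit g t Hr Ht) as Hu. fold tx ty in Hu. pose proof (Hv t Ht) as Hvt.
    assert (E1 : c1 = -2 * (k' t * (ty t * / v t)) + (k t * k t + - lam) * tx t) by lra.
    assert (E2 : c2 = 2 * (k' t * (tx t * / v t)) + (k t * k t + - lam) * ty t) by lra.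
    rewrite E1, E2. split.
    - transitivity (2 * k' t * (tx t ^ 2 + ty t ^ 2)); [rewrite Hu; ring|field; lra].
    - transitivity ((k t ^ 2 - lam) * (tx t ^ 2 + ty t ^ 2)); [rewrite Hu; ring|field; lra]. }
  pose proof (smooth_in_curvature u01 g Hs Hr) as Hk. fold k in Hk.
  set (D := fun t => 2 * k t + (- c2 * xcoord g t + c1 * ycoord g t)).
  assert (HD : forall t, 0 <= t <= 1 -> D t = 0).
  { intros t Ht. transitivity (D 0).
    - apply (constant_in u01 D); auto. intros u Hu.
      assert (A : (0 * k u + 2 * k' u) +
        ((0 * xcoord g u + - c2 * (v u * tx u)) + (0 * ycoord g u + c1 * (v u * ty u))) = 0).
      { destruct (HT u Hu) as [A1 _]. lra. }
      refine (eq_ind _ (is_derive_in 0 1 D u) _ _ A). clear A.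
      unfold D.
      apply (is_derive_in_plus (fun t => 2 * k t) (fun t => - c2 * xcoord g t + c1 * ycoord g t)); auto.
      + apply (is_derive_in_mult (fun _ => 2)); auto; [apply is_derive_in_const; auto|].
        apply (smooth_in_is_derive u01); auto.
      + apply (is_derive_in_plus (fun t => - c2 * xcoord g t) (fun t => c1 * ycoord g t)); auto.
        * apply (is_derive_in_mult (fun _ => - c2)); auto; [apply is_derive_in_const; auto|].
          apply (is_derive_in_xcoord u01); auto.
        * apply (is_derive_in_mult (fun _ => c1)); auto; [apply is_derive_in_const; auto|].
          apply (is_derive_in_ycoord u01); auto.
    - unfold D, xcoord, ycoord. rewrite Hg0, Hk0. simpl. ring. }
  assert (Hk1 : k 1 = 0).
  { pose proof (Hb (fun t => t) (fun _ => 0) Hid01 Hzero) as A1.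
    pose proof (Hb (fun _ => 0) (fun t => t) Hzero Hid01) as A2. cbv beta in A1, A2.
    pose proof (tangent_unit g 1 Hr ltac:(lra)) as Hu. fold tx ty in Hu.
    pose proof (Hv 1 ltac:(lra)) as Hv0.
    assert (B1' : k 1 * ty 1 * / v 1 = 0) by (unfold B1 in A1; lra).
    assert (B2' : k 1 * tx 1 * / v 1 = 0) by (unfold B2 in A2; lra).
    assert (0 < / v 1) by (apply Rinv_0_lt_compat; auto).
    assert (Z1 : k 1 * ty 1 = 0) by nra. assert (Z2 : k 1 * tx 1 = 0) by nra.
    transitivity (k 1 * (tx 1 ^ 2 + ty 1 ^ 2)); [rewrite Hu; ring|].
    transitivity (k 1 * tx 1 * tx 1 + k 1 * ty 1 * ty 1); [ring|rewrite Z1, Z2; ring]. }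
  assert (Hc2 : c2 = 0).
  { pose proof (HD 1 ltac:(lra)) as A. unfold D, xcoord, ycoord in A. rewrite Hg1, Hk1 in A.
    simpl in A. assert (c2 * l = 0) by lra. nra. }
  intros t Ht. fold k tx. destruct (HT t Ht) as [_ A2]. pose proof (HD t Ht) as A1.
  unfold D in A1. rewrite Hc2 in A1, A2. split; lra.
Qed.

End Necessary.

(** * Integrals of even functions of period [PI] *)

Definition integral_from_0 (f : R -> R) (x : R) : R := RInt f 0 x.

Lemma constant_of_derive_zero (h : R -> R) x y : (forall t, is_derive h t 0) -> h x = h y.
Proof.
  intros H. destruct (Rtotal_order x y) as [L|[->|L]]; auto.
  - exact (eq_is_derive (V := R_NormedModule) h x y (fun t _ => H t) L).
  - exact (eq_sym (eq_is_derive (V := R_NormedModule) h y x (fun t _ => H t) L)).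
Qed.

Section Integral.
Context (f : R -> R).
Context (f_cont : forall x, continuous f x).

Lemma ex_RInt_of_continuous a b : ex_RInt f a b.
Proof. apply (ex_RInt_continuous (V := R_CompleteNormedModule)); auto. Qed.

Lemma is_derive_integral_from_0 x : is_derive (integral_from_0 f) x (f x).
Proof.
  apply (is_derive_RInt (V := R_NormedModule) f _ 0); auto.
  apply filter_forall. intros u. apply (RInt_correct (V := R_CompleteNormedModule)).
  apply ex_RInt_of_continuous.
Qed.

Context (f_shift : forall x, f (x + PI) = f x).
Context (f_sym : forall x, f (PI - x) = f x).

Lemma integral_from_0_PI : integral_from_0 f PI = 2 * integral_from_0 f (PI / 2).
Proof.
  set (J := integral_from_0 f).
  assert (H : J 0 + J (PI - 0) = J (PI / 2) + J (PI - PI / 2)).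
  { apply (constant_of_derive_zero (fun x => J x + J (PI - x))). intros t.
    replace 0 with (f t + (-1) * f (PI - t)) by (rewrite f_sym; ring).
    apply (is_derive_plus (V := R_NormedModule)); [apply is_derive_integral_from_0|].
    apply (is_derive_comp (V := R_NormedModule) J (fun x => PI - x)).
    - apply is_derive_integral_from_0.
    - auto_derive; auto; ring. }
  replace (PI - PI / 2) with (PI / 2) in H by field. rewrite Rminus_0_r in H.
  assert (E : J 0 = 0) by (exact (RInt_point 0 f)).
  change (J PI = 2 * J (PI / 2)). lra.
Qed.

Lemma integral_from_0_shift (n : nat) x :
  integral_from_0 f (x + INR n * PI) = integral_from_0 f x + 2 * INR n * integral_from_0 f (PI / 2).
Proof.
  induction n as [|n IH].
  - simpl. rewrite Rmult_0_l, Rplus_0_r. ring.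
  - set (J := integral_from_0 f) in *.
    assert (H : forall y, J (y + PI) - J y = J (0 + PI) - J 0).
    { intros y. apply (constant_of_derive_zero (fun x => J (x + PI) - J x)). intros t.
      replace 0 with (1 * f (t + PI) - f t) by (rewrite f_shift; ring).
      apply (is_derive_minus (V := R_NormedModule)); [|apply is_derive_integral_from_0].
      apply (is_derive_comp (V := R_NormedModule) J (fun x => x + PI)).
      - apply is_derive_integral_from_0.
      - auto_derive; auto; ring. }
    specialize (H (x + INR n * PI)).
    replace (x + INR (S n) * PI) with (x + INR n * PI + PI) by (rewrite S_INR; ring).
    change (J (x + INR n * PI + PI) = J x + 2 * INR (S n) * J (PI / 2)).
    change (J (x + INR n * PI) = J x + 2 * INR n * J (PI / 2)) in IH.
    assert (E : J 0 = 0) by (exact (RInt_point 0 f)).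
    assert (E' : J PI = 2 * J (PI / 2)) by apply integral_from_0_PI.
    rewrite Rplus_0_l, E, E', IH in H. rewrite S_INR. lra.
Qed.

(** The substitution [z = sin theta] turns the improper integral into an integral
    up to [asin z]; the limit uses that [asin z] tends to [PI / 2] as [z] tends
    to 1, which is read off the monotonicity of [sin]. *)
Lemma RInt_gen_sin_substitution (h : R -> R) :
  (forall z, 0 <= z < 1 -> h z = / sqrt (1 - z ^ 2) * f (asin z)) ->
  RInt_gen h (at_point 0) (at_left 1) = integral_from_0 f (PI / 2).
Proof.
  intros Hh. pose proof PI_RGT_0 as HPI.
  set (J := integral_from_0 f).
  assert (Hd : forall z, 0 <= z < 1 -> is_derive asin z (/ sqrt (1 - z ^ 2))).
  { intros z Hz. apply is_derive_Reals. assert (Hz' : -1 < z < 1) by lra.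
    apply (derive_pt_eq_1 asin z _ (derivable_pt_asin z Hz')).
    rewrite derive_pt_asin. unfold Rsqr, Rdiv. rewrite Rmult_1_l. f_equal. f_equal. ring. }
  assert (HJ : forall z, 0 <= z < 1 -> is_RInt h 0 z (J (asin z))).
  { intros z Hz.
    apply (is_RInt_ext (V := R_NormedModule) (fun u => / sqrt (1 - u ^ 2) * f (asin u))).
    { intros u Hu. rewrite Rmin_left, Rmax_right in Hu by lra. symmetry; apply Hh; lra. }
    replace (J (asin z)) with (minus (J (asin z)) (J (asin 0))).
    2:{ rewrite asin_0. assert (E : J 0 = 0) by (exact (RInt_point 0 f)). rewrite E.
      unfold minus, plus, opp; simpl. ring. }
    apply (is_RInt_derive (V := R_CompleteNormedModule) (fun u => J (asin u))).
    - intros u Hu. rewrite Rmin_left, Rmax_right in Hu by lra.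
      apply (is_derive_comp (V := R_NormedModule) J asin); [apply is_derive_integral_from_0|].
      apply Hd; lra.
    - intros u Hu. rewrite Rmin_left, Rmax_right in Hu by lra.
      apply (continuous_mult (K := R_AbsRing) (fun u => / sqrt (1 - u ^ 2)) (fun u => f (asin u))).
      + assert (Hp : 0 < 1 - u ^ 2) by nra. pose proof (sqrt_lt_R0 _ Hp).
        apply (ex_derive_continuous (V := R_NormedModule)). auto_derive.
        replace (1 + - (u * (u * 1))) with (1 - u ^ 2) by ring. repeat split; lra.
      + apply (continuous_comp asin f); auto.
        apply (ex_derive_continuous (V := R_NormedModule)). eexists. apply Hd; lra. }
  apply is_RInt_gen_unique.
  intros P HP.
  assert (HJc : continuous J (PI / 2)).
  { apply (ex_derive_continuous (V := R_NormedModule)). exists (f (PI / 2)). apply is_derive_integral_from_0. }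
  destruct (HJc P HP) as [d Hdd].
  set (m := Rmin (d / 2) (PI / 2)).
  assert (Hm : 0 < m) by (apply Rmin_glb_lt; [apply is_pos_div_2 | lra]).
  assert (Hmd : m < d) by (pose proof (Rmin_l (d / 2) (PI / 2)); pose proof (cond_pos d); unfold m; lra).
  assert (Hm2 : m <= PI / 2) by apply Rmin_r.
  set (z0 := sin (PI / 2 - m)).
  assert (Hz0 : z0 < 1).
  { rewrite <- sin_PI2. apply sin_increasing_1; lra. }
  assert (Hz0' : 0 <= z0) by (apply sin_ge_0; lra).
  apply (Filter_prod _ _ _ (fun x => x = 0) (fun z => z0 < z < 1)).
  - reflexivity.
  - assert (Hq : 0 < 1 - z0) by lra. exists (mkposreal _ Hq). intros z Hz Hz1.
    change (Rabs (z - 1) < 1 - z0) in Hz. apply Rabs_def2 in Hz. lra.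
  - intros x z -> Hz. simpl. exists (J (asin z)). split; [apply HJ; lra|].
    apply (Hdd (asin z)). change (Rabs (asin z - PI / 2) < d).
    pose proof (asin_bound z).
    assert (PI / 2 - m <= asin z).
    { apply sin_incr_0; try lra. rewrite sin_asin by lra. fold z0. lra. }
    apply Rabs_def1; lra.
Qed.

End Integral.

(** * The amplitude and the functions sn, cn and dn *)

Section Jacobi.
Context (p : R).
Context (Hp : 0 < p < 1).

Definition delta_sqr (t : R) : R := 1 - p ^ 2 * sin t ^ 2.

Lemma delta_sqr_bounds t : 1 - p ^ 2 <= delta_sqr t <= 1.
Proof.
  unfold delta_sqr. pose proof (sin2_cos2 t) as E. unfold Rsqr in E.
  assert (0 <= sin t ^ 2 <= 1) by nra. assert (0 < p ^ 2) by nra. nra.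
Qed.

Lemma one_minus_p2_pos : 0 < 1 - p ^ 2.
Proof. nra. Qed.

Lemma delta_sqr_pos t : 0 < delta_sqr t.
Proof. pose proof (delta_sqr_bounds t). pose proof one_minus_p2_pos. lra. Qed.

Definition integrand_K (t : R) : R := 1 / sqrt (1 - p ^ 2 * sin t ^ 2).
Definition integrand_E (t : R) : R := sqrt (1 - p ^ 2 * sin t ^ 2).

Lemma integrand_E_continuous t : continuous integrand_E t.
Proof.
  apply (ex_derive_continuous (V := R_NormedModule)). unfold integrand_E. auto_derive.
  pose proof (delta_sqr_pos t). unfold delta_sqr in *. simpl in *. auto.
Qed.

Lemma integrand_E_pos t : 0 < integrand_E t.
Proof. apply sqrt_lt_R0, delta_sqr_pos. Qed.

Lemma integrand_E_le_1 t : integrand_E t <= 1.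
Proof.
  apply Rle_trans with (sqrt 1); [apply sqrt_le_1_alt, delta_sqr_bounds | rewrite sqrt_1; lra].
Qed.

Lemma integrand_K_continuous t : continuous integrand_K t.
Proof.
  apply (ex_derive_continuous (V := R_NormedModule)). unfold integrand_K. auto_derive.
  replace (1 + - (p * (p * 1) * (sin t * (sin t * 1)))) with (delta_sqr t) by (unfold delta_sqr; ring).
  pose proof (delta_sqr_pos t) as H. pose proof (sqrt_lt_R0 _ H). repeat split; lra.
Qed.

Lemma integrand_K_eq t : integrand_K t = / integrand_E t.
Proof. unfold integrand_K, integrand_E. unfold Rdiv. ring. Qed.

Lemma integrand_K_ge_1 t : 1 <= integrand_K t.
Proof.
  rewrite integrand_K_eq, <- Rinv_1. apply Rinv_le_contravar; [apply integrand_E_pos|].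
  apply integrand_E_le_1.
Qed.

Lemma integrand_shift t : integrand_K (t + PI) = integrand_K t /\ integrand_E (t + PI) = integrand_E t.
Proof.
  unfold integrand_K, integrand_E. rewrite neg_sin.
  replace ((- sin t) ^ 2) with (sin t ^ 2) by ring. auto.
Qed.

Lemma integrand_reflect t : integrand_K (PI - t) = integrand_K t /\ integrand_E (PI - t) = integrand_E t.
Proof. unfold integrand_K, integrand_E. rewrite sin_PI_x. auto. Qed.

Definition incomplete_F (x : R) : R := integral_from_0 integrand_K x.
Definition incomplete_E (x : R) : R := integral_from_0 integrand_E x.

Lemma ellK_eq : ellK p = incomplete_F (PI / 2).
Proof.
  unfold ellK, incomplete_F. apply (RInt_gen_sin_substitution integrand_K integrand_K_continuous).
  intros z Hz. unfold integrand_K. rewrite sin_asin by lra.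
  assert (0 < 1 - z ^ 2) by nra. assert (0 < 1 - p ^ 2 * z ^ 2).
  { assert (0 <= z ^ 2 <= 1) by nra. pose proof one_minus_p2_pos. nra. }
  pose proof (sqrt_lt_R0 _ H). pose proof (sqrt_lt_R0 _ H0). field. lra.
Qed.

Lemma ellE_eq : ellE p = incomplete_E (PI / 2).
Proof.
  unfold ellE, incomplete_E. apply (RInt_gen_sin_substitution integrand_E integrand_E_continuous).
  intros z Hz. unfold integrand_E. rewrite sin_asin by lra. unfold Rdiv. ring.
Qed.

Lemma incomplete_F_shift n x : incomplete_F (x + INR n * PI) = incomplete_F x + 2 * INR n * ellK p.
Proof.
  rewrite ellK_eq. apply integral_from_0_shift.
  - apply integrand_K_continuous.
  - intros; apply integrand_shift.
  - intros; apply integrand_reflect.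
Qed.

Lemma incomplete_E_shift n x : incomplete_E (x + INR n * PI) = incomplete_E x + 2 * INR n * ellE p.
Proof.
  rewrite ellE_eq. apply integral_from_0_shift.
  - apply integrand_E_continuous.
  - intros; apply integrand_shift.
  - intros; apply integrand_reflect.
Qed.

Lemma is_derive_incomplete_F x : is_derive incomplete_F x (integrand_K x).
Proof. apply is_derive_integral_from_0, integrand_K_continuous. Qed.

Lemma is_derive_incomplete_E x : is_derive incomplete_E x (integrand_E x).
Proof. apply is_derive_integral_from_0, integrand_E_continuous. Qed.

Lemma incomplete_F_mvt x y : exists c, Rmin x y <= c <= Rmax x y /\
  incomplete_F y - incomplete_F x = integrand_K c * (y - x).
Proof.
  apply MVT_gen.
  - intros; apply is_derive_incomplete_F.
  - intros. apply continuity_pt_filterlim. apply (ex_derive_continuous (V := R_NormedModule)).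
    eexists; apply is_derive_incomplete_F.
Qed.

Lemma incomplete_F_increasing x y : x < y -> incomplete_F x < incomplete_F y.
Proof.
  intros H. destruct (incomplete_F_mvt x y) as [c [_ E]]. pose proof (integrand_K_ge_1 c). nra.
Qed.

Lemma incomplete_F_0 : incomplete_F 0 = 0.
Proof. exact (RInt_point 0 integrand_K). Qed.

Lemma incomplete_F_injective x y : incomplete_F x = incomplete_F y -> x = y.
Proof.
  intros H. destruct (Rtotal_order x y) as [L|[E|L]]; auto;
  apply incomplete_F_increasing in L; lra.
Qed.

Lemma incomplete_F_surjective y : exists x, incomplete_F x = y.
Proof.
  set (M := Rabs y). assert (HM : 0 <= M) by apply Rabs_pos.
  pose proof (Rle_abs y). pose proof (Rle_abs (- y)). rewrite Rabs_Ropp in H0. fold M in H, H0.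
  destruct (incomplete_F_mvt 0 M) as [c [_ E]]. destruct (incomplete_F_mvt (-M) 0) as [c' [_ E']].
  pose proof (integrand_K_ge_1 c). pose proof (integrand_K_ge_1 c'). rewrite incomplete_F_0 in *.
  assert (M <= incomplete_F M) by nra. assert (incomplete_F (- M) <= - M) by nra.
  destruct (IVT_gen incomplete_F (- M) M y) as [x [_ Hx]].
  - intros x. apply continuity_pt_filterlim. apply (ex_derive_continuous (V := R_NormedModule)).
    eexists; apply is_derive_incomplete_F.
  - rewrite Rmin_left, Rmax_right; lra.
  - exists x; auto.
Qed.

Lemma incomplete_F_am x : incomplete_F (am x p) = x.
Proof.
  apply (iota_correct (V := R_CompleteNormedModule) (fun phi => incomplete_F phi = x)).
  destruct (incomplete_F_surjective x) as [phi H]. exists phi. split; auto.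
  intros y Hy. apply incomplete_F_injective. congruence.
Qed.

Lemma am_incomplete_F x : am (incomplete_F x) p = x.
Proof. apply incomplete_F_injective, incomplete_F_am. Qed.

Lemma am_ellK n : am (ellK p + 2 * INR n * ellK p) p = PI / 2 + INR n * PI.
Proof. rewrite ellK_eq at 1. rewrite <- incomplete_F_shift. apply am_incomplete_F. Qed.

Definition dn (x : R) : R := integrand_E (am x p).
Definition sn (x : R) : R := sin (am x p).

(** The mean value theorem for [incomplete_F], read backwards; it gives both the
    continuity and the derivative of the amplitude. *)
Lemma am_increment x y : exists c, Rmin (am x p) (am y p) <= c <= Rmax (am x p) (am y p) /\
  am y p - am x p = (y - x) * integrand_E c.
Proof.
  destruct (incomplete_F_mvt (am x p) (am y p)) as [c [Hc E]]. exists c. split; auto.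
  rewrite !incomplete_F_am, integrand_K_eq in E. pose proof (integrand_E_pos c).
  rewrite E. field. lra.
Qed.

Lemma am_lipschitz x y : Rabs (am y p - am x p) <= Rabs (y - x).
Proof.
  destruct (am_increment x y) as [c [_ E]]. rewrite E, Rabs_mult.
  pose proof (integrand_E_pos c). pose proof (integrand_E_le_1 c).
  rewrite (Rabs_pos_eq (integrand_E c)) by lra. pose proof (Rabs_pos (y - x)). nra.
Qed.

Lemma is_derive_am x : is_derive (fun u => am u p) x (dn x).
Proof.
  split; [apply is_linear_scal_l|].
  intros x' Hx eps.
  assert (Hxt : x' = x) by (symmetry; exact (is_filter_lim_locally_unique x x' Hx)).
  subst x'.
  destruct (proj1 (filterlim_locally _ _) (integrand_E_continuous (am x p)) eps) as [d Hd].
  exists d. intros y Hy. change (Rabs (y - x) < d) in Hy.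
  change (Rabs (am y p - am x p - (y - x) * dn x) <= eps * Rabs (y - x)).
  destruct (am_increment x y) as [c [Hc E]]. rewrite E.
  replace (_ - _) with ((y - x) * (integrand_E c - dn x)) by ring.
  rewrite Rabs_mult, Rmult_comm. apply Rmult_le_compat_r; [apply Rabs_pos|]. left.
  apply (Hd c). change (Rabs (c - am x p) < d).
  eapply Rle_lt_trans; [|exact Hy]. eapply Rle_trans; [|apply am_lipschitz].
  unfold Rmin, Rmax in Hc. destruct (Rle_dec (am x p) (am y p)).
  - rewrite !Rabs_pos_eq; lra.
  - rewrite !Rabs_left1; lra.
Qed.

Lemma dn_sqr x : dn x ^ 2 = 1 - p ^ 2 * sn x ^ 2.
Proof. unfold dn, integrand_E, sn. apply pow2_sqrt. left. apply delta_sqr_pos. Qed.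

Lemma sn_cn_sqr x : sn x ^ 2 + cn x p ^ 2 = 1.
Proof. unfold sn, cn. pose proof (sin2_cos2 (am x p)). unfold Rsqr in H. lra. Qed.

Lemma dn_pos x : 0 < dn x.
Proof. apply integrand_E_pos. Qed.

Lemma is_derive_sn x : is_derive sn x (cn x p * dn x).
Proof.
  unfold sn. rewrite Rmult_comm.
  apply (is_derive_comp (V := R_NormedModule) sin (fun u => am u p)); [|apply is_derive_am].
  apply is_derive_Reals, derivable_pt_lim_sin.
Qed.

Lemma is_derive_cn x : is_derive (fun u => cn u p) x (- (sn x * dn x)).
Proof.
  unfold cn. replace (- (sn x * dn x)) with (dn x * - sin (am x p)) by (unfold sn; ring).
  apply (is_derive_comp (V := R_NormedModule) cos (fun u => am u p)); [|apply is_derive_am].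
  apply is_derive_Reals, derivable_pt_lim_cos.
Qed.

Lemma is_derive_dn x : is_derive dn x (- (p ^ 2 * sn x * cn x p)).
Proof.
  pose proof (dn_pos x) as Hd. pose proof (dn_sqr x) as E.
  apply (is_derive_ext (fun u => sqrt (1 - p ^ 2 * sn u ^ 2))).
  { intros u. unfold dn, integrand_E, sn. reflexivity. }
  pose proof (is_derive_sn x) as Hs.
  assert (E' : Derive (fun u : R => sn u) x = cn x p * dn x) by (apply is_derive_unique; exact Hs).
  assert (Ed : sqrt (1 - p ^ 2 * sn x ^ 2) = dn x) by reflexivity.
  assert (0 < dn x ^ 2) by (apply pow_lt; auto).
  auto_derive; replace (1 + - (p * (p * 1) * (sn x * (sn x * 1)))) with (1 - p ^ 2 * sn x ^ 2) by ring.
  - split; [eexists; exact Hs|]. split; [lra | auto].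
  - rewrite E', Ed. field. lra.
Qed.

Lemma is_derive_incomplete_E_am x : is_derive (fun u => incomplete_E (am u p)) x (dn x ^ 2).
Proof.
  replace (dn x ^ 2) with (dn x * integrand_E (am x p)) by (unfold dn; ring).
  apply (is_derive_comp (V := R_NormedModule) incomplete_E (fun u => am u p)).
  - apply is_derive_incomplete_E.
  - apply is_derive_am.
Qed.

Lemma ellK_pos : 0 < ellK p.
Proof.
  rewrite ellK_eq, <- incomplete_F_0. apply incomplete_F_increasing. pose proof PI_RGT_0. lra.
Qed.

Lemma cn_ellK : cn (ellK p) p = 0.
Proof.
  unfold cn. rewrite ellK_eq, am_incomplete_F. apply cos_PI2.
Qed.

Lemma sn_ellK : sn (ellK p) = 1.
Proof.
  unfold sn. rewrite ellK_eq, am_incomplete_F. apply sin_PI2.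
Qed.

(** A zero of cn is a point where the amplitude is [PI / 2] plus a multiple of
    [PI]; this is where the oscillation number [n] comes from. *)
Lemma cn_zero x : 0 < x -> cn (x + ellK p) p = 0 -> exists n, x = 2 * (INR n + 1) * ellK p.
Proof.
  intros Hx H. apply cos_eq_0_0 in H. destruct H as [k Hk].
  pose proof PI_RGT_0 as HPI.
  assert (Hgt : PI / 2 < am (x + ellK p) p).
  { destruct (Rlt_le_dec (PI / 2) (am (x + ellK p) p)) as [|Hle]; auto.
    exfalso. assert (incomplete_F (am (x + ellK p) p) <= incomplete_F (PI / 2)).
    { destruct Hle as [Hle| ->]; [left; apply incomplete_F_increasing; auto | lra]. }
    rewrite incomplete_F_am, <- ellK_eq in H. lra. }
  assert (Hk1 : (1 <= k)%Z).
  { rewrite Hk in Hgt. assert (0 < IZR k) by nra. apply lt_IZR in H. lia. }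
  exists (Z.to_nat (k - 1)).
  assert (E : INR (Z.to_nat (k - 1)) + 1 = IZR k).
  { rewrite INR_IZR_INZ, Z2Nat.id by lia. rewrite minus_IZR. ring. }
  assert (E2 : IZR k = INR (Z.to_nat k)) by (rewrite INR_IZR_INZ, Z2Nat.id by lia; reflexivity).
  rewrite E.
  assert (A : x + ellK p = ellK p + 2 * IZR k * ellK p).
  { rewrite <- (incomplete_F_am (x + ellK p)), Hk, Rplus_comm, E2, incomplete_F_shift, <- ellK_eq.
    reflexivity. }
  lra.
Qed.

Lemma cn_shift x : cn (x + 2 * ellK p) p = - cn x p.
Proof.
  assert (E : am (x + 2 * ellK p) p = am x p + PI).
  { apply incomplete_F_injective. rewrite incomplete_F_am.
    pose proof (incomplete_F_shift 1 (am x p)) as H. simpl INR in H. rewrite Rmult_1_l in H.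
    rewrite H, incomplete_F_am. ring. }
  unfold cn. rewrite E, neg_cos. reflexivity.
Qed.

End Jacobi.

(** * The ratio of the complete integrals *)

Lemma ellE_pos p : 0 < p < 1 -> 0 < ellE p.
Proof.
  intros Hp. rewrite ellE_eq by auto. apply RInt_gt_0.
  - pose proof PI_RGT_0. lra.
  - intros; apply integrand_E_pos; auto.
  - intros; apply integrand_E_continuous; auto.
Qed.

Lemma integrand_E_decreasing p q t : 0 < p -> p < q -> q < 1 -> 0 < t < PI / 2 ->
  integrand_E q t < integrand_E p t.
Proof.
  intros Hp Hpq Hq Ht. unfold integrand_E. apply sqrt_lt_1_alt.
  assert (0 < sin t) by (apply sin_gt_0; lra).
  assert (p ^ 2 < q ^ 2) by nra. assert (0 < sin t ^ 2) by nra.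
  split; [left; apply (delta_sqr_pos q); lra | nra].
Qed.

Lemma ellE_over_ellK_decreasing p q : 0 < p -> p < q -> q < 1 ->
  ellE q / ellK q < ellE p / ellK p.
Proof.
  intros Hp Hpq Hq. assert (Hp' : 0 < p < 1) by lra. assert (Hq' : 0 < q < 1) by lra.
  pose proof PI_RGT_0.
  assert (HE : ellE q < ellE p).
  { rewrite !ellE_eq by auto. apply RInt_lt; [lra| | |].
    - intros; apply integrand_E_continuous; auto.
    - intros; apply integrand_E_continuous; auto.
    - intros; apply integrand_E_decreasing; auto. }
  assert (HK : ellK p < ellK q).
  { rewrite !ellK_eq by auto. apply RInt_lt; [lra| | |].
    - intros; apply integrand_K_continuous; auto.
    - intros; apply integrand_K_continuous; auto.
    - intros t Ht. rewrite !integrand_K_eq. apply Rinv_lt_contravar.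
      + apply Rmult_lt_0_compat; apply integrand_E_pos; auto.
      + apply integrand_E_decreasing; auto. }
  pose proof (ellK_pos p Hp'). pose proof (ellE_pos p Hp'). pose proof (ellE_pos q Hq').
  apply Rlt_le_trans with (ellE p / ellK q).
  - apply Rmult_lt_compat_r; auto. apply Rinv_0_lt_compat; lra.
  - apply Rmult_le_compat_l; [lra|]. apply Rinv_le_contravar; lra.
Qed.

(** Pointwise, the integrand of E is [1 - p ^ 2 * sin t ^ 2] times that of K. *)
Lemma ellE_over_ellK_lower p : 0 < p < 1 -> 1 - p ^ 2 <= ellE p / ellK p.
Proof.
  intros Hp. pose proof (ellK_pos p Hp) as HK. pose proof PI_RGT_0.
  apply (Rmult_le_reg_r (ellK p)); auto.
  unfold Rdiv. rewrite Rmult_assoc, Rinv_l, Rmult_1_r by lra.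
  rewrite ellE_eq, ellK_eq by auto. unfold incomplete_F, incomplete_E, integral_from_0.
  assert (HKc := ex_RInt_of_continuous _ (integrand_K_continuous p Hp) 0 (PI / 2)).
  refine (Rle_trans _ _ _ (Req_le _ _ (eq_sym
    (RInt_scal (V := R_CompleteNormedModule) (integrand_K p) 0 (PI / 2) (1 - p ^ 2) HKc))) _).
  apply RInt_le; try lra.
  - apply (ex_RInt_scal (V := R_NormedModule)); auto.
  - apply ex_RInt_of_continuous. apply integrand_E_continuous; auto.
  - intros t _. unfold scal; simpl; unfold mult; simpl. rewrite integrand_K_eq.
    pose proof (integrand_E_pos p Hp t). pose proof (delta_sqr_bounds p Hp t) as [Hb _]. unfold delta_sqr in Hb.
    assert (E : integrand_E p t * integrand_E p t = 1 - p ^ 2 * sin t ^ 2).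
    { apply sqrt_sqrt. left. apply delta_sqr_pos. auto. }
    apply (Rmult_le_reg_r (integrand_E p t)); auto. rewrite E.
    simpl in Hb. rewrite Rmult_assoc, Rinv_l by lra. simpl. lra.
Qed.

(** K diverges logarithmically as the complementary modulus [eps] tends to 0:
    since [cos t <= PI / 2 - t], its integrand is at least
    [1 / (PI / 2 - t + eps)]. *)
Lemma ellK_lower p eps : 0 < p < 1 -> 0 < eps -> eps ^ 2 = 1 - p ^ 2 ->
  - ln eps <= ellK p.
Proof.
  intros Hp He Hep. pose proof PI_RGT_0. pose proof PI2_1.
  set (G := fun t => - ln (PI / 2 - t + eps)).
  set (dG := fun t => / (PI / 2 - t + eps)).
  assert (HG : is_RInt dG 0 (PI / 2) (minus (G (PI / 2)) (G 0))).
  { apply (is_RInt_derive (V := R_CompleteNormedModule) G).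
    - intros t Ht. rewrite Rmin_left, Rmax_right in Ht by lra.
      unfold G, dG. auto_derive; [lra|]. field. lra.
    - intros t Ht. rewrite Rmin_left, Rmax_right in Ht by lra.
      apply (ex_derive_continuous (V := R_NormedModule)). unfold dG. auto_derive. lra. }
  apply Rle_trans with (RInt dG 0 (PI / 2)).
  - rewrite (is_RInt_unique _ _ _ _ HG). unfold minus, plus, opp, G; simpl.
    rewrite Rminus_diag, Rplus_0_l, Rminus_0_r.
    assert (0 < ln (PI / 2 + eps)).
    { rewrite <- ln_1. apply ln_increasing; lra. }
    lra.
  - rewrite ellK_eq by auto. apply RInt_le; try lra.
    + eexists; exact HG.
    + apply ex_RInt_of_continuous. apply integrand_K_continuous; auto.
    + intros t Ht. rewrite integrand_K_eq. unfold dG.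
      apply Rinv_le_contravar; [apply integrand_E_pos; auto|].
      unfold integrand_E. rewrite <- (sqrt_pow2 (PI / 2 - t + eps)) by lra.
      apply sqrt_le_1_alt.
      assert (Hc : 0 <= cos t <= PI / 2 - t).
      { split; [apply cos_ge_0; lra|]. rewrite <- sin_shift. left. apply sin_lt_x. lra. }
      pose proof (sin2_cos2 t) as E. unfold Rsqr in E.
      assert (0 < p ^ 2) by nra. simpl in *. nra.
Qed.

Lemma ellE_over_ellK_small c : 0 < c -> exists p, 0 < p < 1 /\ ellE p / ellK p < c.
Proof.
  (* E is at most PI / 2 <= 2, so M is chosen to make 2 / M smaller than c *)
  intros Hc. set (M := 4 / c). assert (HM : 0 < M) by (apply Rdiv_lt_0_compat; lra).
  set (eps := exp (- M)). assert (He : 0 < eps) by apply exp_pos.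
  assert (He1 : eps < 1) by (rewrite <- exp_0; apply exp_increasing; lra).
  assert (Hq : 0 < 1 - eps ^ 2) by nra.
  exists (sqrt (1 - eps ^ 2)).
  assert (E : sqrt (1 - eps ^ 2) ^ 2 = 1 - eps ^ 2) by (apply pow2_sqrt; lra).
  assert (Hp : 0 < sqrt (1 - eps ^ 2) < 1).
  { pose proof (sqrt_lt_R0 _ Hq). split; auto. nra. }
  split; auto. set (p := sqrt (1 - eps ^ 2)) in *.
  assert (HK : M <= ellK p).
  { replace M with (- ln eps) by (unfold eps; rewrite ln_exp; ring).
    apply ellK_lower; auto. lra. }
  assert (HE : ellE p <= 2).
  { pose proof PI_4. pose proof PI_RGT_0. rewrite ellE_eq by auto.
    apply Rle_trans with (RInt (fun _ => 1) 0 (PI / 2)).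
    - apply RInt_le; try lra.
      + apply ex_RInt_of_continuous. apply integrand_E_continuous; auto.
      + apply ex_RInt_const.
      + intros; apply integrand_E_le_1; auto.
    - rewrite RInt_const. unfold scal; simpl; unfold mult; simpl. lra. }
  apply (Rmult_lt_reg_r (ellK p)); [lra|].
  unfold Rdiv. rewrite Rmult_assoc, Rinv_l, Rmult_1_r by lra.
  assert (c * M = 4) by (unfold M; field; lra). nra.
Qed.

(** Both integrals are even differentiable in the modulus, by differentiation
    under the integral sign around [p]. *)
Lemma ellK_ellE_continuous p : 0 < p < 1 ->
  continuous (fun q => RInt (integrand_K q) 0 (PI / 2)) p /\
  continuous (fun q => RInt (integrand_E q) 0 (PI / 2)) p.
Proof.
  intros Hp. pose proof PI_RGT_0 as HPI.
  assert (ab : 0 < PI / 2) by lra.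
  set (e0 := Rmin p (1 - p)). assert (He0 : 0 < e0) by (apply Rmin_glb_lt; lra).
  assert (Hr : forall e, Rabs e < e0 -> 0 < p + e < 1).
  { intros e He. pose proof (Rmin_l p (1 - p)). pose proof (Rmin_r p (1 - p)). fold e0 in H, H0.
    apply Rabs_def2 in He. lra. }
  set (w := fun e t => 1 - (p + e) ^ 2 * sin t ^ 2).
  set (r := fun e t => / sqrt (w e t)).
  assert (Hw : forall e t, Rabs e < e0 -> 0 < w e t).
  { intros e t He. apply delta_sqr_pos. auto. }
  assert (Hs2 : cont2 0 (PI / 2) e0 (fun _ t => sin t)).
  { apply cont2_snd. apply cont_in_of_continuous; auto. intros t _.
    apply (ex_derive_continuous (V := R_NormedModule)). auto_derive. auto. }
  assert (Hfst := cont2_fst (a := 0) (b := PI / 2) e0).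
  assert (Hneg : forall F, cont2 0 (PI / 2) e0 F -> cont2 0 (PI / 2) e0 (fun e t => - F e t)).
  { intros F HF e t He. apply (continuous_opp (V := R_NormedModule)). exact (HF e t He). }
  assert (Hrc : cont2 0 (PI / 2) e0 r).
  { apply (cont2_rsqrt ab); auto.
    assert (E : w = fun e t => 1 + - ((p + e) * (p + e) * (sin t * sin t))).
    { apply functional_extensionality; intros e. apply functional_extensionality; intros t.
      unfold w. ring. }
    rewrite E. prove_cont2 Hneg. }
  assert (Dr : forall e t, Rabs e < e0 ->
     is_derive (fun e => r e t) e ((p + e) * (sin t * sin t) * (r e t * r e t * r e t))).
  { intros e t He. pose proof (Hw e t He) as Hpos. pose proof (sqrt_lt_R0 _ Hpos).
    unfold r, w in *. auto_derive;
      replace (1 + - ((p + e) * ((p + e) * 1) * (sin t * (sin t * 1))))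
        with (1 - (p + e) ^ 2 * sin t ^ 2) by ring.
    - repeat split; lra.
    - field. lra. }
  assert (HK : is_derive (fun e => RInt (r e) 0 (PI / 2)) 0
     (RInt (fun t => (p + 0) * (sin t * sin t) * (r 0 t * r 0 t * r 0 t)) 0 (PI / 2))).
  { apply (is_derive_RInt_param_in ab e0 r
       (fun e t => (p + e) * (sin t * sin t) * (r e t * r e t * r e t))); auto; try lra.
    - prove_cont2 Hneg.
    - intros e He. apply (cont2_slice e0); auto. }
  assert (HE : is_derive (fun e => RInt (fun t => w e t * r e t) 0 (PI / 2)) 0
     (RInt (fun t => -1 * ((p + 0) * (sin t * sin t) * r 0 t)) 0 (PI / 2))).
  { apply (is_derive_RInt_param_in ab e0 (fun e t => w e t * r e t)
       (fun e t => -1 * ((p + e) * (sin t * sin t) * r e t))); auto; try lra.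
    - intros e t He _. pose proof (Dr e t He) as D. pose proof (Hw e t He) as Hpos.
      pose proof (sqrt_lt_R0 _ Hpos) as Hsq.
      assert (ED : Derive (fun u : R => r u t) e = (p + e) * (sin t * sin t) * (r e t * r e t * r e t))
        by (apply is_derive_unique; exact D).
      unfold w at 1. auto_derive; [eexists; exact D|]. rewrite ED.
      assert (Er : r e t * r e t * (1 - (p + e) ^ 2 * sin t ^ 2) = 1).
      { change (r e t * r e t * w e t = 1). unfold r.
        rewrite <- (sqrt_sqrt (w e t)) at 3 by lra. field. lra. }
      transitivity ((p + e) * (sin t * sin t) * r e t *
        (-2 + r e t * r e t * (1 - (p + e) ^ 2 * sin t ^ 2))); [ring | rewrite Er; ring].
    - prove_cont2 Hneg.
    - intros e He. apply (cont2_slice e0 (fun e t => w e t * r e t)); auto.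
      apply cont2_mult; auto.
      assert (E : w = fun e t => 1 + - ((p + e) * (p + e) * (sin t * sin t))).
      { apply functional_extensionality; intros e'. apply functional_extensionality; intros t.
        unfold w. ring. }
      rewrite E. prove_cont2 Hneg. }
  assert (Hshift : forall F : R -> R, continuous (fun e => F (p + e)) 0 -> continuous F p).
  { intros F HF. apply (continuous_ext (fun q => F (p + (q - p)))).
    - intros q. f_equal. ring.
    - apply (continuous_comp (fun q => q - p) (fun e => F (p + e))).
      + apply (ex_derive_continuous (V := R_NormedModule)). auto_derive. auto.
      + rewrite Rminus_diag. exact HF. }
  assert (Hloc : forall P : R -> Prop, (forall e, Rabs e < e0 -> P e) -> locally 0 P).
  { intros P HP. exists (mkposreal e0 He0). intros e He. apply HP.
    change (Rabs (e - 0) < e0) in He. rewrite Rminus_0_r in He. exact He. }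
  split; apply Hshift.
  - apply (continuous_ext_loc _ (fun e => RInt (r e) 0 (PI / 2))).
    + apply Hloc. intros e He. apply RInt_ext. intros t _. unfold r, integrand_K, w.
      real_eq. unfold Rdiv. ring.
    + apply (ex_derive_continuous (V := R_NormedModule)). eexists; exact HK.
  - apply (continuous_ext_loc _ (fun e => RInt (fun t => w e t * r e t) 0 (PI / 2))).
    + apply Hloc. intros e He. apply RInt_ext. intros t _.
      pose proof (Hw e t He) as Hpos. pose proof (sqrt_lt_R0 _ Hpos) as Hsq.
      unfold r. rewrite <- (sqrt_sqrt (w e t)) at 1 by lra. unfold integrand_E. fold (w e t).
      real_eq. field. lra.
    + apply (ex_derive_continuous (V := R_NormedModule)). eexists; exact HE.
Qed.

Lemma modulus_exists c : 0 < c < 1 -> exists p, 0 < p < 1 /\ ellE p / ellK p = c.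
Proof.
  intros Hc.
  destruct (ellE_over_ellK_small c) as [p2 [Hp2 H2]]; [lra|].
  set (p1 := sqrt ((1 - c) / 2)).
  assert (E1 : p1 ^ 2 = (1 - c) / 2) by (apply pow2_sqrt; lra).
  assert (Hp1 : 0 < p1 < 1).
  { assert (0 < p1) by (apply sqrt_lt_R0; lra). split; auto. nra. }
  pose proof (ellE_over_ellK_lower p1 Hp1) as H1.
  assert (H12 : p1 < p2).
  { destruct (Rtotal_order p1 p2) as [|[E|L]]; auto; exfalso.
    - rewrite E in *. lra.
    - pose proof (ellE_over_ellK_decreasing p2 p1). lra. }
  set (ratio := fun q => RInt (integrand_E q) 0 (PI / 2) / RInt (integrand_K q) 0 (PI / 2)).
  assert (Er : forall q, 0 < q < 1 -> ratio q = ellE q / ellK q).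
  { intros q Hq. unfold ratio. rewrite ellE_eq, ellK_eq by auto. reflexivity. }
  assert (Hcl : forall q, p1 <= clamp p1 p2 q <= p2) by (intros; apply clamp_bounds; lra).
  destruct (IVT_gen (fun q => ratio (clamp p1 p2 q)) p1 p2 c) as [q [_ Hq]].
  - intros q. apply continuity_pt_filterlim.
    apply (continuous_comp (clamp p1 p2) ratio); [apply continuous_clamp|].
    assert (Hq : 0 < clamp p1 p2 q < 1) by (specialize (Hcl q); lra).
    destruct (ellK_ellE_continuous _ Hq) as [CK CE].
    apply (continuous_mult (K := R_AbsRing) (fun q => RInt (integrand_E q) 0 (PI / 2))
      (fun q => / RInt (integrand_K q) 0 (PI / 2))); auto.
    apply (continuous_comp (fun q => RInt (integrand_K q) 0 (PI / 2)) Rinv); auto.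
    apply (ex_derive_continuous (V := R_NormedModule)). auto_derive.
    pose proof (ellK_pos _ Hq) as HK. rewrite ellK_eq in HK by auto. unfold incomplete_F, integral_from_0 in HK.
    apply Rgt_not_eq. exact HK.
  - rewrite !clamp_id by lra. rewrite !Er by auto. rewrite Rmin_right, Rmax_left; lra.
  - exists (clamp p1 p2 q). assert (Hq' : 0 < clamp p1 p2 q < 1) by (specialize (Hcl q); lra).
    split; auto. rewrite <- Er; auto.
Qed.

Lemma modulus_unique c p q : 0 < p < 1 -> 0 < q < 1 ->
  ellE p / ellK p = c -> ellE q / ellK q = c -> p = q.
Proof.
  intros Hp Hq Ep Eq. destruct (Rtotal_order p q) as [L|[E|L]]; auto; exfalso.
  - pose proof (ellE_over_ellK_decreasing p q). lra.
  - pose proof (ellE_over_ellK_decreasing q p). lra.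
Qed.

(** * The arc length parametrization *)

Definition arclength (g : R -> R * R) (t : R) : R := RInt (speed 0 1 g) 0 t.

Section Arclength.
Context (l L : R) (g : R -> R * R).
Context (Hadm : admissible l L g).

Let u01 := Rlt_0_1.

Lemma is_derive_in_arclength t : 0 <= t <= 1 -> is_derive_in 0 1 (arclength g) t (speed 0 1 g t).
Proof.
  destruct Hadm as [Hs [_ [_ [Hr _]]]].
  intros Ht. apply is_derive_in_RInt; auto; [|lra].
  apply (smooth_in_cont u01), (smooth_in_speed u01); auto.
Qed.

Lemma arclength_0 : arclength g 0 = 0.
Proof. exact (RInt_point 0 _). Qed.

Lemma arclength_1 : arclength g 1 = L.
Proof. apply Hadm. Qed.

Lemma arclength_increasing t u : 0 <= t -> t < u -> u <= 1 -> arclength g t < arclength g u.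
Proof.
  destruct Hadm as [Hs [_ [_ [Hr _]]]].
  apply (increasing_in u01 (arclength g) (speed 0 1 g)).
  - apply is_derive_in_arclength.
  - intros; apply speed_pos; auto.
Qed.

Lemma arclength_range t : 0 <= t <= 1 -> 0 <= arclength g t <= L.
Proof.
  intros Ht. split.
  - rewrite <- arclength_0. destruct (Req_dec t 0) as [->|]; [lra|].
    left; apply arclength_increasing; lra.
  - rewrite <- arclength_1. destruct (Req_dec t 1) as [->|]; [lra|].
    left; apply arclength_increasing; lra.
Qed.

Lemma arclength_surjective s : 0 <= s <= L -> exists t, 0 <= t <= 1 /\ arclength g t = s.
Proof.
  intros Hs.
  destruct (IVT_gen (fun t => arclength g (clamp 0 1 t)) 0 1 s) as [t [Ht E]].
  - intros t. apply continuity_pt_filterlim.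
    apply (cont_in_of_ex_derive_in u01 (arclength g)).
    intros u Hu. eexists. apply is_derive_in_arclength; auto.
  - rewrite !clamp_id by lra. rewrite arclength_0, arclength_1, Rmin_left, Rmax_right; lra.
  - rewrite Rmin_left, Rmax_right in Ht by lra. exists t. rewrite clamp_id in E; auto.
Qed.

Lemma arclength_reparam_arclength t : 0 <= t <= 1 -> arclength_reparam g (arclength g t) = g t.
Proof.
  intros Ht. unfold arclength_reparam.
  set (P := fun u => 0 <= u <= 1 /\ arclength g u = arclength g t).
  assert (HP : forall u, P u -> t = u).
  { intros u [Hu E]. destruct (Rtotal_order t u) as [H|[H|H]]; auto; exfalso.
    - pose proof (arclength_increasing t u). lra.
    - pose proof (arclength_increasing u t). lra. }
  f_equal. symmetry. apply HP.
  apply (iota_correct (V := R_CompleteNormedModule) P).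
  exists t. split; [split; auto | exact HP].
Qed.

(** Statements about the arc length reparametrization are pulled back to the
    original parameter, where they can be differentiated directly. *)
Lemma equal_on_arclength_iff (h : R -> R * R) : equal_on 0 L (arclength_reparam g) h <->
  forall t, 0 <= t <= 1 -> g t = h (arclength g t).
Proof.
  split.
  - intros H t Ht. rewrite <- H by (apply arclength_range; auto).
    symmetry. apply arclength_reparam_arclength; auto.
  - intros H s Hs. destruct (arclength_surjective s Hs) as [t [Ht <-]].
    rewrite arclength_reparam_arclength by auto. auto.
Qed.

End Arclength.

(** * The wave-like solutions *)

Definition wave_X (p omega s : R) : R :=
  2 * p ^ 2 * RInt (fun t => cn (omega * t + ellK p) p ^ 2) 0 s + (1 - 2 * p ^ 2) * s.

Definition wave_Y (p omega s : R) : R := - (2 * p / omega) * cn (omega * s + ellK p) p.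

(** The unit tangent of [(wave_X, wave_Y)].  The horizontal component is written
    in terms of the height, as in the second elastica equation. *)
Definition wave_Tx (p omega s : R) : R := omega ^ 2 / 2 * wave_Y p omega s ^ 2 + (1 - 2 * p ^ 2).
Definition wave_Ty (p omega s : R) : R := 2 * p * (sn p (omega * s + ellK p) * dn p (omega * s + ellK p)).

Section Wave.
Context (p omega : R).
Context (Hp : 0 < p < 1).
Context (Homega : 0 < omega).

Let X := wave_X p omega.
Let Y := wave_Y p omega.
Let Tx := wave_Tx p omega.
Let Ty := wave_Ty p omega.
Let u (s : R) := omega * s + ellK p.

Lemma wave_Tx_cn s : Tx s = 2 * p ^ 2 * cn (u s) p ^ 2 + (1 - 2 * p ^ 2).
Proof. unfold Tx, wave_Tx, wave_Y. fold (u s). field. lra. Qed.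

Lemma wave_Tx_dn s : Tx s = 2 * dn p (u s) ^ 2 - 1.
Proof.
  rewrite wave_Tx_cn, (dn_sqr p Hp). pose proof (sn_cn_sqr p (u s)) as E.
  replace (sn p (u s) ^ 2) with (1 - cn (u s) p ^ 2) by lra. ring.
Qed.

Lemma is_derive_u s : is_derive u s omega.
Proof. unfold u. auto_derive; auto; ring. Qed.

Lemma is_derive_cn_u s : is_derive (fun t => cn (u t) p) s (- omega * (sn p (u s) * dn p (u s))).
Proof.
  replace (- omega * _) with (omega * - (sn p (u s) * dn p (u s))) by ring.
  apply (is_derive_comp (V := R_NormedModule) (fun x => cn x p) u);
    [apply is_derive_cn; auto | apply is_derive_u].
Qed.

Lemma is_derive_wave_X s : is_derive X s (Tx s).
Proof.
  rewrite wave_Tx_cn. unfold X, wave_X.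
  apply (is_derive_plus (V := R_NormedModule)).
  - apply (is_derive_scal (fun s => RInt (fun t => cn (u t) p ^ 2) 0 s)).
    apply (is_derive_integral_from_0 (fun t => cn (u t) p ^ 2)). intros t.
    apply (continuous_comp (fun t => cn (u t) p) (fun y => y ^ 2)).
    + apply (ex_derive_continuous (V := R_NormedModule)). eexists; apply is_derive_cn_u.
    + apply (ex_derive_continuous (V := R_NormedModule)). auto_derive. auto.
  - auto_derive; auto; ring.
Qed.

Lemma is_derive_wave_Y s : is_derive Y s (Ty s).
Proof.
  replace (Ty s) with (- (2 * p / omega) * (- omega * (sn p (u s) * dn p (u s)))).
  - apply (is_derive_scal (fun s => cn (u s) p)).
    apply is_derive_cn_u.
  - unfold Ty, wave_Ty. fold (u s). field. lra.
Qed.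

Lemma is_derive_wave_Tx s : is_derive Tx s (omega ^ 2 * Y s * Ty s).
Proof.
  pose proof (is_derive_wave_Y s) as D.
  assert (E : Derive (fun x : R => wave_Y p omega x) s = Ty s) by (apply is_derive_unique; exact D).
  unfold Tx, wave_Tx, Y. auto_derive; [eexists; exact D|]. rewrite E. field.
Qed.

Lemma is_derive_wave_Ty s : is_derive Ty s (- omega ^ 2 * Y s * Tx s).
Proof.
  replace (- omega ^ 2 * Y s * Tx s) with (2 * p * (omega * (cn (u s) p * dn p (u s)) * dn p (u s) +
     sn p (u s) * (omega * - (p ^ 2 * sn p (u s) * cn (u s) p)))).
  - apply (is_derive_scal (fun s => sn p (u s) * dn p (u s))).
    apply (is_derive_mult (K := R_AbsRing) (fun s => sn p (u s)) (fun s => dn p (u s))).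
    + apply (is_derive_comp (V := R_NormedModule) (sn p) u); [apply is_derive_sn; auto | apply is_derive_u].
    + apply (is_derive_comp (V := R_NormedModule) (dn p) u); [apply is_derive_dn; auto | apply is_derive_u].
    + intros; apply Rmult_comm.
  - rewrite wave_Tx_dn. unfold Y, wave_Y. fold (u s).
    transitivity (2 * p * omega * cn (u s) p * (dn p (u s) ^ 2 - p ^ 2 * sn p (u s) ^ 2)); [ring|].
    replace (p ^ 2 * sn p (u s) ^ 2) with (1 - dn p (u s) ^ 2) by (rewrite (dn_sqr p Hp); ring).
    field. lra.
Qed.

Lemma wave_at_0 : X 0 = 0 /\ Y 0 = 0 /\ 0 < Ty 0 /\ Ty 0 ^ 2 = 4 * p ^ 2 * (1 - p ^ 2).
Proof.
  assert (E : u 0 = ellK p) by (unfold u; ring).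
  pose proof (dn_sqr p Hp (ellK p)) as E1. rewrite (sn_ellK p Hp) in E1.
  split; [|split; [|split]].
  - unfold X, wave_X. replace (RInt _ 0 0) with 0 by (symmetry; exact (RInt_point 0 _)). ring.
  - unfold Y, wave_Y. fold (u 0). rewrite E, cn_ellK by auto. ring.
  - unfold Ty, wave_Ty. fold (u 0). rewrite E, sn_ellK by auto.
    pose proof (dn_pos p Hp (ellK p)). nra.
  - unfold Ty, wave_Ty. fold (u 0). rewrite E, sn_ellK by auto.
    replace ((2 * p * (1 * dn p (ellK p))) ^ 2) with (4 * p ^ 2 * dn p (ellK p) ^ 2) by ring.
    rewrite E1. ring.
Qed.

(** Both sides vanish at 0 and have derivative [2 dn ^ 2 - 1]. *)
Lemma wave_X_incomplete_E s :
  X s = 2 / omega * (incomplete_E p (am (u s) p) - ellE p) - s.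
Proof.
  set (D := fun t => X t - (2 / omega * (incomplete_E p (am (u t) p) - ellE p) - t)).
  assert (H : D s = D 0).
  { apply constant_of_derive_zero. intros t. unfold D.
    assert (D1 : is_derive (fun t => incomplete_E p (am (u t) p)) t (omega * dn p (u t) ^ 2)).
    { apply (is_derive_comp (V := R_NormedModule) (fun x => incomplete_E p (am x p)) u).
      - apply is_derive_incomplete_E_am; auto.
      - apply is_derive_u. }
    pose proof (is_derive_wave_X t) as D2.
    assert (Aux : forall (F G : R -> R) c e dF dG, is_derive F t dF -> is_derive G t dG ->
              is_derive (fun t => F t - (c * (G t - e) - t)) t (dF - (c * dG - 1))).
    { intros F G c e dF dG HF HG.
      assert (EF : Derive (fun x : R => F x) t = dF) by (apply is_derive_unique; exact HF).
      assert (EG : Derive (fun x : R => G x) t = dG) by (apply is_derive_unique; exact HG).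
      auto_derive; [repeat split; eexists; eassumption | rewrite EF, EG; ring]. }
    replace 0 with (Tx t - (2 / omega * (omega * dn p (u t) ^ 2) - 1)).
    - apply Aux; auto.
    - rewrite wave_Tx_dn. field. lra. }
  assert (E : u 0 = ellK p) by (unfold u; ring).
  assert (H0 : D 0 = 0).
  { unfold D. destruct wave_at_0 as [-> _]. rewrite E.
    pose proof (am_ellK p Hp 0) as A. simpl INR in A.
    replace (ellK p + 2 * 0 * ellK p) with (ellK p) in A by ring. rewrite A.
    replace (PI / 2 + 0 * PI) with (PI / 2) by ring. rewrite <- ellE_eq by auto. ring. }
  unfold D in H at 1. lra.
Qed.

End Wave.

Definition wave_number (L p : R) (n : nat) : R := 2 * (INR n + 1) * ellK p / L.

Section Matching.
Context (L p : R) (n : nat).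
Context (HL : 0 < L).
Context (Hp : 0 < p < 1).

Lemma wave_number_pos : 0 < wave_number L p n.
Proof.
  pose proof (ellK_pos p Hp). pose proof (pos_INR n). unfold wave_number.
  apply Rdiv_lt_0_compat; auto. apply Rmult_lt_0_compat; lra.
Qed.

Lemma wave_X_end : wave_X p (wave_number L p n) L = L * (2 * (ellE p / ellK p) - 1).
Proof.
  pose proof (ellK_pos p Hp). pose proof (pos_INR n).
  rewrite wave_X_incomplete_E by (auto; apply wave_number_pos).
  replace (wave_number L p n * L + ellK p) with (ellK p + 2 * INR (S n) * ellK p)
    by (unfold wave_number; rewrite S_INR; field; lra).
  rewrite am_ellK, incomplete_E_shift, <- ellE_eq by auto. unfold wave_number. rewrite S_INR.
  field. lra.
Qed.

Lemma X_hat_eq s : X_hat L p n s = wave_X p (wave_number L p n) s.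
Proof. reflexivity. Qed.

Lemma Y_hat_eq s : Y_hat L p n s = wave_Y p (wave_number L p n) s.
Proof.
  pose proof (ellK_pos p Hp). pose proof (pos_INR n).
  unfold Y_hat, wave_Y, wave_number. f_equal. field. lra.
Qed.

Lemma cn_minus_ellK x : cn (x - ellK p) p = - cn (x + ellK p) p.
Proof. replace (x + ellK p) with (x - ellK p + 2 * ellK p) by ring. rewrite cn_shift by auto. ring. Qed.

Lemma X_check_eq s : X_check L p n s = - wave_X p (wave_number L p n) s.
Proof.
  unfold X_check, wave_X.
  rewrite (RInt_ext (fun t => cn (2 * (INR n + 1) * ellK p / L * t - ellK p) p ^ 2)
     (fun t => cn (wave_number L p n * t + ellK p) p ^ 2)).
  - ring.
  - intros t _. rewrite cn_minus_ellK. unfold wave_number. real_eq. ring.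
Qed.

Lemma Y_check_eq s : Y_check L p n s = wave_Y p (wave_number L p n) s.
Proof.
  pose proof (ellK_pos p Hp). pose proof (pos_INR n).
  unfold Y_check, wave_Y. rewrite cn_minus_ellK. unfold wave_number. field. lra.
Qed.

End Matching.

(** * From waves to the elastica equations *)

(** For a wave, [T_x' = omega ^ 2 Y T_y] and [T_y' = - omega ^ 2 Y T_x], so the
    curvature is [- omega ^ 2 Y]; each reflection changes its sign. *)
Lemma wave_elastica l L g p omega sx sy : admissible l L g -> 0 < p < 1 -> 0 < omega ->
  sx ^ 2 = 1 -> sy ^ 2 = 1 ->
  (forall t, 0 <= t <= 1 -> g t = (sx * wave_X p omega (arclength g t),
                                   sy * wave_Y p omega (arclength g t))) ->
  elastica_equations 0 1 g (2 * sx * omega ^ 2) (- 2 * omega ^ 2 * (1 - 2 * p ^ 2)).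
Proof.
  intros Hadm Hp Ho Hsx Hsy Hg.
  assert (Hs : smooth_curve 0 1 g) by apply Hadm.
  assert (Hr : regular_curve 0 1 g) by apply Hadm.
  assert (u01 := Rlt_0_1).
  set (arc := arclength g) in *. set (v := speed 0 1 g).
  assert (Hv : forall t, 0 <= t <= 1 -> 0 < v t) by (intros; apply speed_pos; auto).
  assert (Hcomp : forall c F dF t, 0 <= t <= 1 -> (forall s, is_derive F s (dF s)) ->
            is_derive_in 0 1 (fun t => c * F (arc t)) t (v t * (c * dF (arc t)))).
  { intros c F dF t Ht HF.
    replace (v t * (c * dF (arc t))) with (0 * F (arc t) + c * (v t * dF (arc t))) by ring.
    apply (is_derive_in_mult (fun _ => c) (fun t => F (arc t))); auto; [apply is_derive_in_const; auto|].
    apply (is_derive_in_outer arc t (v t) F); auto. apply (is_derive_in_arclength l L); auto. }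
  assert (Htx : forall t, 0 <= t <= 1 -> tangent_x 0 1 g t = sx * wave_Tx p omega (arc t)).
  { intros t Ht. apply (Rmult_eq_reg_l (v t)); [|specialize (Hv t Ht); lra].
    apply (is_derive_in_unique u01 t (xcoord g)); auto; [apply (is_derive_in_xcoord u01); auto|].
    apply (is_derive_in_ext t (fun t => sx * wave_X p omega (arc t))); auto.
    - intros w Hw. unfold xcoord. rewrite Hg; auto.
    - apply Hcomp; auto. apply is_derive_wave_X; auto. }
  assert (Hty : forall t, 0 <= t <= 1 -> tangent_y 0 1 g t = sy * wave_Ty p omega (arc t)).
  { intros t Ht. apply (Rmult_eq_reg_l (v t)); [|specialize (Hv t Ht); lra].
    apply (is_derive_in_unique u01 t (ycoord g)); auto; [apply (is_derive_in_ycoord u01); auto|].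
    apply (is_derive_in_ext t (fun t => sy * wave_Y p omega (arc t))); auto.
    - intros w Hw. unfold ycoord. rewrite Hg; auto.
    - apply Hcomp; auto. apply is_derive_wave_Y; auto. }
  assert (Hk : forall t, 0 <= t <= 1 ->
    curvature 0 1 g t = - (sx * sy * omega ^ 2 * wave_Y p omega (arc t))).
  { intros t Ht. apply (curvature_unique 0 1 u01); auto.
    - apply (is_derive_in_ext t (fun t => sx * wave_Tx p omega (arc t))); auto.
      { intros; symmetry; auto. }
      rewrite Hty by auto. fold v.
      replace (- _) with (v t * (sx * (omega ^ 2 * wave_Y p omega (arc t) * wave_Ty p omega (arc t)))).
      2:{ transitivity
            (sy ^ 2 * (v t * (sx * (omega ^ 2 * wave_Y p omega (arc t) * wave_Ty p omega (arc t)))));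
          [rewrite Hsy|]; ring. }
      apply (Hcomp sx (wave_Tx p omega) (fun s => omega ^ 2 * wave_Y p omega s * wave_Ty p omega s)); auto.
      apply is_derive_wave_Tx; auto.
    - apply (is_derive_in_ext t (fun t => sy * wave_Ty p omega (arc t))); auto.
      { intros; symmetry; auto. }
      rewrite Htx by auto. fold v.
      replace (_ * (sx * _))
        with (v t * (sy * (- omega ^ 2 * wave_Y p omega (arc t) * wave_Tx p omega (arc t)))).
      2:{ transitivity
            (sx ^ 2 * (v t * (sy * (- omega ^ 2 * wave_Y p omega (arc t) * wave_Tx p omega (arc t)))));
          [rewrite Hsx|]; ring. }
      apply (Hcomp sy (wave_Ty p omega) (fun s => - omega ^ 2 * wave_Y p omega s * wave_Tx p omega s)); auto.
      apply is_derive_wave_Ty; auto. }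
  intros t Ht. rewrite Hk, Htx by auto. split.
  - unfold ycoord. rewrite Hg by auto. simpl. field.
  - unfold wave_Tx. set (y := wave_Y p omega (arc t)).
    transitivity (sx ^ 2 * sy ^ 2 * omega ^ 4 * y ^ 2 + 2 * omega ^ 2 * (1 - 2 * p ^ 2)); [ring|].
    transitivity (sx ^ 2 * (omega ^ 4 * y ^ 2 + 2 * omega ^ 2 * (1 - 2 * p ^ 2))); [|field].
    rewrite Hsx, Hsy. ring.
Qed.

(** * From the elastica equations to waves *)

(** [E t * exp (- M * t)] is nonincreasing, nonnegative, and 0 at [a]. *)
Lemma gronwall_zero a b (ab : a < b) E dE M :
  (forall t, a <= t <= b -> is_derive_in a b E t (dE t)) ->
  (forall t, a <= t <= b -> 0 <= E t /\ dE t <= M * E t) -> E a = 0 ->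
  forall t, a <= t <= b -> E t = 0.
Proof.
  intros HE Hb Ha t Ht.
  set (F := fun t => E t * exp (- M * t)).
  assert (HF : forall t, a <= t <= b ->
    is_derive_in a b F t (dE t * exp (- M * t) + E t * (- M * exp (- M * t)))).
  { intros u Hu. apply (is_derive_in_mult E (fun t => exp (- M * t))); auto.
    apply is_derive_in_of_is_derive; auto. auto_derive; auto; ring. }
  destruct (mvt_in ab F _ a t HF) as [c [Hc Hm]]; try lra.
  assert (F a = 0) by (unfold F; rewrite Ha; ring).
  destruct (Hb t Ht) as [H0 _]. destruct (Hb c) as [_ Hd]; [lra|].
  pose proof (exp_pos (- M * c)). pose proof (exp_pos (- M * t)).
  assert (dE c * exp (- M * c) + E c * (- M * exp (- M * c)) <= 0).
  { replace (_ + _) with (- ((M * E c - dE c) * exp (- M * c))) by ring.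
    assert (0 <= (M * E c - dE c) * exp (- M * c)) by (apply Rmult_le_pos; lra). lra. }
  assert (F t <= 0) by nra. unfold F in H4.
  destruct (Rle_lt_or_eq_dec _ _ H0) as [Hlt|]; auto.
  assert (0 < E t * exp (- M * t)) by (apply Rmult_lt_0_compat; auto). lra.
Qed.

(** The squared distance of two solutions in the phase plane satisfies a linear
    differential inequality, because [beta (y ^ 3 - y' ^ 3)] is [y - y'] times a
    bounded function. *)
Lemma duffing_unique v alpha beta y z y' z' :
  cont_in 0 1 v ->
  (forall t, 0 <= t <= 1 -> is_derive_in 0 1 y t (v t * z t)) ->
  (forall t, 0 <= t <= 1 -> is_derive_in 0 1 z t (v t * (alpha * y t + beta * y t ^ 3))) ->
  (forall t, 0 <= t <= 1 -> is_derive_in 0 1 y' t (v t * z' t)) ->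
  (forall t, 0 <= t <= 1 -> is_derive_in 0 1 z' t (v t * (alpha * y' t + beta * y' t ^ 3))) ->
  y 0 = y' 0 -> z 0 = z' 0 ->
  forall t, 0 <= t <= 1 -> y t = y' t /\ z t = z' t.
Proof.
  intros Hv Hy Hz Hy' Hz' E0 F0. assert (u01 := Rlt_0_1).
  assert (Cy : cont_in 0 1 y) by (apply (cont_in_of_ex_derive_in u01); intros; eexists; eauto).
  assert (Cy' : cont_in 0 1 y') by (apply (cont_in_of_ex_derive_in u01); intros; eexists; eauto).
  set (h := fun t => v t * (1 + alpha + beta * (y t * y t + y t * y' t + y' t * y' t))).
  assert (Ch : cont_in 0 1 h).
  { unfold h. apply cont_in_mult; auto.
    apply (cont_in_plus (fun _ => 1 + alpha)); [apply cont_in_const|].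
    apply (cont_in_mult (fun _ => beta)); [apply cont_in_const|].
    apply cont_in_plus; [apply cont_in_plus|]; apply cont_in_mult; auto. }
  destruct (cont_in_bounded 0 1 h u01 Ch) as [M [HM0 HM]].
  set (E := fun t => (y t + -1 * y' t) * (y t + -1 * y' t) + (z t + -1 * z' t) * (z t + -1 * z' t)).
  set (dE := fun t => 2 * ((y t - y' t) * (z t - z' t)) * h t).
  assert (HE : forall t, 0 <= t <= 1 -> E t = 0).
  { apply (gronwall_zero 0 1 u01 E dE M).
    - intros t Ht.
      assert (Dd : forall f f' df df', is_derive_in 0 1 f t df -> is_derive_in 0 1 f' t df' ->
         is_derive_in 0 1 (fun t => f t + -1 * f' t) t (df - df')).
      { intros f f' df df' D D'. replace (df - df') with (df + (0 * f' t + -1 * df')) by ring.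
        apply (is_derive_in_plus f (fun t => -1 * f' t)); auto.
        apply (is_derive_in_mult (fun _ => -1)); auto. apply is_derive_in_const; auto. }
      pose proof (Dd _ _ _ _ (Hy t Ht) (Hy' t Ht)) as D1.
      pose proof (Dd _ _ _ _ (Hz t Ht) (Hz' t Ht)) as D2.
      pose proof (is_derive_in_plus _ _ _ _ _ Ht (is_derive_in_mult _ _ _ _ _ Ht D1 D1)
                   (is_derive_in_mult _ _ _ _ _ Ht D2 D2)) as D3.
      match type of D3 with is_derive_in _ _ _ _ ?d => replace (dE t) with d; [exact D3|] end.
      unfold dE, h. ring.
    - intros t Ht. specialize (HM t Ht). unfold E, dE.
      set (a := y t - y' t). set (b := z t - z' t).
      replace (y t + -1 * y' t) with a by (unfold a; ring).
      replace (z t + -1 * z' t) with b by (unfold b; ring).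
      split; [nra|]. apply Rabs_le_between in HM.
      assert (0 <= (a - b) * (a - b) /\ 0 <= (a + b) * (a + b)) by (split; apply Rle_0_sqr).
      destruct H as [H1 H2].
      assert (0 <= (M - h t) * ((a + b) * (a + b))) by (apply Rmult_le_pos; lra).
      assert (0 <= (M + h t) * ((a - b) * (a - b))) by (apply Rmult_le_pos; lra).
      lra.
    - unfold E. rewrite E0, F0. ring. }
  intros t Ht. specialize (HE t Ht). unfold E in HE.
  apply (Rplus_sqr_eq_0 (y t + -1 * y' t)) in HE.
  lra.
Qed.

Section Solve.
Context (l L : R) (g : R -> R * R) (C lam : R).
Context (Hl : 0 < l).
Context (HL : l < L).
Context (Hadm : admissible l L g).
Context (Hel : elastica_equations 0 1 g C lam).

Let u01 := Rlt_0_1.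
Let v := speed 0 1 g.
Let k := curvature 0 1 g.
Let tx := tangent_x 0 1 g.
Let ty := tangent_y 0 1 g.
Let x := xcoord g.
Let y := ycoord g.
Let arc := arclength g.

Let Hs : smooth_curve 0 1 g. Proof. apply Hadm. Qed.
Let Hr : regular_curve 0 1 g. Proof. apply Hadm. Qed.
Let Dx t (Ht : 0 <= t <= 1) : is_derive_in 0 1 x t (v t * tx t) := is_derive_in_xcoord u01 g Hs Hr t Ht.
Let Dy t (Ht : 0 <= t <= 1) : is_derive_in 0 1 y t (v t * ty t) := is_derive_in_ycoord u01 g Hs Hr t Ht.
Let Darc t (Ht : 0 <= t <= 1) : is_derive_in 0 1 arc t (v t) := is_derive_in_arclength l L g Hadm t Ht.

Let ends : x 0 = 0 /\ y 0 = 0 /\ x 1 = l /\ y 1 = 0.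
Proof.
  destruct (proj2 Hadm) as [H0 [H1 _]]. unfold x, y, xcoord, ycoord. rewrite H0, H1. auto.
Qed.

Lemma displacement_of_constant_tangent f d c :
  (forall t, 0 <= t <= 1 -> is_derive_in 0 1 f t (v t * d t)) ->
  (forall t, 0 <= t <= 1 -> d t = c) -> f 1 - f 0 = c * L.
Proof.
  intros Df Hd.
  assert (H : f 1 + - c * arc 1 = f 0 + - c * arc 0).
  { apply (constant_in u01 (fun t => f t + - c * arc t)); [|lra].
    intros t Ht. assert (A : v t * d t + (0 * arc t + - c * v t) = 0) by (rewrite Hd by auto; ring).
    refine (eq_ind _ (is_derive_in 0 1 _ t) _ _ A).
    apply (is_derive_in_plus f (fun t => - c * arc t)); auto.
    apply (is_derive_in_mult (fun _ => - c)); auto. apply is_derive_in_const; auto. }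
  assert (arc 1 = L) by (apply (arclength_1 l L g Hadm)).
  assert (arc 0 = 0) by apply arclength_0. rewrite H0, H1 in H. lra.
Qed.

(** A segment would join the end points only if [l = L]. *)
Lemma not_straight c : c ^ 2 = 1 -> ~ (forall t, 0 <= t <= 1 -> tx t = c).
Proof.
  intros Hc H. pose proof (displacement_of_constant_tangent x tx c Dx H) as E.
  destruct ends as [E0 [_ [E1 _]]]. rewrite E0, E1 in E.
  assert ((c - 1) * (c + 1) = 0) by lra. apply Rmult_integral in H0. destruct H0; nra.
Qed.

Lemma multiplier_nonzero : C <> 0.
Proof.
  intros HC.
  assert (Hk : forall t, 0 <= t <= 1 -> k t = 0).
  { intros t Ht. destruct (Hel t Ht) as [E _]. unfold k. rewrite E, HC. field. }
  assert (Htx : forall t, 0 <= t <= 1 -> tx t = tx 0).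
  { apply (constant_in u01). intros t Ht.
    pose proof (is_derive_in_tangent_x u01 g Hs Hr t Ht) as D. fold k tx in D.
    rewrite Hk in D by auto. rewrite Rmult_0_r, Rmult_0_l, Ropp_0 in D. exact D. }
  assert (Hty : forall t, 0 <= t <= 1 -> ty t = ty 0).
  { apply (constant_in u01). intros t Ht.
    pose proof (is_derive_in_tangent_y u01 g Hs Hr t Ht) as D. fold k ty in D.
    rewrite Hk in D by auto. rewrite Rmult_0_r, Rmult_0_l in D. exact D. }
  pose proof (displacement_of_constant_tangent y ty (ty 0) Dy Hty) as E.
  destruct ends as [_ [E0 [_ E1]]]. rewrite E0, E1 in E.
  assert (Hz : ty 0 = 0) by nra.
  pose proof (tangent_unit g 0 Hr ltac:(lra)) as Hu. fold tx ty in Hu. rewrite Hz in Hu.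
  apply (not_straight (tx 0)); auto. lra.
Qed.

Let a0 := - lam / C.

(** This is where the curvature is eliminated between the two elastica equations. *)
Lemma tangent_x_of_height t : 0 <= t <= 1 -> tx t = C / 4 * y t ^ 2 + a0.
Proof.
  intros Ht. destruct (Hel t Ht) as [E1 E2]. rewrite E1 in E2. fold tx y in E2.
  pose proof multiplier_nonzero as HC.
  apply (Rmult_eq_reg_l C); auto. rewrite <- E2. unfold a0. field. auto.
Qed.

Lemma height_equation t : 0 <= t <= 1 ->
  is_derive_in 0 1 ty t (v t * ((- C * a0 / 2) * y t + (- C ^ 2 / 8) * y t ^ 3)).
Proof.
  intros Ht. pose proof (is_derive_in_tangent_y u01 g Hs Hr t Ht) as D. fold tx ty v k in D.
  replace (v t * (_ + _)) with (v t * k t * tx t); [exact D|].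
  rewrite tangent_x_of_height by auto. destruct (Hel t Ht) as [E1 _]. unfold k. rewrite E1.
  fold y. field.
Qed.

Lemma tangent_x_0 : tx 0 = a0.
Proof.
  rewrite tangent_x_of_height by lra. destruct ends as [_ [-> _]]. ring.
Qed.

(** A horizontal start would make the height vanish identically, by uniqueness. *)
Lemma initial_slope_nonzero : ty 0 <> 0.
Proof.
  intros H0. destruct ends as [_ [E0 _]].
  assert (H : forall t, 0 <= t <= 1 -> y t = 0 /\ ty t = 0).
  { apply (duffing_unique v (- C * a0 / 2) (- C ^ 2 / 8) y ty (fun _ => 0) (fun _ => 0)); auto.
    - apply (smooth_in_cont u01), (smooth_in_speed u01); auto.
    - apply height_equation.
    - intros t Ht. rewrite Rmult_0_r. apply is_derive_in_const; auto.
    - intros t Ht. replace (v t * _) with 0 by ring. apply is_derive_in_const; auto. }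
  pose proof (tangent_unit g 0 Hr ltac:(lra)) as Hu. fold tx ty in Hu.
  rewrite H0, tangent_x_0 in Hu.
  apply (not_straight a0); [lra|].
  intros t Ht. rewrite tangent_x_of_height by auto. destruct (H t Ht) as [-> _]. ring.
Qed.

(** The parameters are forced: [C = 2 sx omega ^ 2], and at the start, where the
    height is 0, the horizontal component [1 - 2 p ^ 2] of the tangent of the
    wave must equal [sx * a0]. *)
Lemma elastica_is_wave : exists p n sx sy,
  0 < p < 1 /\ (sx = 1 \/ sx = -1) /\ (sy = 1 \/ sy = -1) /\
  l = sx * (L * (2 * (ellE p / ellK p) - 1)) /\
  forall t, 0 <= t <= 1 -> g t = (sx * wave_X p (wave_number L p n) (arc t),
                                  sy * wave_Y p (wave_number L p n) (arc t)).
Proof.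
  pose proof multiplier_nonzero as HC. pose proof initial_slope_nonzero as Hb.
  destruct ends as [Ex0 [Ey0 [Ex1 Ey1]]].
  pose proof (tangent_unit g 0 Hr ltac:(lra)) as Hu. fold tx ty in Hu. rewrite tangent_x_0 in Hu.
  assert (Ha : -1 < a0 < 1) by (assert (0 < ty 0 ^ 2) by nra; split; nra).
  (* the sign of C selects a hat or a check curve, that of the initial slope the reflection in the x-axis *)
  assert (Hsx : exists sx, (sx = 1 \/ sx = -1) /\ 0 < sx * C).
  { destruct (Rtotal_order C 0) as [|[|]]; [exists (-1) | contradiction | exists 1]; split; auto; lra. }
  assert (Hsy : exists sy, (sy = 1 \/ sy = -1) /\ 0 < sy * ty 0).
  { destruct (Rtotal_order (ty 0) 0) as [|[|]]; [exists (-1) | contradiction | exists 1]; split; auto; lra. }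
  destruct Hsx as [sx [Hsx HsC]]. destruct Hsy as [sy [Hsy Hsb]].
  assert (Hsx2 : sx ^ 2 = 1) by (destruct Hsx; subst; ring).
  assert (Hsy2 : sy ^ 2 = 1) by (destruct Hsy; subst; ring).
  set (omega := sqrt (sx * C / 2)).
  assert (Ho2 : omega ^ 2 = sx * C / 2) by (apply pow2_sqrt; lra).
  assert (Ho : 0 < omega) by (apply sqrt_lt_R0; lra).
  assert (EC : C = 2 * sx * omega ^ 2).
  { rewrite Ho2. transitivity (sx ^ 2 * C); [rewrite Hsx2|]; field. }
  assert (Hsa : -1 < sx * a0 < 1) by (destruct Hsx; subst sx; lra).
  set (p := sqrt ((1 - sx * a0) / 2)).
  assert (Hp2 : p ^ 2 = (1 - sx * a0) / 2) by (apply pow2_sqrt; lra).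
  assert (Hp : 0 < p < 1).
  { assert (0 < p) by (apply sqrt_lt_R0; lra). split; auto. nra. }
  assert (Ea : sx * a0 = 1 - 2 * p ^ 2) by lra.
  assert (Ea' : a0 = sx * (1 - 2 * p ^ 2)).
  { rewrite <- Ea. transitivity (sx ^ 2 * a0); [rewrite Hsx2|]; ring. }
  destruct (wave_at_0 p omega Hp) as [X0 [Y0 [T0 T0']]].
  (* the slopes agree up to sign because both tangents have length 1; sy was chosen to fix the sign *)
  assert (Eb : ty 0 = sy * wave_Ty p omega 0).
  { assert (E : (sy * ty 0) ^ 2 = wave_Ty p omega 0 ^ 2).
    { rewrite T0', Rpow_mult_distr, Hsy2. replace (ty 0 ^ 2) with (1 - a0 ^ 2) by lra.
      rewrite Ea'. transitivity (1 - sx ^ 2 * (1 - 2 * p ^ 2) ^ 2); [ring|rewrite Hsx2; ring]. }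
    assert (E' : sy * ty 0 = wave_Ty p omega 0) by (apply Rsqr_inj; unfold Rsqr; lra).
    rewrite <- E'. transitivity (sy ^ 2 * ty 0); [rewrite Hsy2|]; ring. }
  assert (HSo : forall F dF t, 0 <= t <= 1 -> (forall s, is_derive F s (dF s)) ->
            forall c, is_derive_in 0 1 (fun t => c * F (arc t)) t (v t * (c * dF (arc t)))).
  { intros F dF t Ht HF c.
    replace (v t * (c * dF (arc t))) with (0 * F (arc t) + c * (v t * dF (arc t))) by ring.
    apply (is_derive_in_mult (fun _ => c) (fun t => F (arc t))); auto; [apply is_derive_in_const; auto|].
    apply (is_derive_in_outer arc t (v t) F); auto. }
  assert (S0 : arc 0 = 0) by apply arclength_0.
  assert (S1 : arc 1 = L) by (apply (arclength_1 l L g Hadm)).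
  assert (HY : forall t, 0 <= t <= 1 -> y t = sy * wave_Y p omega (arc t)).
  { intros t Ht.
    apply (duffing_unique v (- C * a0 / 2) (- C ^ 2 / 8) y ty
       (fun t => sy * wave_Y p omega (arc t)) (fun t => sy * wave_Ty p omega (arc t))); auto.
    - apply (smooth_in_cont u01), (smooth_in_speed u01); auto.
    - apply height_equation.
    - intros u Hu'. apply (HSo (wave_Y p omega) (wave_Ty p omega)); auto. apply is_derive_wave_Y; auto.
    - intros u Hu'.
      replace (v u * _) with (v u * (sy * (- omega ^ 2 * wave_Y p omega (arc u) * wave_Tx p omega (arc u)))).
      + apply (HSo (wave_Ty p omega) (fun s => - omega ^ 2 * wave_Y p omega s * wave_Tx p omega s)); auto.
        apply is_derive_wave_Ty; auto.
      + f_equal. unfold wave_Tx. set (Yu := wave_Y p omega (arc u)). rewrite EC, Ea'.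
        transitivity (- sx ^ 2 * omega ^ 2 * (1 - 2 * p ^ 2) * (sy * Yu)
          - sx ^ 2 * sy ^ 2 * omega ^ 4 / 2 * (sy * Yu ^ 3)).
        * rewrite Hsx2, Hsy2. field.
        * field.
    - rewrite S0, Y0, Ey0. ring.
    - rewrite S0. exact Eb. }
  assert (HX : forall t, 0 <= t <= 1 -> x t = sx * wave_X p omega (arc t)).
  { intros t Ht.
    assert (H : x t + - sx * wave_X p omega (arc t) = x 0 + - sx * wave_X p omega (arc 0)).
    { apply (constant_in u01 (fun t => x t + - sx * wave_X p omega (arc t))); auto.
      intros u Hu'.
      assert (A : v u * tx u + v u * (- sx * wave_Tx p omega (arc u)) = 0).
      { rewrite tangent_x_of_height, HY by auto. unfold wave_Tx. rewrite EC, Ea'.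
        set (Yu := wave_Y p omega (arc u)).
        transitivity (v u * sx * omega ^ 2 / 2 * Yu ^ 2 * (sy ^ 2 - 1)); [field | rewrite Hsy2; ring]. }
      refine (eq_ind _ (is_derive_in 0 1 _ u) _ _ A).
      apply (is_derive_in_plus x (fun t => - sx * wave_X p omega (arc t))); auto.
      apply (HSo (wave_X p omega) (wave_Tx p omega)); auto. apply is_derive_wave_X; auto. }
    rewrite S0, X0, Ex0 in H. lra. }
  assert (Hn : exists n, omega * L = 2 * (INR n + 1) * ellK p).
  { apply (cn_zero p Hp); [apply Rmult_lt_0_compat; lra|].
    pose proof (HY 1 ltac:(lra)) as E. rewrite Ey1, S1 in E. unfold wave_Y in E.
    assert (0 < 2 * p / omega) by (apply Rdiv_lt_0_compat; lra).
    destruct Hsy; subst sy; nra. }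
  destruct Hn as [n Hn].
  assert (Eo : omega = wave_number L p n) by (unfold wave_number; rewrite <- Hn; field; lra).
  exists p, n, sx, sy. repeat split; auto; try lra.
  - rewrite <- (wave_X_end L p n), <- Eo by (auto; lra).
    rewrite <- Ex1, <- S1. apply HX. lra.
  - intros t Ht. rewrite <- Eo, <- HX, <- HY by auto. apply surjective_pairing.
Qed.

End Solve.

(** * The classification *)

Theorem theorem1p1 (l L : R) (hl : 0 < l) (hL : l < L) :
  exists phat pcheck : R,
    unique (hat_modulus l L) phat /\
    unique (check_modulus l L) pcheck /\
    forall gamma : R -> R * R,
      critical_point l L gamma <->
      admissible l L gamma /\
      exists n : nat,
        equal_on 0 L (arclength_reparam gamma) (hat_plus L phat n) \/
        equal_on 0 L (arclength_reparam gamma) (hat_minus L phat n) \/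
        equal_on 0 L (arclength_reparam gamma) (check_plus L pcheck n) \/
        equal_on 0 L (arclength_reparam gamma) (check_minus L pcheck n).
Proof.
  assert (Hq : 0 < l / L < 1).
  { split; [apply Rdiv_lt_0_compat; lra|]. apply (Rmult_lt_reg_r L); [lra|].
    unfold Rdiv. rewrite Rmult_assoc, Rinv_l; lra. }
  destruct (modulus_exists ((1 + l / L) / 2)) as [phat [Hph Eph]]; [lra|].
  destruct (modulus_exists ((1 - l / L) / 2)) as [pcheck [Hpc Epc]]; [lra|].
  assert (Uh : forall p, hat_modulus l L p -> phat = p).
  { intros p [Hp E]. apply (modulus_unique ((1 + l / L) / 2)); auto. lra. }
  assert (Uc : forall p, check_modulus l L p -> pcheck = p).
  { intros p [Hp E]. apply (modulus_unique ((1 - l / L) / 2)); auto. lra. }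
  exists phat, pcheck. split; [|split].
  - split; [split; auto; lra | auto].
  - split; [split; auto; lra | auto].
  - intros gamma. split.
    + intros [Hadm [lam Hcrit]]. split; auto.
      assert (H := Hadm). destruct H as [Hs [Hg0 [Hg1 [Hr _]]]].
      destruct (critical_elastica l lam gamma hl Hs Hr Hg0 Hg1 Hcrit) as [C Hel].
      destruct (elastica_is_wave l L gamma C lam hl hL Hadm Hel)
        as [p [n [sx [sy [Hp [Hsx [Hsy [El Hg]]]]]]]].
      assert (E : l / L = sx * (2 * (ellE p / ellK p) - 1)).
      { rewrite El at 1. field. pose proof (ellK_pos p Hp). lra. }
      exists n. rewrite !(equal_on_arclength_iff l L gamma Hadm).
      destruct Hsx; subst sx.
      * assert (phat = p) by (apply Uh; split; auto; lra). subst p.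
        destruct Hsy; subst sy; [left | right; left]; intros t Ht; rewrite Hg by auto;
          unfold hat_plus, hat_minus; rewrite X_hat_eq, Y_hat_eq by (auto; lra); f_equal; ring.
      * assert (pcheck = p) by (apply Uc; split; auto; lra). subst p.
        destruct Hsy; subst sy; right; right; [left | right]; intros t Ht; rewrite Hg by auto;
          unfold check_plus, check_minus; rewrite X_check_eq, Y_check_eq by (auto; lra); f_equal; ring.
    + intros [Hadm [n Hn]]. split; auto.
      assert (H := Hadm). destruct H as [Hs [_ [_ [Hr _]]]].
      rewrite !(equal_on_arclength_iff l L gamma Hadm) in Hn.
      assert (Hw : exists p sx sy, 0 < p < 1 /\ sx ^ 2 = 1 /\ sy ^ 2 = 1 /\
        forall t, 0 <= t <= 1 -> gamma t = (sx * wave_X p (wave_number L p n) (arclength gamma t),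
                                  sy * wave_Y p (wave_number L p n) (arclength gamma t))).
      { destruct Hn as [Hn|[Hn|[Hn|Hn]]];
        [exists phat, 1, 1 | exists phat, 1, (-1) | exists pcheck, (-1), 1 | exists pcheck, (-1), (-1)];
        (split; [auto|split; [ring|split; [ring|]]]); intros t Ht; rewrite (Hn t Ht) at 1;
        unfold hat_plus, hat_minus, check_plus, check_minus;
        rewrite ?X_hat_eq, ?Y_hat_eq, ?X_check_eq, ?Y_check_eq by (auto; lra); f_equal; ring. }
      destruct Hw as [p [sx [sy [Hp [Hsx [Hsy Hg]]]]]].
      assert (Ho : 0 < wave_number L p n) by (apply wave_number_pos; auto; lra).
      exists (- 2 * wave_number L p n ^ 2 * (1 - 2 * p ^ 2)).
      exact (elastica_critical l gamma _ _ Hs Hr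
        (wave_elastica l L gamma p (wave_number L p n) sx sy Hadm Hp Ho Hsx Hsy Hg)).
Qed.
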